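(* Let $n\in\mathbb{N}$. Let $\mathcal{A}$ be the set of all $f\in L^\infty(\mathbb{C}^n)$ such that $$\lim_{t\to0}\|T_f^{(t)}T_g^{(t)}-T_{fg}^{(t)}\|_t=0\quad\text{and}\quad \lim_{t\to0}\|T_g^{(t)}T_f^{(t)}-T_{fg}^{(t)}\|_t=0\quad\text{for all } g\in L^\infty(\mathbb{C}^n),$$ and let $\mathcal{B}$ be the set of all $f\in L^\infty(\mathbb{C}^n)$ with $\lim_{t\to0}\|f\|_{\mathrm{BMO}_*^t}=0$. Then $$\mathcal{A}=\mathcal{B}=\mathrm{VMO}(\mathbb{C}^n)\cap L^\infty(\mathbb{C}^n).$$
   Context: For $t>0$ let $d\mu_t(z)=\frac{1}{(4\pi t)^n}e^{-|z|^2/(4t)}\,dv(z)$ on $\mathbb{C}^n$, where $dv$ is Lebesgue measure, let $L_t^2=L^2(\mathbb{C}^n,d\mu_t)$ with norm $\|\cdot\|_t$, let $H_t^2$ be the closed subspace of entire functions in $L_t^2$, and let $P^{(t)}:L_t^2\to H_t^2$ be the orthogonal projection. For $f\in L^\infty(\mathbb{C}^n)$ the Toeplitz operator is $T_f^{(t)}:H_t^2\to H_t^2$, $T_f^{(t)}h=P^{(t)}(fh)$; $\|X\|_t$ also denotes the operator norm. The heat transform is $\tilde f^{(t)}(w)=\int_{\mathbb{C}^n}f(w-z)\,d\mu_t(z)$, the mean oscillation is $\mathrm{MO}^t(f)(w)=\int_{\mathbb{C}^n}|f(w-z)-\tilde f^{(t)}(w)|^2\,d\mu_t(z)$, and $\|f\|_{\mathrm{BMO}_*^t}=\sup_{w\in\mathbb{C}^n}\sqrt{\mathrm{MO}^t(f)(w)}$.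 Identify $\mathbb{C}^n$ with $\mathbb{R}^{2n}$. For a locally integrable function $f$ and a bounded measurable set $E$ of positive measure $|E|$, put $f_E=\frac1{|E|}\int_E f\,dv$ and $\mathrm{Osc}_E(f)=\frac{1}{|E|}\int_E|f-f_E|\,dv$. Then $f\in\mathrm{VMO}(\mathbb{C}^n)$ means that $\{\mathrm{Osc}_E(f): E \text{ a cube in } \mathbb{R}^{2n}\}$ is bounded and $\lim_{a\to0}\sup\{\mathrm{Osc}_E(f): E\text{ a cube},\ |E|\le a\}=0$. *)

(* Defs.v *)
From HB Require Import structures.
From mathcomp Require Import all_boot all_order all_algebra.
From mathcomp Require Import complex.
From mathcomp Require Import all_classical all_reals all_analysis.
From mathcomp Require Import measurable_realfun.

Set Implicit Arguments.
Unset Strict Implicit.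
Unset Printing Implicit Defensive.
Import Order.TTheory GRing.Theory Num.Theory.
Import ComplexField.Normc.
Import numFieldNormedType.Exports.

Local Open Scope classical_set_scope.
Local Open Scope ring_scope.
Local Open Scope complex_scope.

(* topology and norm of R[i] as a normed module over itself *)
HB.instance Definition _ (R : realType) := NormedModule.copy R[i] R[i]^o.
HB.instance Definition _ (R : realType) := Pointed.copy R[i] R[i]^o.

Section sigma_finite_product.
Local Open Scope ereal_scope.
Context d1 d2 (T1 : measurableType d1) (T2 : measurableType d2) (R : realType).
Variables (m1 : {sigma_finite_measure set T1 -> \bar R})
  (m2 : {sigma_finite_measure set T2 -> \bar R}).

(* The canonical sigma-finite structure of m1 \x m2 is only found for
   subprobabilities; sigma_prod is m1 \x m2 with the general one. *)
Definition sigma_prod : set (T1 * T2) -> \bar R := m1 \x m2.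

HB.instance Definition _ := Measure.on sigma_prod.

Let sigma_prod_sigma_finite : sigma_finite setT sigma_prod.
Proof.
have /sigma_finiteP[F [TF ndF Foo]] := sigma_finiteT m1.
have /sigma_finiteP[G [TG ndG Goo]] := sigma_finiteT m2.
exists (fun n => F n `*` G n).
  rewrite -setXTT TF TG predeqE => -[x y]; split.
    move=> [/= [n _ Fnx] [k _ Gky]]; exists (maxn n k) => //; split.
    - by move: x Fnx; exact/subsetPset/ndF/leq_maxl.
    - by move: y Gky; exact/subsetPset/ndG/leq_maxr.
  by move=> [n _ []/= ? ?]; split; exists n.
move=> k; have [? ?] := Foo k; have [? ?] := Goo k.
split; first exact: measurableX.
by rewrite /sigma_prod product_measure1E// lte_mul_pinfty// ge0_fin_numE.
Qed.

HB.instance Definition _ := @Measure_isSigmaFinite.Build _ _ _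
  sigma_prod sigma_prod_sigma_finite.

End sigma_finite_product.

Section tuple_measure_step.
Local Open Scope ereal_scope.
Context d (T : measurableType d) (R : realType) (n : nat).
Variables (m : {sigma_finite_measure set T -> \bar R})
  (mn : {sigma_finite_measure set (n.-tuple T) -> \bar R}).

Definition consT (x : T * n.-tuple T) : n.+1.-tuple T := cons_tuple x.1 x.2.

Lemma measurable_consT : measurable_fun [set: T * n.-tuple T] consT.
Proof. exact: measurable_cons. Qed.

Definition tuple_measure_step : set (n.+1.-tuple T) -> \bar R :=
  pushforward (sigma_prod m mn) consT.

Let step0 : tuple_measure_step set0 = 0.
Proof. by rewrite /tuple_measure_step /pushforward preimage_set0 measure0. Qed.

Let step_ge0 A : 0 <= tuple_measure_step A.
Proof. by rewrite /tuple_measure_step /pushforward. Qed.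

Let step_sigma_additive : semi_sigma_additive tuple_measure_step.
Proof.
move=> F mF tF mUF; rewrite /tuple_measure_step /pushforward preimage_bigcup.
have mG k : measurable (consT @^-1` F k).
  by rewrite -[X in measurable X]setTI; exact: measurable_consT.
apply: measure_semi_sigma_additive => //.
- apply/trivIsetP => /= i j _ _ ij; rewrite -preimage_setI.
  by move/trivIsetP : tF => /(_ _ _ _ _ ij) ->//; rewrite preimage_set0.
- exact: bigcup_measurable.
Qed.

HB.instance Definition _ := isMeasure.Build _ _ _ tuple_measure_step
  step0 step_ge0 step_sigma_additive.

Let step_sigma_finite : sigma_finite setT tuple_measure_step.
Proof.
have [F UF mF] := sigma_finiteT (sigma_prod m mn).
pose u (t : n.+1.-tuple T) := (tnth t ord0, [tuple of behead t]).
have mu : measurable_fun setT u.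
  by apply: measurable_fun_pair;
    [exact: measurable_tnth|exact: measurable_behead].
have uK : cancel u consT by move=> t; rewrite [RHS]tuple_eta.
have Ku : cancel consT u.
  by case=> x t; rewrite /u /consT tnth0; congr pair; exact: val_inj.
exists (fun k => u @^-1` F k).
  by rewrite -preimage_bigcup -UF preimage_setT.
move=> k; have [mFk Fkoo] := mF k; split.
  by rewrite -[X in measurable X]setTI; exact: mu.
rewrite /tuple_measure_step /pushforward -comp_preimage.
by rewrite (_ : u \o consT = id) ?preimage_id//; apply/funext => x /=; rewrite Ku.
Qed.

HB.instance Definition _ := @Measure_isSigmaFinite.Build _ _ _
  tuple_measure_step step_sigma_finite.

End tuple_measure_step.

(* the n-fold product measure m x ... x m *)
Fixpoint tuple_measure d (T : measurableType d) (R : realType)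
    (m : {sigma_finite_measure set T -> \bar R}) (n : nat) :
    {sigma_finite_measure set (n.-tuple T) -> \bar R} :=
  match n with
  | 0%N => \d_([tuple] : 0.-tuple T)
  | k.+1 => tuple_measure_step m (tuple_measure m k)
  end.

(* 'rV[R[i]]_n carries the Borel sigma-algebra of R^(2n), generated by the real
   and imaginary parts of the coordinates. *)
Section Cn_measurable.
Context (R : realType) (n : nat).

Definition Cn_coord (i : 'I_n) (z : 'rV[R[i]]_n) :
    measurableTypeR R * measurableTypeR R :=
  (complex.Re (z 0 i), complex.Im (z 0 i)).

Let Cn_set0 : g_sigma_preimage Cn_coord set0.
Proof. exact: sigma_algebra0. Qed.

Let Cn_setC A : g_sigma_preimage Cn_coord A ->
  g_sigma_preimage Cn_coord (~` A).
Proof. exact: sigma_algebraC. Qed.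

Let Cn_bigcup (F : _^nat) : (forall i, g_sigma_preimage Cn_coord (F i)) ->
  g_sigma_preimage Cn_coord (\bigcup_i (F i)).
Proof. exact: sigma_algebra_bigcup. Qed.

HB.instance Definition _ := @isMeasurable.Build default_measure_display
  'rV[R[i]]_n (g_sigma_preimage Cn_coord) Cn_set0 Cn_setC Cn_bigcup.

Lemma measurable_Cn_coord i : measurable_fun setT (Cn_coord i).
Proof.
move=> _ Y mY; rewrite setTI; apply: sub_sigma_algebra => /=.
rewrite -bigcup_seq/=; exists i => /=; first by rewrite mem_index_enum.
by exists Y => //; rewrite setTI.
Qed.

End Cn_measurable.

Section lebesgue_Cn.
Local Open Scope ereal_scope.
Context (R : realType) (n : nat).
Local Notation RR := (measurableTypeR R * measurableTypeR R)%type.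

Definition Cn_of_coords (x : n.-tuple RR) : 'rV[R[i]]_n :=
  \row_i ((tnth x i).1 +i* (tnth x i).2).

Lemma measurable_Cn_of_coords : measurable_fun setT Cn_of_coords.
Proof.
have Ec : (fun i => @Cn_coord R n i \o Cn_of_coords) =
          (fun i x => tnth x i).
  by apply/funext => i; apply/funext => x /=;
    rewrite /Cn_coord mxE -surjective_pairing.
move=> _ A mA.
suff : g_sigma_preimage (fun i => @Cn_coord R n i \o Cn_of_coords)
         (setT `&` Cn_of_coords @^-1` A) by rewrite Ec.
by rewrite g_sigma_preimage_comp; exists A.
Qed.

Definition lebesgue_Cn : set 'rV[R[i]]_n -> \bar R :=
  pushforward (tuple_measure (sigma_prod (@lebesgue_measure R) (@lebesgue_measure R)) n)
    Cn_of_coords.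

Let leb0 : lebesgue_Cn set0 = 0.
Proof. by rewrite /lebesgue_Cn /pushforward preimage_set0 measure0. Qed.

Let leb_ge0 A : 0 <= lebesgue_Cn A.
Proof. by rewrite /lebesgue_Cn /pushforward. Qed.

Let leb_sigma_additive : semi_sigma_additive lebesgue_Cn.
Proof.
move=> F mF tF mUF; rewrite /lebesgue_Cn /pushforward preimage_bigcup.
have mG k : measurable (Cn_of_coords @^-1` F k).
  by rewrite -[X in measurable X]setTI; exact: measurable_Cn_of_coords.
apply: measure_semi_sigma_additive => //.
- apply/trivIsetP => /= i j _ _ ij; rewrite -preimage_setI.
  by move/trivIsetP : tF => /(_ _ _ _ _ ij) ->//; rewrite preimage_set0.
- exact: bigcup_measurable.
Qed.

HB.instance Definition _ := isMeasure.Build _ _ _ lebesgue_Cn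
  leb0 leb_ge0 leb_sigma_additive.

End lebesgue_Cn.
Arguments lebesgue_Cn : clear implicits.

Section gauss_Cn.
Local Open Scope ereal_scope.
Context (R : realType) (n : nat).

Definition sqnormCn (z : 'rV[R[i]]_n) : R :=
  (\sum_(i < n) normc (z 0 i) ^+ 2)%R.

(* only meant for 0 < t; the value 0 elsewhere makes gauss_Cn t a measure for
   every t *)
Definition gauss_density (t : R) (z : 'rV[R[i]]_n) : R :=
  (if 0 < t then expR (- (sqnormCn z / (4 * t))) / (4 * pi * t) ^+ n else 0)%R.

Lemma gauss_density_ge0 t z : (0 <= gauss_density t z)%R.
Proof.
rewrite /gauss_density; case: ifPn => // t0.
by rewrite divr_ge0 ?expR_ge0// exprn_ge0// !mulr_ge0 ?pi_ge0// ltW.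
Qed.

Lemma measurable_sqnormCn : measurable_fun setT sqnormCn.
Proof.
apply: measurable_sum => i; apply: measurable_funX.
have mc := @measurable_Cn_coord R n i.
have -> : (fun z : 'rV[R[i]]_n => normc (z 0%R i)) =
    (fun z => Num.sqrt ((Cn_coord i z).1 ^+ 2 + (Cn_coord i z).2 ^+ 2)%R).
  by apply/funext => z; rewrite /Cn_coord /=; case: (z 0%R i).
apply: (measurableT_comp (continuous_measurable_fun (@sqrt_continuous R))).
by apply: measurable_funD; apply: measurable_funX;
  exact: measurableT_comp mc.
Qed.

Lemma measurable_gauss_density t : measurable_fun setT (gauss_density t).
Proof.
rewrite /gauss_density; case: (0 < t)%R => //.
apply: measurable_funM => //; apply: (measurableT_comp (@measurable_expR R)).
apply: measurable_funN; apply: measurable_funM => //.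
exact: measurable_sqnormCn.
Qed.

Definition gauss_Cn (t : R) (A : set 'rV[R[i]]_n) : \bar R :=
  \int[lebesgue_Cn R n]_(z in A) (gauss_density t z)%:E.

Let gauss0 t : gauss_Cn t set0 = 0.
Proof. exact: integral_set0. Qed.

Let gauss_ge0 t A : 0 <= gauss_Cn t A.
Proof. by apply: integral_ge0 => z _; rewrite lee_fin gauss_density_ge0. Qed.

Let gauss_sigma_additive t : semi_sigma_additive (gauss_Cn t).
Proof.
move=> F mF tF mUF; rewrite /gauss_Cn ge0_integral_bigcup//.
- apply/cvg_closeP; split; last by rewrite closeE.
  by apply: is_cvg_nneseries => k _ _; exact: gauss_ge0.
- apply: measurable_funTS; apply/measurable_EFinP.
  exact: measurable_gauss_density.
- by move=> z _; rewrite lee_fin gauss_density_ge0.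
Qed.

HB.instance Definition _ t := isMeasure.Build _ _ _ (gauss_Cn t)
  (gauss0 t) (gauss_ge0 t) (@gauss_sigma_additive t).

End gauss_Cn.
Arguments gauss_Cn {R} n t.

Section complex_valued.
Context (R : realType) d (T : measurableType d).
Implicit Types (f : T -> R[i]) (mu : {measure set T -> \bar R}).

Definition cmeasurable f :=
  measurable_fun setT (fun z => complex.Re (f z)) /\
  measurable_fun setT (fun z => complex.Im (f z)).

Definition cintegral mu (D : set T) f : R[i] :=
  (\int[mu]_(z in D) complex.Re (f z)) +i* (\int[mu]_(z in D) complex.Im (f z)).

Definition cLnorm mu (p : \bar R) f : \bar R :=
  ('N[mu]_p [EFin \o (fun z => normc (f z))])%E.

(* a set of functions, not of almost-everywhere classes *)
Definition cLp mu (p : \bar R) : set (T -> R[i]) :=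
  [set f | cmeasurable f /\ (cLnorm mu p f < +oo)%E].

End complex_valued.

Section toeplitz.
Context (R : realType) (n : nat).
Local Notation Cn := 'rV[R[i]]_n.
Implicit Types (f g h : Cn -> R[i]) (t : R) (w z : Cn).

Definition Linfty : set (Cn -> R[i]) := cLp (lebesgue_Cn R n) +oo%E.

Definition L2 t : set (Cn -> R[i]) := cLp (gauss_Cn n t) 2%:E.

Definition L2norm t f : \bar R := cLnorm (gauss_Cn n t) 2%:E f.

Definition L2dot t f g : R[i] :=
  cintegral (gauss_Cn n t) setT (fun z => f z * (g z)^*).

(* complex Frechet differentiability at every point: R[i] is the field of
   scalars of both normed modules *)
Definition entire f := forall z, differentiable f z.

Definition H2 t : set (Cn -> R[i]) := [set h | L2 t h /\ entire h].

(* The orthogonal projection P^(t) h is the g in H2 t with h - g orthogonal to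
   H2 t; it is unique as a function, because entire functions that are equal
   almost everywhere are equal. *)
Definition bergman_proj t h : Cn -> R[i] :=
  xget (fun=> 0) [set g | H2 t g /\
    forall k, H2 t k -> L2dot t (fun z => h z - g z) k = 0].

Definition toeplitz t f h : Cn -> R[i] := bergman_proj t (fun z => f z * h z).

Definition opnorm t (X : (Cn -> R[i]) -> (Cn -> R[i])) : \bar R :=
  ereal_sup [set L2norm t (X h) | h in [set h | H2 t h /\ (L2norm t h <= 1)%E]].

Definition heat t f w : R[i] :=
  cintegral (gauss_Cn n t) setT (fun z => f (w - z)).

Definition MO t f w : \bar R :=
  (\int[gauss_Cn n t]_z ((normc (f (w - z) - heat t f w)) ^+ 2)%:E)%E.

Definition BMOnorm t f : \bar R := ereal_sup [set sqrte (MO t f w) | w in setT].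

(* closed cube of R^(2n) with sides parallel to the axes, corner c and side
   length l *)
Definition cube (c : Cn) (l : R) : set Cn :=
  [set z | forall i,
    complex.Re (c 0 i) <= complex.Re (z 0 i) <= complex.Re (c 0 i) + l /\
    complex.Im (c 0 i) <= complex.Im (z 0 i) <= complex.Im (c 0 i) + l].

Definition is_cube (E : set Cn) := exists c l, 0 < l /\ E = cube c l.

Definition mean (E : set Cn) f : R[i] :=
  ((fine (lebesgue_Cn R n E))^-1)%:C * cintegral (lebesgue_Cn R n) E f.

Definition Osc (E : set Cn) f : \bar R :=
  (((fine (lebesgue_Cn R n E))^-1)%:E *
   \int[lebesgue_Cn R n]_(z in E) (normc (f z - mean E f))%:E)%E.

Definition loc_integrable f :=
  cmeasurable f /\ forall K : set Cn, compact K ->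
    (\int[lebesgue_Cn R n]_(z in K) (normc (f z))%:E < +oo)%E.

Definition VMO : set (Cn -> R[i]) :=
  [set f | [/\ loc_integrable f,
    (exists M : R, forall E, is_cube E -> (Osc E f <= M%:E)%E) &
    ereal_sup [set Osc E f | E in
      [set E | is_cube E /\ (lebesgue_Cn R n E <= a%:E)%E]]
      @[a --> 0^'+] --> 0%E]].

Definition classA : set (Cn -> R[i]) :=
  [set f | Linfty f /\ forall g, Linfty g ->
    opnorm t (fun h z => toeplitz t f (toeplitz t g h) z
                         - toeplitz t (fun w => f w * g w) h z)
      @[t --> 0^'+] --> 0%E /\
    opnorm t (fun h z => toeplitz t g (toeplitz t f h) z
                         - toeplitz t (fun w => f w * g w) h z)
      @[t --> 0^'+] --> 0%E].

Definition classB : set (Cn -> R[i]) :=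
  [set f | Linfty f /\ BMOnorm t f @[t --> 0^'+] --> 0%E].

End toeplitz.
Arguments Linfty R n : clear implicits.
Arguments VMO R n : clear implicits.
Arguments classA R n : clear implicits.
Arguments classB R n : clear implicits.

(* Main.v *)
(** Against the Gaussian mu_t the projection P^(t) is the integral operator with
   kernel K(z, w) = exp(<z, w> / 4t): entire functions have the mean value
   property (Cauchy's theorem on rectangles, applied to s +i theta |->
   h(e^(s + i theta) z)), which gives the reproducing formula, and the Schur
   test gives boundedness.

   B is contained in A: with b the heat transform of f at time 2t, the Schur
   test bounds f h - P(b h) in L^2_t by sup_w MO^(2t) f(w) times the square of
   the norm of h, hence also the Hankel vector (I - P)(f h); and
   T_f T_g h - T_(fg) h = - P(f (I - P)(g h)).

   A is contained in B: take g = conj f and test T_g T_f - T_(fg) on the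
   normalized kernel k_w; this bounds (I - P)(f k_w), and symmetrically
   (I - P)(conj f k_w).  So z |-> f(w - z) and its conjugate are both close to
   holomorphic functions, which forces f(w - z) to be close to a constant.

   B = VMO: on a cube of side l the normalized Lebesgue measure is at most a
   constant times the Gaussian at time l^2 centred at a corner; conversely the
   Gaussian at time t is controlled by the cube of side sqrt(s t) up to a tail of
   mass O(e^(-s/32)). *)
From HB Require Import structures.
Require Import Defs.
From mathcomp Require Import all_boot all_order all_algebra.
From mathcomp Require Import complex.
From mathcomp Require Import all_classical all_reals all_analysis.
From mathcomp Require Import measurable_realfun ess_sup_inf ring lra.

Set Implicit Arguments.
Unset Strict Implicit.
Unset Printing Implicit Defensive.
Import Order.TTheory GRing.Theory Num.Theory.
Import ComplexField.Normc.
Import numFieldNormedType.Exports.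

Local Open Scope classical_set_scope.
Local Open Scope ring_scope.
Local Open Scope complex_scope.

(** * Complex-valued functions *)

Section complex_numbers.
Context {R : realType}.
Implicit Types x y z : R[i].

Lemma normc_ge0 x : 0 <= normc x.
Proof. by case: x => a b; exact: sqrtr_ge0. Qed.

Lemma normc_sqr x : normc x ^+ 2 = complex.Re x ^+ 2 + complex.Im x ^+ 2.
Proof. by case: x => a b /=; rewrite sqr_sqrtr// addr_ge0// sqr_ge0. Qed.

Lemma normcB x y : normc (x - y) = normc (y - x).
Proof. by rewrite -normcN opprB. Qed.

Lemma normc_conj x : normc x^* = normc x.
Proof. by case: x => a b /=; rewrite sqrrN. Qed.

Lemma normcR (a : R) : normc a%:C = `|a|.
Proof. by rewrite /= expr0n/= addr0 sqrtr_sqr. Qed.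

Lemma le_Re_normc x : `|complex.Re x| <= normc x.
Proof.
case: x => a b /=; rewrite -sqrtr_sqr ler_wsqrtr// lerDl; exact: sqr_ge0.
Qed.

Lemma le_Im_normc x : `|complex.Im x| <= normc x.
Proof.
case: x => a b /=; rewrite -sqrtr_sqr ler_wsqrtr// lerDr; exact: sqr_ge0.
Qed.

Lemma ler_normc_ReIm x : normc x <= `|complex.Re x| + `|complex.Im x|.
Proof.
rewrite -(@ler_pXn2r _ 2)// ?nnegrE ?normc_ge0 ?addr_ge0// normc_sqr sqrrD.
by rewrite !real_normK ?num_real// addrAC lerDl mulrn_wge0// mulr_ge0.
Qed.

Lemma normE_normc x : `|x| = (normc x)%:C.
Proof. by []. Qed.

Lemma conj_mulc x : x * x^* = (normc x ^+ 2)%:C.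
Proof.
by case: x => a b; apply/eqP; rewrite eq_complex normc_sqr/=; apply/andP;
  split; apply/eqP; ring.
Qed.

Lemma normc_sqrD x y : normc (x + y) ^+ 2 <= 2 * normc x ^+ 2 + 2 * normc y ^+ 2.
Proof.
case: x y => [a b] [c d]; rewrite !normc_sqr/=.
have := sqr_ge0 (a - c); have := sqr_ge0 (b - d); nra.
Qed.

End complex_numbers.

Section complex_measurable.
Context {R : realType} d (T : measurableType d).
Implicit Types f g : T -> R[i].

Lemma measurable_Re f : cmeasurable f ->
  measurable_fun setT (fun z => complex.Re (f z)).
Proof. by case. Qed.

Lemma measurable_Im f : cmeasurable f ->
  measurable_fun setT (fun z => complex.Im (f z)).
Proof. by case. Qed.

Lemma cmeasurable_cst (c : R[i]) : cmeasurable (fun _ : T => c).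
Proof. by split. Qed.

Lemma cmeasurableD f g : cmeasurable f -> cmeasurable g ->
  cmeasurable (fun z => f z + g z).
Proof.
move=> [f1 f2] [g1 g2]; split.
  under eq_fun do rewrite (raddfD (@complex.Re R : Rcomplex R -> R)).
  exact: measurable_funD.
under eq_fun do rewrite (raddfD (@complex.Im R : Rcomplex R -> R)).
exact: measurable_funD.
Qed.

Lemma cmeasurableN f : cmeasurable f -> cmeasurable (fun z => - f z).
Proof.
move=> [f1 f2]; split.
  under eq_fun do rewrite (raddfN (@complex.Re R : Rcomplex R -> R)).
  exact: measurable_funN.
under eq_fun do rewrite (raddfN (@complex.Im R : Rcomplex R -> R)).
exact: measurable_funN.
Qed.

Lemma cmeasurableB f g : cmeasurable f -> cmeasurable g ->
  cmeasurable (fun z => f z - g z).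
Proof. by move=> mf mg; apply: cmeasurableD => //; exact: cmeasurableN. Qed.

Lemma Re_mulc (x y : R[i]) : complex.Re (x * y) =
  complex.Re x * complex.Re y - complex.Im x * complex.Im y.
Proof. by case: x y => [a b] [c e]. Qed.

Lemma Im_mulc (x y : R[i]) : complex.Im (x * y) =
  complex.Re x * complex.Im y + complex.Im x * complex.Re y.
Proof. by case: x y => [a b] [c e]. Qed.

Lemma Re_conj (x : R[i]) : complex.Re x^* = complex.Re x.
Proof. by case: x. Qed.

Lemma Im_conj (x : R[i]) : complex.Im x^* = - complex.Im x.
Proof. by case: x. Qed.

Lemma cmeasurableM f g : cmeasurable f -> cmeasurable g ->
  cmeasurable (fun z => f z * g z).
Proof.
move=> [f1 f2] [g1 g2]; split.
  by under eq_fun do rewrite Re_mulc; apply: measurable_funB; exact: measurable_funM.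
by under eq_fun do rewrite Im_mulc; apply: measurable_funD; exact: measurable_funM.
Qed.

Lemma cmeasurable_conj f : cmeasurable f -> cmeasurable (fun z => (f z)^*).
Proof.
move=> [f1 f2]; split; first by under eq_fun do rewrite Re_conj.
by under eq_fun do rewrite Im_conj; exact: measurable_funN.
Qed.

Lemma cmeasurableR (h : T -> R) : measurable_fun setT h ->
  cmeasurable (fun z => (h z)%:C).
Proof. by move=> mh; split. Qed.

Lemma measurable_normc f : cmeasurable f ->
  measurable_fun setT (fun z => normc (f z)).
Proof.
move=> [f1 f2].
under eq_fun do
  rewrite -[normc _]ger0_norm ?normc_ge0// -sqrtr_sqr normc_sqr.
apply: (measurableT_comp (continuous_measurable_fun (@sqrt_continuous R))).
by apply: measurable_funD; exact: measurable_funX.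
Qed.

Lemma cmeasurable_comp d' (T' : measurableType d') (p : T' -> T) f :
  measurable_fun setT p -> cmeasurable f -> cmeasurable (f \o p).
Proof.
by move=> mp [f1 f2]; split; [exact: (measurableT_comp f1)|
  exact: (measurableT_comp f2)].
Qed.

End complex_measurable.

Section complex_integral.
Context {R : realType} d (T : measurableType d).
Variable mu : {measure set T -> \bar R}.
Implicit Types (f g : T -> R[i]) (D : set T).

Definition cintegrable D f :=
  cmeasurable f /\ (\int[mu]_(z in D) (normc (f z))%:E < +oo)%E.

Lemma cintegrable_Re D f : measurable D -> cintegrable D f ->
  mu.-integrable D (EFin \o (fun z => complex.Re (f z))).
Proof.
move=> mD [mf foo]; apply/integrableP; split.
  by apply/measurable_EFinP; apply: measurable_funTS; exact: measurable_Re.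
apply: le_lt_trans foo; apply: ge0_le_integral => //.
- apply: measurableT_comp => //; apply/measurable_EFinP; apply: measurable_funTS.
  exact: measurable_Re.
- by apply/measurable_EFinP; apply: measurable_funTS; exact: measurable_normc.
- by move=> z _; rewrite lee_fin le_Re_normc.
Qed.

Lemma cintegrable_Im D f : measurable D -> cintegrable D f ->
  mu.-integrable D (EFin \o (fun z => complex.Im (f z))).
Proof.
move=> mD [mf foo]; apply/integrableP; split.
  by apply/measurable_EFinP; apply: measurable_funTS; exact: measurable_Im.
apply: le_lt_trans foo; apply: ge0_le_integral => //.
- apply: measurableT_comp => //; apply/measurable_EFinP; apply: measurable_funTS.
  exact: measurable_Im.
- by apply/measurable_EFinP; apply: measurable_funTS; exact: measurable_normc.
- by move=> z _; rewrite lee_fin le_Im_normc.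
Qed.

Lemma measurable_EFin_normc D f : cmeasurable f ->
  measurable_fun D (fun z => (normc (f z))%:E).
Proof.
by move=> mf; apply/measurable_EFinP; apply: measurable_funTS;
  exact: measurable_normc.
Qed.

Lemma le_cintegrable D f (h : T -> R) : measurable D -> cmeasurable f ->
  measurable_fun setT h -> (\int[mu]_(z in D) (h z)%:E < +oo)%E ->
  (forall z, D z -> normc (f z) <= h z) -> cintegrable D f.
Proof.
move=> mD mf mh hoo fh; split => //; apply: le_lt_trans hoo.
apply: ge0_le_integral => //.
- by move=> z _; rewrite lee_fin normc_ge0.
- exact: measurable_EFin_normc.
- by apply/measurable_EFinP; exact: measurable_funTS.
Qed.

Lemma cintegrableD D f g : measurable D -> cintegrable D f -> cintegrable D g ->
  cintegrable D (fun z => f z + g z).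
Proof.
move=> mD [mf foo] [mg goo].
apply: (@le_cintegrable _ _ (fun z => normc (f z) + normc (g z))) => //.
- exact: cmeasurableD.
- by apply: measurable_funD; exact: measurable_normc.
- under eq_integral do rewrite EFinD.
  rewrite ge0_integralD//; first exact: lte_add_pinfty.
  all: try by move=> z _; rewrite lee_fin normc_ge0.
  1,2: exact: measurable_EFin_normc.
- by move=> z _; exact: le_normcD.
Qed.

Lemma cintegrableZ D f (c : R[i]) : measurable D -> cintegrable D f ->
  cintegrable D (fun z => c * f z).
Proof.
move=> mD [mf foo].
apply: (@le_cintegrable _ _ (fun z => normc c * normc (f z))) => //.
- by apply: cmeasurableM => //; exact: cmeasurable_cst.
- by apply: measurable_funM => //; exact: measurable_normc.
- under eq_integral do rewrite EFinM.
  rewrite ge0_integralZl_EFin ?normc_ge0//.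
  + by apply: lte_mul_pinfty => //; rewrite lee_fin normc_ge0.
  + by move=> z _; rewrite lee_fin normc_ge0.
  + exact: measurable_EFin_normc.
- by move=> z _; rewrite normcM.
Qed.

Lemma cintegrableN D f : measurable D -> cintegrable D f ->
  cintegrable D (fun z => - f z).
Proof.
by move=> mD /(cintegrableZ (-1) mD); under eq_fun do rewrite mulN1r.
Qed.

Lemma cintegrableB D f g : measurable D -> cintegrable D f -> cintegrable D g ->
  cintegrable D (fun z => f z - g z).
Proof. by move=> mD fi gi; apply: cintegrableD => //; exact: cintegrableN. Qed.

Lemma cintegrable_conj D f : cintegrable D f ->
  cintegrable D (fun z => (f z)^*).
Proof.
by move=> [mf foo]; split; [exact: cmeasurable_conj|
  under eq_integral do rewrite normc_conj].
Qed.

Lemma eq_cintegral D f g : {in D, f =1 g} ->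
  cintegral mu D f = cintegral mu D g.
Proof.
by move=> fg; rewrite /cintegral; congr (_ +i* _); apply: eq_Rintegral => z zD;
  rewrite fg.
Qed.

Lemma eq_cintegrable D f g : f =1 g -> cintegrable D f -> cintegrable D g.
Proof. by move=> /funext ->. Qed.

Lemma cintegralD D f g : measurable D -> cintegrable D f -> cintegrable D g ->
  cintegral mu D (fun z => f z + g z) = cintegral mu D f + cintegral mu D g.
Proof.
move=> mD fi gi; rewrite /cintegral.
under eq_Rintegral do rewrite (raddfD (@complex.Re R : Rcomplex R -> R)).
rewrite RintegralD//; [|exact: cintegrable_Re..].
under [in X in _ +i* X]eq_Rintegral do
  rewrite (raddfD (@complex.Im R : Rcomplex R -> R)).
by rewrite RintegralD//; exact: cintegrable_Im.
Qed.

Lemma cintegralZ D f (c : R[i]) : measurable D -> cintegrable D f ->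
  cintegral mu D (fun z => c * f z) = c * cintegral mu D f.
Proof.
move=> mD fi; rewrite /cintegral.
have iRe := cintegrable_Re mD fi; have iIm := cintegrable_Im mD fi.
have iZ (k : R) (h : T -> R) : mu.-integrable D (EFin \o h) ->
    mu.-integrable D (EFin \o (fun z => k * h z)).
  by move=> ih; exact: (integrableZl mD k ih).
under eq_Rintegral do rewrite Re_mulc.
rewrite RintegralB//; [|exact: iZ..].
under [in X in _ +i* X]eq_Rintegral do rewrite Im_mulc.
rewrite RintegralD//; [|exact: iZ..].
by rewrite !RintegralZl//; case: c => a b.
Qed.

Lemma cintegralN D f : measurable D -> cintegrable D f ->
  cintegral mu D (fun z => - f z) = - cintegral mu D f.
Proof.
move=> mD fi; rewrite -mulN1r -cintegralZ//.
by apply: eq_cintegral => z _; rewrite mulN1r.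
Qed.

Lemma cintegralB D f g : measurable D -> cintegrable D f -> cintegrable D g ->
  cintegral mu D (fun z => f z - g z) = cintegral mu D f - cintegral mu D g.
Proof.
by move=> mD fi gi; rewrite cintegralD// ?cintegralN//; exact: cintegrableN.
Qed.

Lemma cintegral_conj D f : measurable D -> cintegrable D f ->
  cintegral mu D (fun z => (f z)^*) = (cintegral mu D f)^*.
Proof.
move=> mD fi; rewrite /cintegral/=; congr (_ +i* _).
  by apply: eq_Rintegral => z _; rewrite Re_conj.
rewrite -[RHS]mulN1r -RintegralZl//; last exact: cintegrable_Im.
by apply: eq_Rintegral => z _; rewrite Im_conj mulN1r.
Qed.

Lemma cintegral_cst D (c : R[i]) : measurable D ->
  cintegral mu D (fun=> c) = c * (fine (mu D))%:C.
Proof.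
move=> mD; rewrite /cintegral !Rintegral_cst//.
by case: c => a b; apply/eqP; rewrite eq_complex/= !mulr0 subr0 add0r !eqxx.
Qed.

Lemma le_normc_cintegral D f : measurable D -> cintegrable D f ->
  ((normc (cintegral mu D f))%:E <= \int[mu]_(z in D) (normc (f z))%:E)%E.
Proof.
move=> mD fi; set I := cintegral mu D f.
have [->|I0] := eqVneq I 0.
  by rewrite normc0 integral_ge0// => z _; rewrite lee_fin normc_ge0.
have nI0 : normc I != 0 by apply: contra_neq I0 => /eq0_normc.
pose u := (normc I)^-1%:C * I^*.
have nu : normc u = 1.
  rewrite normcM normcR normc_conj ger0_norm ?invr_ge0 ?normc_ge0//.
  by rewrite mulVf.
have uI : complex.Re (u * I) = normc I.
  rewrite /u -mulrA [_ * I]mulrC conj_mulc -rmorphM/= expr2.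
  by rewrite mulrA mulVf// mul1r.
have ui := cintegrableZ u mD fi.
rewrite -uI -(cintegralZ u mD fi) /=.
apply: (@le_trans _ _ (\int[mu]_(z in D) (complex.Re (u * f z))%:E)%E).
  rewrite /Rintegral fineK//.
  exact: (integrable_fin_num mD (cintegrable_Re mD ui)).
apply: le_integral => //.
- exact: cintegrable_Re ui.
- apply/integrableP; split; first by apply: measurable_EFin_normc; case: fi.
  case: fi => mf foo; rewrite (le_lt_trans _ foo)//.
  by rewrite le_eqVlt; apply/orP; left; apply/eqP; apply: eq_integral => z _;
    rewrite /= ger0_norm// normc_ge0.
- move=> z _; rewrite lee_fin (le_trans (ler_norm _))//.
  by rewrite (le_trans (le_Re_normc _))// normcM nu mul1r.
Qed.

End complex_integral.

Section cauchy_schwarz.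
Context {R : realType} d (T : measurableType d).
Variable mu : {measure set T -> \bar R}.
Local Open Scope ereal_scope.

Lemma cauchy_schwarz_integral (f g : T -> R) :
  measurable_fun setT f -> measurable_fun setT g ->
  (forall z, 0 <= f z)%R -> (forall z, 0 <= g z)%R ->
  (\int[mu]_z (f z * g z)%:E) ^+ 2 <=
  (\int[mu]_z (f z ^+ 2)%:E) * (\int[mu]_z (g z ^+ 2)%:E).
Proof.
move=> mf mg f0 g0.
have N2 (h : T -> R) : (forall z, 0 <= h z)%R ->
    'N[mu]_2%:E[EFin \o h] = sqrte (\int[mu]_z (h z ^+ 2)%:E).
  move=> h0; rewrite unlock poweR12_sqrt; last first.
    by apply: integral_ge0 => z _; exact: poweR_ge0.
  congr sqrte; apply: eq_integral => z _.
  by rewrite /= ger0_norm// powR_mulrn.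
have lt02 : (0 < 2 :> R)%R by [].
have h2 : (2^-1 + 2^-1 = 1 :> R)%R by rewrite [RHS]splitr !div1r.
have := hoelder mu mf mg lt02 lt02 h2.
rewrite Lnorm1 !N2// -sqrteM; last first.
  by apply: integral_ge0 => z _; rewrite lee_fin sqr_ge0.
have -> : \int[mu]_x `|(EFin \o (f \* g)%R) x| = \int[mu]_z (f z * g z)%:E.
  by apply: eq_integral => z _; rewrite /= ger0_norm// mulr_ge0.
move=> le; rewrite -[leRHS]sqr_sqrte; last first.
  by apply: mule_ge0; apply: integral_ge0 => z _; rewrite lee_fin sqr_ge0.
by rewrite !expe2; apply: lee_pmul => //; apply: integral_ge0 => z _;
  rewrite lee_fin mulr_ge0.
Qed.

End cauchy_schwarz.

Section density.
Context {R : realType} d (T : measurableType d).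
Variables (mu nu : {measure set T -> \bar R}) (rho : T -> R).
Hypotheses (rho0 : forall z, 0 <= rho z) (mrho : measurable_fun setT rho).
Hypothesis nuE : forall A, measurable A ->
  nu A = (\int[mu]_(z in A) (rho z)%:E)%E.
Local Open Scope ereal_scope.
Import HBNNSimple.

Lemma ge0_integral_density (f : T -> \bar R) : measurable_fun setT f ->
  (forall z, 0 <= f z) -> \int[nu]_z f z = \int[mu]_z (f z * (rho z)%:E).
Proof.
move=> mf f0.
have mrhoE : measurable_fun setT (EFin \o rho) by exact/measurable_EFinP.
pose f_ := nnsfun_approx measurableT mf.
transitivity (limn (fun n => \int[nu]_x (f_ n x)%:E)).
  rewrite -monotone_convergence//.
  - apply: eq_integral => y _; apply/esym/cvg_lim => //.
    exact: cvg_nnsfun_approx.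
  - by move=> n; exact/measurable_EFinP.
  - by move=> n y _; rewrite lee_fin.
  - by move=> y _ m n mn; rewrite lee_fin; exact/lefP/nd_nnsfun_approx.
rewrite [X in limn X](_ : _ =
    (fun n => \int[mu]_x ((f_ n x)%:E * (rho x)%:E))).
  rewrite -monotone_convergence//; last 3 first.
  - move=> n; apply: emeasurable_funM => //; exact/measurable_EFinP.
  - by move=> n x _; rewrite mule_ge0// lee_fin.
  - move=> x _ m n mn; rewrite lee_wpmul2r// lee_fin//.
    exact/lefP/nd_nnsfun_approx.
  apply: eq_integral => x _; apply/cvg_lim => //.
  apply: cvgeZr => //.
  exact: cvg_nnsfun_approx.
apply/funext => n.
under eq_integral do rewrite fimfunE -fsumEFin//.
rewrite ge0_integral_fsum//; last 2 first.
- by move=> y; exact/measurable_EFinP/measurable_funM.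
- by move=> y x _; rewrite nnfun_muleindic_ge0.
transitivity (\sum_(k \in range (f_ n))
  \int[mu]_x ((k * \1_(f_ n @^-1` [set k]) x)%:E * (rho x)%:E)).
  apply: eq_fsbigr => r rn; rewrite integralZl_indic_nnsfun// integral_indic//= setIT.
  under [RHS]eq_integral do rewrite EFinM -muleA.
  have [r0|r0] := ltP r 0%R.
    rewrite preimage_nnfun0// measure0 mule0 integral0_eq// => x _.
    by rewrite indic0 mul0e mule0.
  rewrite ge0_integralZl//.
  - rewrite nuE//; congr (_ * _).
    rewrite integral_mkcond; apply: eq_integral => x _.
    rewrite patchE indicE; case: ifPn => _; first by rewrite mul1e.
    by rewrite mul0e.
  - by apply: emeasurable_funM => //; exact/measurable_EFinP.
  - by move=> x _; rewrite mule_ge0// lee_fin.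
rewrite -ge0_integral_fsum//.
- apply: eq_integral => x _.
  rewrite -ge0_mule_fsuml; last by move=> ?; exact: nnfun_muleindic_ge0.
  by rewrite fsumEFin// -fimfunE.
- move=> r; apply: emeasurable_funM => //.
  by apply/measurable_EFinP/measurable_funM.
- move=> r x _; apply: mule_ge0; last by rewrite lee_fin.
  exact: nnfun_muleindic_ge0.
Qed.

End density.

Section complex_fubini.
Context {R : realType} d1 d2 (T1 : measurableType d1) (T2 : measurableType d2).

Lemma cmeasurable_pair1 (f : T1 * T2 -> R[i]) x :
  cmeasurable f -> cmeasurable (fun y => f (x, y)).
Proof.
by move=> mf; apply: (cmeasurable_comp _ mf); exact: pair1_measurable.
Qed.

Lemma measurable_fun_Rintegral2 (m2 : {sigma_finite_measure set T2 -> \bar R})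
    (h : T1 * T2 -> R) : measurable_fun setT h ->
  measurable_fun setT (fun x => \int[m2]_y h (x, y)).
Proof.
move=> /measurable_EFinP mh; apply: (measurableT_comp (@fine_measurable R setT measurableT)).
rewrite (_ : (fun x => _) = (fun x => (\int[m2]_y (EFin \o h)^\+ (x, y)) -
   (\int[m2]_y (EFin \o h)^\- (x, y)))%E); last first.
  apply/funext => x; rewrite integralE.
  by congr (_ - _)%E; apply: eq_integral => y _; rewrite ?funeposE ?funenegE.
apply: emeasurable_funB.
- apply: (measurable_fun_fubini_tonelli_F ((EFin \o h)^\+)%E) => //.
  exact: measurable_funepos.
- apply: (measurable_fun_fubini_tonelli_F ((EFin \o h)^\-)%E) => //.
  exact: measurable_funeneg.
Qed.

Lemma cmeasurable_cintegral (m2 : {sigma_finite_measure set T2 -> \bar R})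
    (f : T1 * T2 -> R[i]) : cmeasurable f ->
  cmeasurable (fun x => cintegral m2 setT (fun y => f (x, y))).
Proof.
by move=> [f1 f2]; split => /=;
  [exact: (measurable_fun_Rintegral2 m2 f1)|
   exact: (measurable_fun_Rintegral2 m2 f2)].
Qed.

Lemma Rintegral_Fubini (m1 : {sigma_finite_measure set T1 -> \bar R})
    (m2 : {sigma_finite_measure set T2 -> \bar R}) (h : T1 * T2 -> R) :
  measurable_fun setT h ->
  (\int[m1]_x \int[m2]_y `|h (x, y)|%:E < +oo)%E ->
  (forall x, m2.-integrable setT (fun y => (h (x, y))%:E)) ->
  (forall y, m1.-integrable setT (fun x => (h (x, y))%:E)) ->
  \int[m1]_x \int[m2]_y h (x, y) = \int[m2]_y \int[m1]_x h (x, y).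
Proof.
move=> mh hoo i2 i1; rewrite /Rintegral.
have -> : (\int[m1]_x (fine (\int[m2]_y (h (x, y))%:E))%:E =
    \int[m1]_x \int[m2]_y (h (x, y))%:E)%E.
  apply: eq_integral => x _; rewrite fineK//.
  exact: (integrable_fin_num measurableT (i2 x)).
have -> : (\int[m2]_y (fine (\int[m1]_x (h (x, y))%:E))%:E =
    \int[m2]_y \int[m1]_x (h (x, y))%:E)%E.
  apply: eq_integral => y _; rewrite fineK//.
  exact: (integrable_fin_num measurableT (i1 y)).
congr fine; apply: (@Fubini _ _ _ _ _ m1 m2 (EFin \o h)).
by apply/integrable12ltyP => //; exact/measurable_EFinP.
Qed.

Lemma cintegral_Fubini (m1 : {sigma_finite_measure set T1 -> \bar R})
    (m2 : {sigma_finite_measure set T2 -> \bar R}) (f : T1 * T2 -> R[i]) :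
  cmeasurable f ->
  (\int[m1]_x \int[m2]_y (normc (f (x, y)))%:E < +oo)%E ->
  (forall x, cintegrable m2 setT (fun y => f (x, y))) ->
  (forall y, cintegrable m1 setT (fun x => f (x, y))) ->
  cintegral m1 setT (fun x => cintegral m2 setT (fun y => f (x, y))) =
  cintegral m2 setT (fun y => cintegral m1 setT (fun x => f (x, y))).
Proof.
move=> mf foo i2 i1.
have mn : measurable_fun setT (fun x => \int[m2]_y (normc (f (x, y)))%:E)%E.
  apply: (@measurable_fun_fubini_tonelli_F _ _ _ _ _ m2
    (fun z => (normc (f z))%:E)).
    exact: measurable_EFin_normc.
  by move=> z; rewrite lee_fin normc_ge0.
have le (h : T1 * T2 -> R) : measurable_fun setT h ->
    (forall z, `|h z| <= normc (f z)) ->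
    (\int[m1]_x \int[m2]_y `|h (x, y)|%:E < +oo)%E.
  move=> mh hf; apply: le_lt_trans foo; apply: ge0_le_integral => //.
  - by move=> x _; apply: integral_ge0 => y _; rewrite lee_fin.
  - apply: (@measurable_fun_fubini_tonelli_F _ _ _ _ _ m2
      (fun z => `|h z|%:E)) => //.
    by apply/measurable_EFinP; exact: measurableT_comp.
  - move=> x _; apply: ge0_le_integral => //.
    + apply/measurable_EFinP/measurableT_comp => //.
      exact: (measurableT_comp mh (pair1_measurable _)).
    + by apply: measurable_EFin_normc; exact: cmeasurable_pair1.
    + by move=> y _; rewrite lee_fin.
rewrite /cintegral/=; congr (_ +i* _).
  apply: (@Rintegral_Fubini m1 m2 (fun z => complex.Re (f z))).
- exact: measurable_Re.
- by apply: (le (fun z => complex.Re (f z))) => [|z];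
    [exact: measurable_Re|exact: le_Re_normc].
- by move=> x; exact: (cintegrable_Re measurableT (i2 x)).
- by move=> x; exact: (cintegrable_Re measurableT (i1 x)).
apply: (@Rintegral_Fubini m1 m2 (fun z => complex.Im (f z))).
- exact: measurable_Im.
- by apply: (le (fun z => complex.Im (f z))) => [|z];
    [exact: measurable_Im|exact: le_Im_normc].
- by move=> x; exact: (cintegrable_Im measurableT (i2 x)).
- by move=> x; exact: (cintegrable_Im measurableT (i1 x)).
Qed.

End complex_fubini.

(** * Lebesgue and Gaussian measure on C^n *)

Section measure_preserving.
Context {R : realType}.
Local Open Scope ereal_scope.

Definition preserves d (T : measurableType d) (mu : set T -> \bar R)
    (phi : T -> T) :=
  measurable_fun setT phi /\
  forall A, measurable A -> mu (phi @^-1` A) = mu A.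

Lemma preserves_comp d (T : measurableType d) (mu : set T -> \bar R)
    (phi psi : T -> T) :
  preserves mu phi -> preserves mu psi -> preserves mu (phi \o psi).
Proof.
move=> [mphi phiE] [mpsi psiE]; split; first exact: measurableT_comp.
move=> A mA; rewrite comp_preimage psiE ?phiE//.
by rewrite -[X in measurable X]setTI; exact: mphi.
Qed.

Lemma preserves_id d (T : measurableType d) (mu : set T -> \bar R) :
  preserves mu id.
Proof. by split. Qed.

Lemma ge0_integral_preserves d (T : measurableType d)
    (mu : {measure set T -> \bar R}) (phi : T -> T) (f : T -> \bar R) :
  preserves mu phi -> measurable_fun setT f -> (forall z, 0 <= f z) ->
  \int[mu]_z f (phi z) = \int[mu]_z f z.
Proof.
move=> [mphi phiE] mf f0.
rewrite -[LHS](@ge0_integral_pushforward _ _ _ _ _ _ mphi mu setT)//.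
by apply: eq_measure_integral => A mA _; exact/phiE.
Qed.

Lemma cintegrable_preserves d (T : measurableType d)
    (mu : {measure set T -> \bar R}) (phi : T -> T) (f : T -> R[i]) :
  preserves mu phi -> cintegrable mu setT f -> cintegrable mu setT (f \o phi).
Proof.
move=> pphi [mf foo]; split; first by apply: cmeasurable_comp mf; case: pphi.
rewrite (ge0_integral_preserves pphi (f := fun z => (normc (f z))%:E))//.
  exact: measurable_EFin_normc.
by move=> z; rewrite lee_fin normc_ge0.
Qed.

Lemma cintegral_preserves d (T : measurableType d)
    (mu : {measure set T -> \bar R}) (phi : T -> T) (f : T -> R[i]) :
  preserves mu phi -> cmeasurable f ->
  cintegral mu setT (f \o phi) = cintegral mu setT f.
Proof.
move=> pphi [f1 f2]; rewrite /cintegral /Rintegral.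
have E (h : T -> R) : measurable_fun setT h ->
    \int[mu]_z (h (phi z))%:E = \int[mu]_z (h z)%:E.
  move=> mh; rewrite integralE [RHS]integralE.
  have mhE : measurable_fun setT (EFin \o h) by exact/measurable_EFinP.
  congr (_ - _).
    transitivity (\int[mu]_z (EFin \o h)^\+ (phi z)).
      by apply: eq_integral => z _; rewrite !funeposE.
    by apply: (ge0_integral_preserves (f := (EFin \o h)^\+)) => //;
      exact: measurable_funepos.
  transitivity (\int[mu]_z (EFin \o h)^\- (phi z)).
    by apply: eq_integral => z _; rewrite !funenegE.
  by apply: (ge0_integral_preserves (f := (EFin \o h)^\-)) => //;
    exact: measurable_funeneg.
by congr (fine _ +i* fine _); exact: E.
Qed.

Lemma preserves_skew d1 d2 (T1 : measurableType d1) (T2 : measurableType d2)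
    (m1 : {sigma_finite_measure set T1 -> \bar R})
    (m2 : {sigma_finite_measure set T2 -> \bar R})
    (phi : T1 -> T1) (psi : T1 * T2 -> T2) :
  preserves m1 phi -> measurable_fun setT psi ->
  (forall x, preserves m2 (fun y => psi (x, y))) ->
  preserves (sigma_prod m1 m2) (fun z => (phi z.1, psi z)).
Proof.
move=> pphi mpsi ppsi; split.
  apply: measurable_fun_pair => //; apply: measurableT_comp => //.
  by case: pphi.
move=> A mA; rewrite /sigma_prod /product_measure1/=.
rewrite -[RHS](ge0_integral_preserves pphi)//; last first.
  exact: measurable_fun_xsection.
apply: eq_integral => x _ /=.
rewrite -[RHS](proj2 (ppsi x)); last exact: measurable_xsection.
by congr (m2 _); apply/seteqP; split => y /=; rewrite /xsection/= !inE.
Qed.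

Lemma preserves_swap d (T : measurableType d)
    (m : {sigma_finite_measure set T -> \bar R}) :
  preserves (sigma_prod m m) (fun z => (z.2, z.1)).
Proof.
split; first exact: measurable_fun_pair.
move=> A mA.
transitivity ((m \x^ m) A).
  rewrite /sigma_prod /product_measure1 /product_measure2.
  by apply: eq_integral => x _ /=; congr (m _).
symmetry; apply: product_measure_unique => //= B C mB mC.
by rewrite product_measure2E.
Qed.

End measure_preserving.

Section lebesgue_plane.
Context {R : realType}.
Local Notation leb := (@lebesgue_measure R).
Local Notation leb2 := (sigma_prod leb leb).
Local Notation RR := (measurableTypeR R * measurableTypeR R)%type.

Lemma lebesgue_preserves_shift (c : R) :
  preserves leb (fun x : measurableTypeR R => x + c).
Proof.
have mc : measurable_fun setT (fun x : measurableTypeR R => x + c : measurableTypeR R).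
  exact: measurable_funD.
split => // A mA.
apply/esym/(@lebesgue_measure_unique R (pushforward leb
   (fun x : measurableTypeR R => x + c : measurableTypeR R))) => // _ [[a b] _ <-].
transitivity (leb `]a - c, b - c]%classic); last first.
  rewrite /= /pushforward; congr (leb _).
  by apply/seteqP; split => x /=; rewrite !in_itv/= ltrBlDr lerBrDr.
rewrite !lebesgue_measure_itv/= !lte_fin ltrD2r.
by case: ifP => // _; rewrite -!EFinD; congr EFin; ring.
Qed.

Lemma lebesgue_preserves_opp : preserves leb (fun x : measurableTypeR R => - x).
Proof.
by split => [|A mA]; [exact: measurable_funN|exact: lebesgue_measureN].
Qed.

Let shear1 (a : R) : preserves leb2 (fun z : RR => (z.1, z.2 + a * z.1)).
Proof.
apply: (preserves_skew (phi := id) (psi := fun z : RR => z.2 + a * z.1)) => //=.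
- by apply: measurable_funD => //; apply: measurable_funM.
- by move=> x; exact: lebesgue_preserves_shift.
Qed.

Let shear2 (a : R) : preserves leb2 (fun z : RR => (z.1 + a * z.2, z.2)).
Proof.
have := preserves_comp (preserves_swap leb)
  (preserves_comp (shear1 a) (preserves_swap leb)).
by congr preserves.
Qed.

Lemma plane_preserves_shift (c : RR) :
  preserves leb2 (fun z : RR => (z.1 + c.1, z.2 + c.2)).
Proof.
apply: (@preserves_skew R _ _ (measurableTypeR R) (measurableTypeR R) leb leb
  (fun x => x + c.1) ( fun z : RR => z.2 + c.2)) => //=.
- exact: lebesgue_preserves_shift.
- by apply: measurable_funD.
- by move=> x; exact: lebesgue_preserves_shift.
Qed.

(* for b != 0 the rotation is a product of three shears *)
Lemma plane_preserves_rot (a b : R) : a ^+ 2 + b ^+ 2 = 1 ->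
  preserves leb2 (fun z : RR => (a * z.1 - b * z.2, b * z.1 + a * z.2)).
Proof.
move=> ab1; have [b0|b0] := eqVneq b 0.
  have /eqP : (a - 1) * (a + 1) = 0 by move: ab1; rewrite b0 => ab1; lra.
  rewrite mulf_eq0 subr_eq0 addr_eq0 => /orP[|] /eqP aE.
    rewrite (_ : (fun z : RR => _) = id); first exact: preserves_id.
    by apply/funext => -[x y]/=; rewrite aE b0 !mul1r !mul0r subr0 add0r.
  rewrite (_ : (fun z : RR => _) = (fun z : RR => (- z.1, - z.2))); last first.
    by apply/funext => -[x y]/=; rewrite aE b0 !mulN1r !mul0r subr0 add0r.
  apply: (@preserves_skew R _ _ (measurableTypeR R) (measurableTypeR R) leb leb
    (fun x => - x) ( fun z : RR => - z.2)) => //=.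
  - exact: lebesgue_preserves_opp.
  - by apply: measurable_funN.
  - by move=> x; exact: lebesgue_preserves_opp.
pose k := (a - 1) / b.
have := preserves_comp (shear2 k) (preserves_comp (shear1 b) (shear2 k)).
congr preserves; apply/funext => -[x y] /=.
have bk : b * k = a - 1 by rewrite /k mulrC divfK.
have kE : k * (1 + a) = - b.
  apply: (mulfI b0); rewrite mulrA bk; lra.
have e1 : y + b * (x + k * y) = b * x + a * y.
  by rewrite mulrDr mulrA bk; ring.
rewrite e1; congr pair.
rewrite -[- (b * y)]mulNr -kE mulrDr [k * (b * x)]mulrA [k * b]mulrC bk; ring.
Qed.

End lebesgue_plane.

Section tuple_measure_theory.
Context d (T : measurableType d) (R : realType).
Variable m : {sigma_finite_measure set T -> \bar R}.

Definition tuple_map (phi : nat -> T -> T) n (x : n.-tuple T) : n.-tuple T :=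
  [tuple phi i (tnth x i) | i < n].

Lemma tuple_map_cons phi n (x : T) (t : n.-tuple T) :
  tuple_map phi (consT (x, t)) =
  consT (phi 0%N x, tuple_map (fun i => phi i.+1) t).
Proof.
apply: eq_from_tnth => i; rewrite tnth_mktuple /consT/=.
case: (unliftP ord0 i) => [j ->|->] /=; last by rewrite !tnth0.
by rewrite !tnthS tnth_mktuple.
Qed.

Lemma preserves_tuple_map phi n : (forall i, preserves m (phi i)) ->
  preserves (tuple_measure m n) (@tuple_map phi n).
Proof.
move=> pphi; split.
  apply/measurable_fun_tnthP => i.
  rewrite (_ : _ \o _ = phi i \o (@tnth _ T ^~ i)); last first.
    by apply/funext => x; rewrite /= tnth_mktuple.
  by apply: measurableT_comp; [case: (pphi i)|exact: measurable_tnth].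
elim: n phi pphi => [|n IH] phi pphi A mA.
  by rewrite /= !diracE; congr (nat_of_bool _)%:R%:E; congr (_ \in A);
    exact: tuple0.
have mphi : measurable_fun setT (@tuple_map (fun i => phi i.+1) n).
  apply/measurable_fun_tnthP => i.
  rewrite (_ : _ \o _ = phi i.+1 \o (@tnth _ T ^~ i)); last first.
    by apply/funext => x; rewrite /= tnth_mktuple.
  by apply: measurableT_comp; [case: (pphi i.+1)|exact: measurable_tnth].
have P := @preserves_skew R _ _ T (n.-tuple T) m (tuple_measure m n) (phi 0%N)
  (fun z => tuple_map (fun i => phi i.+1) z.2) (pphi 0%N).
have {}P := P (measurableT_comp mphi measurable_snd).
have /P [_ PE] : forall x : T, preserves (tuple_measure m n)
    (fun y => tuple_map (fun i => phi i.+1) y).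
  by move=> _; split => // B mB; exact: IH.
rewrite /= /tuple_measure_step /pushforward -[RHS]PE; last first.
  by rewrite -[X in measurable X]setTI; exact: (@measurable_consT _ T n).
congr (sigma_prod _ _ _); apply/seteqP; split => -[x t] /=;
  by rewrite tuple_map_cons.
Qed.

Lemma integral_tuple_prod (F : nat -> T -> R) (v : nat -> R) n :
  (forall i x, 0 <= F i x) -> (forall i, measurable_fun setT (F i)) ->
  (forall i, (\int[m]_x (F i x)%:E = (v i)%:E)%E) ->
  (\int[tuple_measure m n]_x (\prod_(i < n) F i (tnth x i))%:E =
   (\prod_(i < n) v i)%:E)%E.
Proof.
have mprod (G : nat -> T -> R) k : (forall i, measurable_fun setT (G i)) ->
    measurable_fun [set: k.-tuple T] (fun x => \prod_(i < k) G i (tnth x i)).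
  move=> mG; apply: measurable_prod => i _.
  by apply: measurableT_comp; [exact: mG|exact: measurable_tnth].
elim: n F v => [|n IH] F v F0 mF Fv.
  under eq_integral do rewrite big_ord0.
  by rewrite /= integral_cst//= diracT mule1 big_ord0.
rewrite /= /tuple_measure_step ge0_integral_pushforward//; last 3 first.
- exact: measurable_consT.
- by apply/measurable_EFinP; exact: (mprod F n.+1 mF).
- by move=> x _; rewrite lee_fin prodr_ge0.
rewrite preimage_setT /sigma_prod.
rewrite (fubini_tonelli1 (m2 := tuple_measure m n)); last 2 first.
- apply/measurable_EFinP.
  exact: (measurableT_comp (mprod F n.+1 mF) (@measurable_consT _ T n)).
- by move=> x; rewrite lee_fin prodr_ge0.
transitivity (\int[m]_x ((F 0%N x)%:E * (\prod_(i < n) v i.+1)%:E))%E.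
  apply: eq_integral => x _; rewrite /fubini_F/=.
  rewrite -(IH (fun i => F i.+1) (fun i => v i.+1))//.
  rewrite -ge0_integralZl_EFin//; last 2 first.
  - by move=> y _; rewrite lee_fin prodr_ge0.
  - by apply/measurable_EFinP; exact: (mprod (fun i => F i.+1) n (fun i => mF i.+1)).
  apply: eq_integral => y _; rewrite -EFinM big_ord_recl /= tnth0; congr EFin.
  by congr (_ * _); apply: eq_bigr => i _; rewrite /consT/= tnthS.
rewrite ge0_integralZr//; last 3 first.
- exact/measurable_EFinP.
- by move=> x _; rewrite lee_fin.
- rewrite lee_fin; apply: prodr_ge0 => i _; rewrite -lee_fin -Fv.
  by apply: integral_ge0 => x _; rewrite lee_fin.
by rewrite Fv -EFinM big_ord_recl.
Qed.

End tuple_measure_theory.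

Section Cn_theory.
Context {R : realType} {n : nat}.
Local Notation Cn := 'rV[R[i]]_n.
Local Notation leb := (@lebesgue_measure R).
Local Notation leb2 := (sigma_prod leb leb).
Local Notation RR := (measurableTypeR R * measurableTypeR R)%type.

Lemma measurable_CnP d (T : measurableType d) (p : T -> Cn) :
  (forall i, cmeasurable (fun x => p x 0 i)) -> measurable_fun setT p.
Proof.
move=> mp _ A mA.
suff : forall B, g_sigma_preimage (@Cn_coord R n) B -> measurable (p @^-1` B).
  by rewrite setTI; exact.
apply: smallest_sub => /=.
  split => [|B mB|F mF].
  - by rewrite preimage_set0.
  - by rewrite setTD -preimage_setC; exact: measurableC.
  - by rewrite preimage_bigcup; exact: bigcup_measurable.
rewrite -bigcup_seq => B [i _ [Y mY <-]]; rewrite setTI -comp_preimage.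
rewrite -[X in measurable X]setTI.
suff : measurable_fun setT (@Cn_coord R n i \o p) by exact.
by apply: measurable_fun_pair; case: (mp i).
Qed.

Lemma cmeasurable_coord (i : 'I_n) : cmeasurable (fun z : Cn => z 0 i).
Proof.
have mc := @measurable_Cn_coord R n i.
by split; [exact: (measurableT_comp measurable_fst mc)|
  exact: (measurableT_comp measurable_snd mc)].
Qed.

Definition Cn_to_coords (z : Cn) : n.-tuple RR := [tuple Cn_coord i z | i < n].

Lemma measurable_Cn_to_coords : measurable_fun setT Cn_to_coords.
Proof.
apply/measurable_fun_tnthP => i.
rewrite (_ : _ \o _ = @Cn_coord R n i); first exact: measurable_Cn_coord.
by apply/funext => z; rewrite /= tnth_mktuple.
Qed.

Lemma Cn_of_coordsK : cancel (@Cn_of_coords R n) Cn_to_coords.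
Proof.
move=> x; apply: eq_from_tnth => i; rewrite tnth_mktuple /Cn_coord mxE/=.
by rewrite -surjective_pairing.
Qed.

Lemma Cn_to_coordsK : cancel Cn_to_coords (@Cn_of_coords R n).
Proof.
move=> z; apply/rowP => i; rewrite mxE tnth_mktuple /Cn_coord/=.
by case: (z 0 i).
Qed.

Let lebesgue_Cn_sigma_finite : sigma_finite setT (@lebesgue_Cn R n).
Proof.
have [F UF mF] := sigma_finiteT (tuple_measure leb2 n).
exists (fun k => Cn_to_coords @^-1` F k).
  by rewrite -preimage_bigcup -UF preimage_setT.
move=> k; have [mFk Fkoo] := mF k; split.
  by rewrite -[X in measurable X]setTI; exact: measurable_Cn_to_coords.
rewrite /lebesgue_Cn /pushforward -comp_preimage.
rewrite (_ : Cn_to_coords \o @Cn_of_coords R n = id) ?preimage_id//.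
by apply/funext => x /=; rewrite Cn_of_coordsK.
Qed.

HB.instance Definition _ := @Measure_isSigmaFinite.Build _ _ _
  (@lebesgue_Cn R n) lebesgue_Cn_sigma_finite.

Lemma ge0_integral_lebesgue_Cn (f : Cn -> \bar R) : measurable_fun setT f ->
  (forall z, 0 <= f z)%E ->
  (\int[lebesgue_Cn R n]_z f z =
   \int[tuple_measure leb2 n]_x f (Cn_of_coords x))%E.
Proof.
move=> mf f0; rewrite /lebesgue_Cn.
by rewrite ge0_integral_pushforward//; exact: measurable_Cn_of_coords.
Qed.

Lemma lebesgue_Cn_preserves (Psi : Cn -> Cn) (phi : nat -> RR -> RR) :
  (forall i, preserves leb2 (phi i)) ->
  (forall z (i : 'I_n), Cn_coord i (Psi z) = phi i (Cn_coord i z)) ->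
  preserves (@lebesgue_Cn R n) Psi.
Proof.
move=> pphi PsiE.
have E x : Psi (Cn_of_coords x) = Cn_of_coords (tuple_map phi x).
  apply/rowP => i; rewrite [RHS]mxE tnth_mktuple.
  have := PsiE (Cn_of_coords x) i.
  rewrite {2}/Cn_coord mxE/= -surjective_pairing => <-.
  by rewrite /Cn_coord/=; case: (Psi _ 0 i).
have mPsi : measurable_fun setT Psi.
  rewrite (_ : Psi = (@Cn_of_coords R n) \o (@tuple_map _ _ phi n) \o Cn_to_coords).
    apply: measurableT_comp; last exact: measurable_Cn_to_coords.
    apply: measurableT_comp; first exact: measurable_Cn_of_coords.
    by have [] := preserves_tuple_map n pphi.
  by apply/funext => z /=; rewrite -E Cn_to_coordsK.
split => // A mA; rewrite /lebesgue_Cn /pushforward.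
rewrite -[RHS](proj2 (preserves_tuple_map n pphi)); last first.
  by rewrite -[X in measurable X]setTI; exact: measurable_Cn_of_coords.
by congr (tuple_measure _ _ _); apply/seteqP; split => x /=; rewrite E.
Qed.

Let ext (c : Cn) (i : nat) : R[i] :=
  if insub i is Some j then c 0 j else 0.

Let extE (c : Cn) (i : 'I_n) : ext c i = c 0 i.
Proof. by rewrite /ext valK. Qed.

Lemma lebesgue_Cn_shift (c : Cn) :
  preserves (@lebesgue_Cn R n) (fun z => z + c).
Proof.
apply: (@lebesgue_Cn_preserves _ (fun i (z : RR) =>
  (z.1 + complex.Re (ext c i), z.2 + complex.Im (ext c i)))).
  move=> i.
  exact: (plane_preserves_shift (complex.Re (ext c i), complex.Im (ext c i))).
move=> z i; rewrite /Cn_coord extE mxE/=.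
by case: (z 0 i) (c 0 i) => [a b] [c1 c2].
Qed.

Lemma lebesgue_Cn_rot (u : R[i]) : normc u = 1 ->
  preserves (@lebesgue_Cn R n) (fun z => u *: z).
Proof.
move=> u1; apply: (@lebesgue_Cn_preserves _ (fun i (z : RR) =>
  (complex.Re u * z.1 - complex.Im u * z.2,
   complex.Im u * z.1 + complex.Re u * z.2))).
  by move=> i; apply: plane_preserves_rot; rewrite -normc_sqr u1 expr1n.
move=> z i; rewrite /Cn_coord mxE/=.
by case: u {u1} (z 0 i) => [a b] [c1 c2] /=; rewrite [a * c2 + _]addrC.
Qed.

Lemma lebesgue_Cn_reflect (w : Cn) :
  preserves (@lebesgue_Cn R n) (fun z => w - z).
Proof.
have := preserves_comp (lebesgue_Cn_shift w) (@lebesgue_Cn_rot (-1) _).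
rewrite normcN normc1 => /(_ erefl).
by congr preserves; apply/funext => z /=; rewrite scaleN1r addrC.
Qed.

Lemma sqnormCn_ge0 (z : Cn) : 0 <= sqnormCn z.
Proof. by apply: sumr_ge0 => i _; exact: sqr_ge0. Qed.

Lemma integral_lebesgue_Cn_prod (F : R -> R -> R) (v : R) :
  (forall x y, 0 <= F x y) ->
  measurable_fun setT (fun z : RR => F z.1 z.2) ->
  (\int[leb]_x \int[leb]_y (F x y)%:E = v%:E)%E ->
  (\int[lebesgue_Cn R n]_z
    (\prod_(i < n) F (complex.Re (z 0 i)) (complex.Im (z 0 i)))%:E =
   (v ^+ n)%:E)%E.
Proof.
move=> F0 mF Fv.
rewrite ge0_integral_lebesgue_Cn; last 2 first.
- apply/measurable_EFinP; apply: measurable_prod => i _.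
  exact: (measurableT_comp mF (@measurable_Cn_coord R n i)).
- by move=> z; rewrite lee_fin prodr_ge0.
transitivity (\int[tuple_measure leb2 n]_x
   (\prod_(i < n) (fun i (z : RR) => F z.1 z.2) i (tnth x i))%:E)%E.
  by apply: eq_integral => x _; congr EFin; apply: eq_bigr => i _; rewrite mxE.
have := @integral_tuple_prod _ _ R leb2 (fun _ (z : RR) => F z.1 z.2)
  (fun=> v) n.
rewrite prodr_const card_ord; apply => //.
move=> _; rewrite /sigma_prod.
rewrite (fubini_tonelli1 (m2 := leb)); first exact: Fv.
- exact/measurable_EFinP.
- by move=> x; rewrite lee_fin.
Qed.

Section gauss.
Variable t : R.
Hypothesis t0 : 0 < t.

Let s : R := Num.sqrt (2 * t).

Let s_neq0 : s != 0.
Proof. by rewrite gt_eqF// sqrtr_gt0 mulr_gt0. Qed.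

Let gauss1 (x : R) : expR (- (x ^+ 2 / (4 * t))) =
  Num.sqrt (4 * pi * t) * normal_pdf 0 s x.
Proof.
have s2 : s ^+ 2 = 2 * t by rewrite sqr_sqrtr// mulr_ge0// ltW.
rewrite normal_pdfE// /normal_peak /normal_fun s2 subr0.
have -> : 2 * t * pi *+ 2 = 4 * pi * t by rewrite -mulr_natl; ring.
rewrite mulrA divff ?mul1r; last first.
  by rewrite gt_eqF// sqrtr_gt0 !mulr_gt0 ?pi_gt0.
congr expR; rewrite mulNr -mulr_natl; congr (- (_ / _)); ring.
Qed.

Lemma gauss_densityE (z : Cn) :
  gauss_density t z = expR (- (sqnormCn z / (4 * t))) / (4 * pi * t) ^+ n.
Proof. by rewrite /gauss_density t0. Qed.

Lemma integral_gauss_density :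
  (\int[lebesgue_Cn R n]_z (gauss_density t z)%:E = 1)%E.
Proof.
have c0 : 0 < 4 * pi * t :> R by rewrite !mulr_gt0 ?pi_gt0.
pose F (x y : R) := expR (- (x ^+ 2 / (4 * t))) *
  expR (- (y ^+ 2 / (4 * t))) / (4 * pi * t).
transitivity (\int[lebesgue_Cn R n]_z
    (\prod_(i < n) F (complex.Re (z 0%R i)) (complex.Im (z 0%R i)))%:E)%E.
  apply: eq_integral => z _; rewrite gauss_densityE; congr EFin.
  rewrite /F big_split/= prodr_const card_ord exprVn; congr (_ / _).
  rewrite /sqnormCn big_distrl/= -sumrN expR_sum; apply: eq_bigr => i _.
  by rewrite -expRD normc_sqr mulrDl opprD.
have g0 x : 0 <= normal_pdf 0 s x by exact: normal_pdf_ge0.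
rewrite (@integral_lebesgue_Cn_prod _ 1) ?expr1n//.
- by move=> x y; apply: divr_ge0; [apply: mulr_ge0; exact: expR_ge0|exact: ltW].
- rewrite /F/=; apply: measurable_funM => //; apply: measurable_funM.
    apply: (measurableT_comp (@measurable_expR R)); apply: measurable_funN.
    by apply: measurable_funM => //; apply: measurable_funX.
  apply: (measurableT_comp (@measurable_expR R)); apply: measurable_funN.
  by apply: measurable_funM => //; apply: measurable_funX.
transitivity (\int[leb]_x (normal_pdf 0 s x)%:E)%E; last first.
  exact: integral_normal_pdf.
apply: eq_integral => x _.
transitivity (\int[leb]_y ((normal_pdf 0 s x)%:E * (normal_pdf 0 s y)%:E))%E.
  apply: eq_integral => y _; rewrite -EFinM /F !gauss1; congr EFin.
  rewrite mulrACA -expr2 sqr_sqrtr; last exact: ltW.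
  by rewrite mulrAC divff ?mul1r// gt_eqF.
rewrite ge0_integralZl_EFin ?integral_normal_pdf ?mule1//.
- by move=> y _; rewrite lee_fin.
- by apply/measurable_EFinP; exact: measurable_normal_pdf.
Qed.

End gauss.

Lemma gauss_density_le0 (t : R) : t <= 0 -> gauss_density t = cst 0 :> (Cn -> R).
Proof. by move=> t0; apply/funext => z; rewrite /gauss_density ltNge t0. Qed.

Let gauss_Cn_fin t : fin_num_fun (@gauss_Cn R n t).
Proof.
move=> A mA; rewrite ge0_fin_numE//.
apply: (@le_lt_trans _ _ (\int[lebesgue_Cn R n]_z (gauss_density t z)%:E)%E).
  apply: ge0_subset_integral => //.
    by apply/measurable_EFinP; exact: measurable_gauss_density.
  by move=> z _; rewrite lee_fin gauss_density_ge0.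
have [t0|t0] := ltP 0 t; first by rewrite integral_gauss_density// ltry.
by rewrite gauss_density_le0//= integral0 ltry.
Qed.

HB.instance Definition _ t :=
  @Measure_isFinite.Build _ _ _ (@gauss_Cn R n t) (gauss_Cn_fin t).

Lemma gauss_CnT (t : R) : 0 < t -> gauss_Cn n t setT = 1%E :> \bar R.
Proof. exact: integral_gauss_density. Qed.

Lemma ge0_integral_gauss (t : R) (f : Cn -> \bar R) :
  measurable_fun setT f -> (forall z, 0 <= f z)%E ->
  (\int[gauss_Cn n t]_z f z =
   \int[lebesgue_Cn R n]_z (f z * (gauss_density t z)%:E))%E.
Proof.
move=> mf f0; apply: ge0_integral_density => //.
- exact: gauss_density_ge0.
- exact: measurable_gauss_density.
Qed.

End Cn_theory.

(** * The mean value property *)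

Section real_exp_trigo.
Context {R : realType}.
Implicit Types x y : R.

Lemma expR_subr1_le x : `|expR x - 1| <= `|x| * expR `|x|.
Proof.
have h1 := expR_ge1Dx x; have h2 := expR_ge1Dx (- x).
have e0 : 0 < expR x by exact: expR_gt0.
have e1 : expR x * expR (- x) = 1 by rewrite expRN divff// gt_eqF.
have [x0|x0] := leP 0 x.
  rewrite ger0_norm; last by rewrite subr_ge0 -expR0 ler_expR.
  by rewrite [`|x|]ger0_norm//; nra.
rewrite ler0_norm; last by rewrite subr_le0 -expR0 ler_expR ltW.
rewrite opprB [`|x|]ltr0_norm//.
have : 1 <= expR (- x) by rewrite -expR0 ler_expR oppr_ge0 ltW.
nra.
Qed.

Lemma expR_taylor1_le x : `|expR x - 1 - x| <= x ^+ 2 * expR `|x|.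
Proof.
have h := expR_ge1Dx x.
have h2 := expR_ge1Dx (- x).
have e1 : expR x * expR (- x) = 1 by rewrite expRN divff// gt_eqF// expR_gt0.
rewrite ger0_norm; last by rewrite -addrA -opprD subr_ge0.
have e0 : 0 < expR x by exact: expR_gt0.
apply: (@le_trans _ _ (x * (expR x - 1))); first by nra.
rewrite (le_trans (ler_norm _))// normrM expr2 -[x * x]ger0_norm ?sqr_ge0//.
by rewrite normrM -mulrA ler_wpM2l// expR_subr1_le.
Qed.

Lemma mvt_bound (f df : R -> R) y (M : R) :
  (forall x, is_derive x 1 f (df x)) -> f 0 = 0 ->
  (forall x, `|x| <= `|y| -> `|df x| <= M) -> `|f y| <= M * `|y|.
Proof.
move=> dfP f0 dfM.
have cf a b : {within `[a, b], continuous f}.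
  by apply: derivable_within_continuous => x _; have [] := dfP x.
have [y0|y0|->] := ltgtP y 0; last by rewrite f0 !normr0 mulr0.
  have [c] := @MVT_segment R f df y 0 (ltW y0) (fun x _ => dfP x) (cf _ _).
  rewrite in_itv/= => /andP[yc c0]; rewrite f0 !sub0r => fE.
  rewrite -normrN fE normrM normrN ler_wpM2r// dfM//.
  by rewrite (ler0_norm c0) (ltr0_norm y0) lerN2.
have [c] := @MVT_segment R f df 0 y (ltW y0) (fun x _ => dfP x) (cf _ _).
rewrite in_itv/= => /andP[c0 yc]; rewrite f0 !subr0 => fE.
rewrite fE normrM ler_wpM2r// dfM//.
by rewrite (ger0_norm c0) (gtr0_norm y0).
Qed.

Lemma norm_sin_le y : `|sin y| <= `|y|.
Proof.
rewrite -[leRHS]mul1r; apply: (@mvt_bound _ cos) => [|x _].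
- exact: sin0.
- by rewrite ler_norml cos_geN1 cos_le1.
Qed.

Lemma norm_cos_sub1_le y : `|cos y - 1| <= y ^+ 2.
Proof.
rewrite -[y ^+ 2]real_normK ?num_real// expr2.
apply: (@mvt_bound (fun y => cos y - 1) (fun x => - sin x)) => [x||x xy].
- by apply: is_derive_eq; rewrite subr0.
- by rewrite cos0 subrr.
- by rewrite normrN (le_trans (norm_sin_le _)).
Qed.

Lemma norm_sin_subr_le y : `|sin y - y| <= y ^+ 2.
Proof.
rewrite -[y ^+ 2]real_normK ?num_real// expr2.
apply: (@mvt_bound (fun y => sin y - y) (fun x => cos x - 1)) => [|x xy].
- by rewrite sin0 subrr.
- have [c1 cN1] := (cos_le1 x, cos_geN1 x).
  have [x1|x1] := leP `|x| 1.
    apply: le_trans xy; apply: (le_trans (norm_cos_sub1_le _)).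
    by rewrite -real_normK ?num_real// expr2 ler_piMr.
  apply: le_trans xy.
  have [z0|z0] := leP 1 (cos x).
    by rewrite ger0_norm ?subr_ge0// lerBlDr (le_trans c1)// lerDr.
  have h := norm_sin_le (x / 2).
  have -> : cos x = 1 - 2 * sin (x / 2) ^+ 2.
    rewrite {1}[x]splitr cosD -!expr2.
    have := cos2Dsin2 (x / 2); lra.
  rewrite addrAC subrr add0r normrN normrM (@gtr0_norm _ 2)// normrX expr2.
  have s1 : `|sin (x / 2)| <= 1 by rewrite ler_norml sin_le1 sin_geN1.
  rewrite normrM (@gtr0_norm _ 2^-1) in h; last by rewrite invr_gt0.
  have s0 : 0 <= `|sin (x / 2)| by [].
  by nra.
Qed.

End real_exp_trigo.

Section complex_exp.
Context {R : realType}.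
Implicit Types z : R[i].

Definition cexp z : R[i] :=
  (expR (complex.Re z) * cos (complex.Im z)) +i*
  (expR (complex.Re z) * sin (complex.Im z)).

Lemma cexp0 : cexp 0 = 1.
Proof. by rewrite /cexp/= expR0 cos0 sin0 !mul1r. Qed.

Lemma cexpD z w : cexp (z + w) = cexp z * cexp w.
Proof.
case: z w => [a b] [c d]; rewrite /cexp/= expRD cosD sinD.
by apply/eqP; rewrite eq_complex/=; apply/andP; split; apply/eqP; ring.
Qed.

Lemma normc_cexp z : normc (cexp z) = expR (complex.Re z).
Proof.
rewrite -[LHS]ger0_norm ?normc_ge0// -sqrtr_sqr normc_sqr/=.
rewrite !exprMn -mulrDr cos2Dsin2 mulr1 sqrtr_sqr ger0_norm//.
Qed.

Lemma cexp_conj z : cexp z^* = (cexp z)^*.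
Proof. by case: z => a b; rewrite /cexp/= cosN sinN mulrN. Qed.

Lemma cexp_real (a : R) : cexp a%:C = (expR a)%:C.
Proof. by rewrite /cexp/= cos0 sin0 mulr1 mulr0. Qed.

Lemma cexpNK z : cexp (- z) * cexp z = 1.
Proof. by rewrite -cexpD addNr cexp0. Qed.

Lemma cexp_taylor1_le z :
  normc (cexp z - 1 - z) <= 3 * normc z ^+ 2 * expR (normc z).
Proof.
case: z => x y; set N := normc (x +i* y).
have xN : `|x| <= N by exact: (le_Re_normc (x +i* y)).
have yN : `|y| <= N by exact: (le_Im_normc (x +i* y)).
have NE : N ^+ 2 = x ^+ 2 + y ^+ 2 by exact: (normc_sqr (x +i* y)).
apply: (le_trans (ler_normc_ReIm _)); rewrite /= !subr0.
set E := expR N.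
have EN : expR `|x| <= E by rewrite ler_expR.
have E1 : 1 <= E by rewrite -expR0 ler_expR (le_trans _ xN).
have ExE : expR x <= E by rewrite ler_expR (le_trans (ler_norm _)).
have h1 : `|expR x * cos y - 1 - x| <= E * x ^+ 2 + E * y ^+ 2.
  have -> : expR x * cos y - 1 - x = (expR x - 1 - x) + expR x * (cos y - 1).
    by ring.
  rewrite (le_trans (ler_normD _ _))// lerD//.
    rewrite (le_trans (expR_taylor1_le _))// mulrC ler_wpM2r// sqr_ge0//.
  rewrite normrM ger0_norm ?expR_ge0// ler_pM ?expR_ge0//.
  exact: norm_cos_sub1_le.
have h2 : `|expR x * sin y - y| <= E * (`|x| * `|y|) + E * y ^+ 2.
  have -> : expR x * sin y - y = (expR x - 1) * sin y + (sin y - y) by ring.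
  rewrite (le_trans (ler_normD _ _))// lerD//.
    rewrite normrM mulrA ler_pM ?norm_sin_le//.
    by rewrite (le_trans (expR_subr1_le _))// mulrC ler_wpM2r.
  rewrite (le_trans (norm_sin_subr_le _))// -[leLHS]mul1r ler_wpM2r//.
  exact: sqr_ge0.
have h3 : `|x| * `|y| <= N ^+ 2 by rewrite expr2 ler_pM.
have h4 : y ^+ 2 <= N ^+ 2 by rewrite NE lerDr sqr_ge0.
apply: (le_trans (lerD h1 h2)).
have -> : E * x ^+ 2 + E * y ^+ 2 + (E * (`|x| * `|y|) + E * y ^+ 2) =
  E * (N ^+ 2 + `|x| * `|y| + y ^+ 2) by rewrite NE; ring.
rewrite mulrC ler_wpM2r ?(le_trans _ E1)//; lra.
Qed.

Lemma cmeasurable_cexp d (T : measurableType d) (f : T -> R[i]) :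
  cmeasurable f -> cmeasurable (fun x => cexp (f x)).
Proof.
move=> [f1 f2]; split; apply: measurable_funM.
- exact: (measurableT_comp (@measurable_expR R)).
- exact: (measurableT_comp (continuous_measurable_fun (@continuous_cos R))).
- exact: (measurableT_comp (@measurable_expR R)).
- exact: (measurableT_comp (continuous_measurable_fun (@continuous_sin R))).
Qed.

End complex_exp.

Section complex_differentiable.
Context {R : realType}.

Lemma differentiable_sq (V : normedModType R[i]) (f : V -> R[i]) (x : V)
    (C : R[i]) : 0 <= C ->
  (forall h, `|h| <= 1 -> `|f (h + x) - f x| <= C * `|h| ^+ 2) ->
  differentiable f x.
Proof.
move=> C0 fC.
have c0 : continuous (\0 : V -> R[i]) by exact: cst_continuous.
have E : f \o shift x = cst (f x) + (\0 : V -> R[i]) +o_ 0 id.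
  apply/eqaddoP => e e0.
  have C1 : 0 < C + 1 by rewrite (lt_le_trans ltr01)// lerDr.
  near=> h.
  have h1 : `|h| <= 1 by near: h; apply: nbhs0_le.
  have he : `|h| <= e / (C + 1).
    by near: h; apply: nbhs0_le; rewrite divr_gt0.
  rewrite /= !fctE/= addr0; apply: (le_trans (fC h h1)).
  rewrite expr2 mulrA ler_wpM2r//.
  rewrite (@le_trans _ _ ((C + 1) * `|h|))//.
    by rewrite ler_wpM2r// lerDl.
  by rewrite mulrC -ler_pdivlMr.
apply/diff_locallyP; split.
  by rewrite (diff_unique c0 E).
by rewrite [in RHS](diff_unique c0 E).
Unshelve. all: by end_near. Qed.

Lemma differentiable_normcP (V : normedModType R[i]) (f : V -> R[i]) (x : V) :
  differentiable f x ->
  exists D : {linear V -> R[i]}, forall e : R, 0 < e ->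
    exists2 d : R, 0 < d & forall h, `|h| < d%:C ->
      (normc (f (h + x) - f x - D h))%:C <= e%:C * `|h|.
Proof.
move=> /diff_locallyP[_ E]; exists ('d f x) => e e0.
have /eqaddoP/(_ e%:C) := E.
rewrite ltcR => /(_ e0) /nbhs_ballP[d' /= d'0 H].
have dE : d' = (complex.Re d')%:C by rewrite RRe_real// gtr0_real.
exists (complex.Re d'); first by rewrite -ltcR -dE.
move=> h hd; have /H : ball 0 d' h.
  by rewrite -ball_normE/= sub0r normrN dE.
by rewrite /= !fctE/= opprD addrA normE_normc.
Qed.

End complex_differentiable.

Section interval_integral.
Context {R : realType}.
Local Notation leb := (@lebesgue_measure R).
Implicit Types (phi : R -> R[i]) (a h : R).

Definition ccontinuous phi :=
  continuous (fun s => complex.Re (phi s)) /\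
  continuous (fun s => complex.Im (phi s)).

Definition cint a h phi : R[i] := cintegral leb `[a, a + h] phi.

Lemma ccontinuous_cmeasurable phi : ccontinuous phi ->
  cmeasurable (phi : measurableTypeR R -> R[i]).
Proof. by move=> [f1 f2]; split; exact: continuous_measurable_fun. Qed.

Lemma ccontinuous_cintegrable phi a b : ccontinuous phi ->
  cintegrable leb `[a, b] (phi : measurableTypeR R -> R[i]).
Proof.
move=> cphi; have [f1 f2] := cphi.
split; first exact: ccontinuous_cmeasurable.
have i1 : leb.-integrable `[a, b] (EFin \o (fun s => complex.Re (phi s))).
  apply: continuous_compact_integrable; first exact: segment_compact.
  exact: continuous_subspaceT.
have i2 : leb.-integrable `[a, b] (EFin \o (fun s => complex.Im (phi s))).
  apply: continuous_compact_integrable; first exact: segment_compact.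
  exact: continuous_subspaceT.
have /integrableP[_ j1] := i1; have /integrableP[_ j2] := i2.
apply: le_lt_trans (lte_add_pinfty j1 j2).
have m1 : measurable_fun `[a, b] (EFin \o (fun s => complex.Re (phi s))).
  exact: (measurable_int leb).
have m2 : measurable_fun `[a, b] (EFin \o (fun s => complex.Im (phi s))).
  exact: (measurable_int leb).
rewrite -ge0_integralD//; [|exact: measurableT_comp..].
apply: ge0_le_integral => //.
- by move=> z _; rewrite lee_fin normc_ge0.
- by apply: measurable_EFin_normc; exact: ccontinuous_cmeasurable.
- by apply: emeasurable_funD; exact: measurableT_comp.
- by move=> z _; rewrite /= -EFinD lee_fin ler_normc_ReIm.
Qed.

Lemma cint_split a h k phi : 0 <= h -> 0 <= k -> ccontinuous phi ->
  cint a (h + k) phi = cint a h phi + cint (a + h) k phi.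
Proof.
move=> h0 k0 cphi.
have ci := ccontinuous_cintegrable a (a + (h + k)) cphi.
have key (f : R -> R) : leb.-integrable `[a, a + (h + k)] (EFin \o f) ->
    \int[leb]_(x in `[a, (a + (h + k))]) f x =
    (\int[leb]_(x in `[a, (a + h)]) f x) +
    (\int[leb]_(x in `[(a + h), (a + h + k)]) f x).
  move=> fi; have := @Rintegral_itvB R f (BLeft a) (BRight (a + (h + k))) (a + h) fi.
  rewrite !bnd_simp lerDl => /(_ h0); rewrite addrA lerDl => /(_ k0) E.
  rewrite Rintegral_itv_obnd_cbnd in E; last first.
    rewrite -addrA; apply: integrableS fi => //.
    by move=> x /=; rewrite !in_itv/= => /andP[x1 ->]; rewrite andbT ltW//
      (le_lt_trans _ x1)// lerDl.
  by rewrite -E [RHS]addrC subrK.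
have mI : measurable (`[a, (a + (h + k))]%classic : set (measurableTypeR R)) by [].
rewrite /cint /cintegral (key _ (cintegrable_Re mI ci)).
by rewrite (key _ (cintegrable_Im mI ci)).
Qed.

Lemma cint_cst a h (c : R[i]) : 0 <= h -> cint a h (fun=> c) = c * h%:C.
Proof.
move=> h0; rewrite /cint cintegral_cst//= lebesgue_measure_itv/= lte_fin.
rewrite ltrDl; case: ltP => h1; first by rewrite -EFinD/= addrAC subrr add0r.
by congr (_ * _); congr (_%:C); apply/le_anti; rewrite h0.
Qed.

Lemma le_normc_cint a h phi (M : R) : 0 <= h -> ccontinuous phi ->
  (forall s, a <= s <= a + h -> normc (phi s) <= M) ->
  normc (cint a h phi) <= M * h.
Proof.
move=> h0 cphi phiM.
have ci := ccontinuous_cintegrable a (a + h) cphi.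
rewrite -lee_fin.
apply: (le_trans (le_normc_cintegral _ ci)) => //.
apply: (@le_trans _ _ (\int[leb]_(x in `[a, (a + h)%R]) M%:E)%E).
  apply: ge0_le_integral => //.
  - by move=> z _; rewrite lee_fin normc_ge0.
  - by apply: measurable_EFin_normc; case: ci.

rewrite integral_cst//= lebesgue_measure_itv/= lte_fin ltrDl.
case: ltP => h1; first by rewrite -EFinD -EFinM lee_fin addrAC subrr add0r.
by rewrite mule0 lee_fin (_ : h = 0) ?mulr0//; apply/le_anti; rewrite h0 h1.
Qed.

Lemma cintB a h phi psi : ccontinuous phi -> ccontinuous psi ->
  cint a h (fun s => phi s - psi s) = cint a h phi - cint a h psi.
Proof. by move=> c1 c2; apply: cintegralB => //; exact: ccontinuous_cintegrable. Qed.

End interval_integral.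

Section goursat.
Context {R : realType}.
Local Notation leb := (@lebesgue_measure R).

Definition cderivable (g : R[i] -> R[i]) := forall z, exists D : R[i],
  forall e : R, 0 < e -> exists2 d : R, 0 < d & forall h, normc h < d ->
    normc (g (z + h) - g z - D * h) <= e * normc h.

Lemma differentiable_cderivable (g : R[i] -> R[i]) :
  (forall z, differentiable g z) -> cderivable g.
Proof.
move=> dg z; have [D HD] := differentiable_normcP (dg z).
exists (D 1) => e e0; have [d d0 Hd] := HD _ e0; exists d => // h hd.
have := Hd h; rewrite normE_normc ltcR => /(_ hd).
rewrite -rmorphM/= lecR [h + z]addrC; suff -> : D h = D 1 * h by [].
by rewrite -[in LHS](mulr1 h) -[h * 1]/(h *: (1 : R[i])) linearZ/= mulrC.
Qed.

Variable g : R[i] -> R[i].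
Hypothesis dg : cderivable g.

Lemma cderivable_continuous z (e : R) : 0 < e ->
  exists2 d : R, 0 < d & forall h, normc h < d -> normc (g (z + h) - g z) < e.
Proof.
move=> e0; have [D HD] := dg z; have [d d0 Hd] := HD 1 ltr01.
pose M := 1 + normc D; have M0 : 0 < M.
  by rewrite ltr_wpDr// ?normc_ge0.
exists (Num.min d (e / M)); first by rewrite lt_min d0 divr_gt0.
move=> h; rewrite lt_min => /andP[hd he].
have -> : g (z + h) - g z = (g (z + h) - g z - D * h) + D * h by ring.
rewrite (le_lt_trans (le_normcD _ _))//.
rewrite (@le_lt_trans _ _ (M * normc h))//.
  by rewrite /M mulrDl lerD ?Hd// normcM.
by rewrite mulrC -ltr_pdivlMr.
Qed.

Let cont_line (p : R -> R[i]) : (forall s t, normc (p s - p t) <= `|s - t|) ->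
  ccontinuous (g \o p).
Proof.
move=> pl.
have key s (e : R) : 0 < e -> \forall t \near s, normc (g (p t) - g (p s)) < e.
  move=> e0; have [d d0 Hd] := cderivable_continuous (p s) e0.
  apply/nbhs_ballP; exists d => //= t st.
  have := Hd (p t - p s); rewrite [p s + _]addrC subrK; apply.
  by rewrite (le_lt_trans (pl _ _))// distrC.
split=> s; apply/cvgrPdist_lt => e e0; apply: filterS (key s e e0) => t.
  rewrite distrC -(raddfB (@complex.Re R : Rcomplex R -> R)).
  exact/le_lt_trans/le_Re_normc.
rewrite distrC -(raddfB (@complex.Im R : Rcomplex R -> R)).
exact/le_lt_trans/le_Im_normc.
Qed.

Lemma ccontinuous_vertical x : ccontinuous (fun s => g (x +i* s)).
Proof.
apply: cont_line => s t.
by rewrite /= subrr expr0n/= add0r sqrtr_sqr.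
Qed.

Lemma ccontinuous_horizontal y : ccontinuous (fun s => g (s +i* y)).
Proof.
apply: cont_line => s t.
by rewrite /= subrr expr0n/= addr0 sqrtr_sqr.
Qed.

(* the integral of g over the boundary of [a, a + w] x [c, c + h] *)
Definition rect_integral (a c w h : R) : R[i] :=
  'i * (cint c h (fun s => g ((a + w) +i* s)) - cint c h (fun s => g (a +i* s)))
  - (cint a w (fun s => g (s +i* (c + h))) - cint a w (fun s => g (s +i* c))).

Let rect_integral_split a c w h : 0 <= w -> 0 <= h ->
  rect_integral a c (w + w) (h + h) =
  rect_integral a c w h + rect_integral (a + w) c w h +
  (rect_integral a (c + h) w h + rect_integral (a + w) (c + h) w h).
Proof.
move=> w0 h0; rewrite /rect_integral.
rewrite !(@cint_split _ c h h)//; [|exact: ccontinuous_vertical..].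
rewrite !(@cint_split _ a w w)//; [|exact: ccontinuous_horizontal..].
by rewrite !addrA; ring.
Qed.

(* Subtracting the affine approximation of g leaves the boundary integral
   unchanged. *)
Let rect_integral_small a c w h (p D : R[i]) (e : R) : 0 <= w -> 0 <= h ->
  (forall x y, a <= x <= a + w -> c <= y <= c + h ->
    normc (g (x +i* y) - g p - D * ((x +i* y) - p)) <= e) ->
  normc (rect_integral a c w h) <= 2 * e * (w + h).
Proof.
move=> w0 h0 He.
pose r z := g z - g p - D * (z - p).
have cv x : ccontinuous (fun s => g (x +i* s)) by exact: ccontinuous_vertical.
have ch y : ccontinuous (fun s => g (s +i* y)) by exact: ccontinuous_horizontal.
have cB phi psi : ccontinuous phi -> ccontinuous psi ->
    ccontinuous (fun s => phi s - psi s : R[i]).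
  move=> [p1 p2] [q1 q2]; split=> s.
    rewrite [X in continuous_at _ X](_ : _ =
      (fun s => complex.Re (phi s)) \- (fun s => complex.Re (psi s))).
      by apply: cvgB; [exact: p1|exact: q1].
    by apply/funext => x; rewrite (raddfB (@complex.Re R : Rcomplex R -> R)).
  rewrite [X in continuous_at _ X](_ : _ =
    (fun s => complex.Im (phi s)) \- (fun s => complex.Im (psi s))).
    by apply: cvgB; [exact: p2|exact: q2].
  by apply/funext => x; rewrite (raddfB (@complex.Im R : Rcomplex R -> R)).
have cc (k : R[i]) : ccontinuous (fun=> k) by split=> s; exact: cvg_cst.
have -> : rect_integral a c w h =
    'i * cint c h (fun s => g ((a + w) +i* s) - g (a +i* s) - D * w%:C) -
    cint a w (fun s => g (s +i* (c + h)) - g (s +i* c) - D * ('i * h%:C)).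
  rewrite !cintB//; [|exact: cB..].
  by rewrite !cint_cst// /rect_integral; ring.
have rD x1 y1 x2 y2 : normc (r (x1 +i* y1)) <= e -> normc (r (x2 +i* y2)) <= e ->
    normc (g (x1 +i* y1) - g (x2 +i* y2) - D * ((x1 - x2) +i* (y1 - y2))) <= 2 * e.
  move=> h1 h2.
  have -> : g (x1 +i* y1) - g (x2 +i* y2) - D * ((x1 - x2) +i* (y1 - y2)) =
     r (x1 +i* y1) - r (x2 +i* y2).
    have -> : (x1 - x2) +i* (y1 - y2) = (x1 +i* y1) - (x2 +i* y2) by [].
    by rewrite /r; ring.
  rewrite (le_trans (le_normcD _ _))// normcN mulr_natl mulr2n lerD//.
have aw : a <= a + w by rewrite lerDl.
have chh : c <= c + h by rewrite lerDl.
rewrite (le_trans (le_normcD _ _))// normcN normcM.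
have -> : normc 'i = 1 :> R by rewrite /= expr0n expr1n/= add0r sqrtr1.
rewrite mul1r mulrDr addrC lerD//.
  apply: le_normc_cint => //; first exact/cB/cc/cB.
  move=> s sw; have -> : 'i * h%:C = (s - s) +i* (c + h - c) :> R[i].
    apply/eqP; rewrite eq_complex/=; apply/andP; split; apply/eqP; ring.
  by apply: rD; apply: He; rewrite // ?lexx ?chh.
apply: le_normc_cint => //; first exact/cB/cc/cB.
move=> s sw; have -> : w%:C = (a + w - a) +i* (s - s) :> R[i].
  apply/eqP; rewrite eq_complex/=; apply/andP; split; apply/eqP; ring.
by apply: rD; apply: He; rewrite // ?lexx ?aw.
Qed.

Lemma goursat a c w h : 0 < w -> 0 < h -> rect_integral a c w h = 0.
Proof.
move=> w0 h0; apply: contrapT => I0.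
pose hw k : R := w / 2 ^+ k; pose hh k : R := h / 2 ^+ k.
have hw0 k : 0 < hw k by rewrite divr_gt0// exprn_gt0.
have hh0 k : 0 < hh k by rewrite divr_gt0// exprn_gt0.
have hwS k : hw k = hw k.+1 + hw k.+1.
  by rewrite /hw exprS invfM; field; rewrite expf_neq0.
have hhS k : hh k = hh k.+1 + hh k.+1.
  by rewrite /hh exprS invfM; field; rewrite expf_neq0.
pose eta := normc (rect_integral a c w h) / (w + h) ^+ 2.
have wh0 : 0 < w + h by rewrite addr_gt0.
have eta0 : 0 < eta.
  rewrite divr_gt0// ?exprn_gt0// lt_def normc_ge0 andbT.
  by apply/eqP => /eq0_normc.
pose bad k (q : R * R) :=
  eta * (hw k + hh k) ^+ 2 <= normc (rect_integral q.1 q.2 (hw k) (hh k)).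
have step k q : bad k q -> exists q', bad k.+1 q' /\
    (q.1 <= q'.1 <= q.1 + hw k.+1) /\ (q.2 <= q'.2 <= q.2 + hh k.+1).
  move=> bq; apply: contrapT => /forallNP nb.
  have small q' : (q.1 <= q'.1 <= q.1 + hw k.+1) ->
      (q.2 <= q'.2 <= q.2 + hh k.+1) ->
      normc (rect_integral q'.1 q'.2 (hw k.+1) (hh k.+1)) <
      eta * (hw k.+1 + hh k.+1) ^+ 2.
    by move=> h1 h2; rewrite ltNge; apply/negP => h3; apply: (nb q').
  have [wk hk] := (ltW (hw0 k.+1), ltW (hh0 k.+1)).
  have l1 : q.1 <= q.1 + hw k.+1 by rewrite lerDl.
  have l2 : q.2 <= q.2 + hh k.+1 by rewrite lerDl.
  have s1 := small (q.1, q.2); have s2 := small (q.1 + hw k.+1, q.2).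
  have s3 := small (q.1, q.2 + hh k.+1).
  have s4 := small (q.1 + hw k.+1, q.2 + hh k.+1).
  move: bq; rewrite /bad hwS hhS rect_integral_split// leNgt => /negP; apply.
  rewrite (le_lt_trans (le_normcD _ _))//.
  rewrite (@le_lt_trans _ _ (normc (rect_integral q.1 q.2 (hw k.+1) (hh k.+1)) +
    normc (rect_integral (q.1 + hw k.+1) q.2 (hw k.+1) (hh k.+1)) +
    (normc (rect_integral q.1 (q.2 + hh k.+1) (hw k.+1) (hh k.+1)) +
    normc (rect_integral (q.1 + hw k.+1) (q.2 + hh k.+1) (hw k.+1) (hh k.+1)))))//.
    by rewrite lerD// le_normcD.
  move: s1 s2 s3 s4; rewrite /= !lexx !l1 !l2/= => s1 s2 s3 s4.
  have := s1 erefl erefl; have := s2 erefl erefl.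
  have := s3 erefl erefl; have := s4 erefl erefl.
  by set X := hw k.+1; set Y := hh k.+1; lra.
have bad0 : bad 0%N (a, c).
  rewrite /bad /hw /hh expr0 !divr1/= /eta divfK//.
  by rewrite expf_neq0// gt_eqF.
pose nxt k q := xget q [set q' | bad k.+1 q' /\
    (q.1 <= q'.1 <= q.1 + hw k.+1) /\ (q.2 <= q'.2 <= q.2 + hh k.+1)].
pose Q := fix Q k := if k is k'.+1 then nxt k' (Q k') else (a, c).
have nxtP k q : bad k q -> bad k.+1 (nxt k q) /\
    (q.1 <= (nxt k q).1 <= q.1 + hw k.+1) /\
    (q.2 <= (nxt k q).2 <= q.2 + hh k.+1).
  by move=> /step [q' H]; rewrite /nxt; case: xgetP => [y _//|/(_ q')].
have Qbad k : bad k (Q k).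
  by elim: k => [//|k IH]; exact: (nxtP k _ IH).1.
have Qmono1 k m : (Q k).1 <= (Q (k + m)%N).1 /\
    (Q (k + m)%N).1 + hw (k + m)%N <= (Q k).1 + hw k.
  elim: m => [|m [IH1 IH2]]; first by rewrite addn0.
  have [_ [/andP[h1 h2] _]] := nxtP _ _ (Qbad (k + m)%N).
  rewrite addnS; split; first exact: (le_trans IH1).
  apply: le_trans IH2; rewrite [in leRHS]hwS addrA lerD2r//.
have Qmono2 k m : (Q k).2 <= (Q (k + m)%N).2 /\
    (Q (k + m)%N).2 + hh (k + m)%N <= (Q k).2 + hh k.
  elim: m => [|m [IH1 IH2]]; first by rewrite addn0.
  have [_ [_ /andP[h1 h2]]] := nxtP _ _ (Qbad (k + m)%N).
  rewrite addnS; split; first exact: (le_trans IH1).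
  apply: le_trans IH2; rewrite [in leRHS]hhS addrA lerD2r//.
have nest (u v : nat -> R) : (forall k, 0 < v k) ->
   (forall k m, u k <= u (k + m)%N /\ u (k + m)%N + v (k + m)%N <= u k + v k) ->
   exists p, forall k, u k <= p <= u k + v k.
  move=> v0 uv.
  have ub k m : u m <= u k + v k.
    have [km|mk] := leqP k m.
      have [_] := uv k (m - k)%N; rewrite subnKC//; apply: le_trans.
      by rewrite lerDl ltW.
    have [+ _] := uv m (k - m)%N; rewrite subnKC ?(ltnW mk)// => /le_trans; apply.
    by rewrite lerDl ltW.
  exists (sup (range u)) => k; apply/andP; split.
    apply: ub_le_sup; last by exists k.
    by exists (u 0%N + v 0%N) => _ [m _ <-].
  by apply: ge_sup; [exists (u 0%N), 0%N|move=> _ [m _ <-]].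
have [p1 Hp1] := nest (fun k => (Q k).1) hw hw0 Qmono1.
have [p2 Hp2] := nest (fun k => (Q k).2) hh hh0 Qmono2.
have [D HD] := dg (p1 +i* p2).
have e4 : 0 < eta / 4 by rewrite divr_gt0.
have [d d0 Hd] := HD (eta / 4) e4.
have [k kd] : exists k, hw k + hh k < d.
  have : 0 < d / (w + h) by rewrite divr_gt0.
  move=> e0.
  have [k Hk] : exists k, (2^-1 : R) ^+ k < d / (w + h).
    have := @cvg_expr R 2^-1; rewrite ger0_norm// invf_lt1// ltr1n.
    move=> /(_ isT)/cvgrPdist_lt/(_ _ e0)[k _ /(_ k (leqnn k))].
    by rewrite /= sub0r normrN ger0_norm ?exprn_ge0// => H; exists k.
  exists k; rewrite /hw /hh -mulrDl -exprVn mulrC -ltr_pdivlMr//.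
have := Qbad k; rewrite /bad leNgt => /negP; apply.
have wk0 : 0 < hw k + hh k by rewrite addr_gt0.
apply: (@le_lt_trans _ _ (2 * (eta / 4 * (hw k + hh k)) * (hw k + hh k))).
  apply: (@rect_integral_small _ _ _ _ (p1 +i* p2) D) => [| |x y].
  - exact: ltW.
  - exact: ltW.
  - move=> /andP[x1 x2] /andP[y1 y2].
    have /andP[px1 px2] := Hp1 k; have /andP[py1 py2] := Hp2 k.
    set z := x +i* y; set p := p1 +i* p2.
    have zp : normc (z - p) <= hw k + hh k.
      rewrite (le_trans (ler_normc_ReIm _))//= lerD//.
        by rewrite ler_norml; apply/andP; split; lra.
      by rewrite ler_norml; apply/andP; split; lra.
    have := Hd (z - p); rewrite [p + _]addrC subrK => /(_ (le_lt_trans zp kd)) H.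
    by rewrite (le_trans H)// ler_wpM2l// ltW// divr_gt0.
have : 0 < eta * (hw k + hh k) ^+ 2 by rewrite mulr_gt0// exprn_gt0.
by set S := hw k + hh k; lra.
Qed.

End goursat.

Section circle_mean.
Context {R : realType}.

Lemma differentiable_cexp (z : R[i]) : differentiable (@cexp R) z.
Proof.
pose r (y : R[i]) := cexp y - cexp z * y.
have dr : differentiable r z.
  apply: (@differentiable_sq _ _ _ _ (normc (cexp z) * 3 * expR 1)%:C).
    by rewrite lecR !mulr_ge0 ?normc_ge0 ?expR_ge0.
  move=> h; rewrite !normE_normc lecR => h1.
  have -> : r (h + z) - r z = cexp z * (cexp h - 1 - h).
    by rewrite /r cexpD; ring.
  rewrite -rmorphXn -rmorphM/= lecR normcM -!mulrA ler_wpM2l ?normc_ge0//.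
  rewrite (le_trans (cexp_taylor1_le _))// -mulrA ler_wpM2l//.
  by rewrite mulrC ler_wpM2r ?sqr_ge0// ler_expR.
have -> : @cexp R = r + (fun y => cexp z * y).
  by apply/funext => y; rewrite fctE /r subrK.
by apply: differentiableD => //; apply: differentiableM.
Qed.

Lemma circle_mean (F : R[i] -> R[i]) : (forall z, differentiable F z) ->
  cint 0 (pi *+ 2) (fun s => F (cexp (0 +i* s))) = F 0 * (pi *+ 2)%:C.
Proof.
move=> dF; pose g z := F (cexp z).
have dg : cderivable g.
  apply: differentiable_cderivable => z.
  by apply: (@differentiable_comp _ _ _ _ (@cexp R) F) => //; exact: differentiable_cexp.
have p0 : 0 < pi *+ 2 :> R by rewrite mulrn_wgt0// pi_gt0.
have per x y : g (x +i* (y + pi *+ 2)) = g (x +i* y).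
  by rewrite /g /cexp/= cosD2pi sinD2pi.
have V w : 0 < w -> cint 0 (pi *+ 2) (fun s => g (0 +i* s)) =
    cint 0 (pi *+ 2) (fun s => g ((- w) +i* s)).
  move=> w0; have := goursat dg (- w) 0 w0 p0.
  rewrite /rect_integral addNr.
  have -> : cint (- w) w (fun s => g (s +i* (0 + pi *+ 2))) =
            cint (- w) w (fun s => g (s +i* 0)).
    by apply: eq_cintegral => s _; rewrite per.
  rewrite subrr subr0 => /eqP; rewrite mulf_eq0 subr_eq0 => /orP[|/eqP//].
  by rewrite eq_complex/= oner_eq0 andbF.
apply/eqP; rewrite -subr_eq0; apply/eqP/eq0_normc/le_anti.
rewrite normc_ge0 andbT; apply/ler_addgt0Pl => e e0; rewrite addr0.
have e1 : 0 < e / (pi *+ 2) by rewrite divr_gt0.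
have [d d0 Hd] := cderivable_continuous (differentiable_cderivable dF) 0 e1.
rewrite -/(g _) -(@cint_cst _ 0)//; last exact: ltW.
have -> : cint 0 (pi *+ 2) (fun s => F (cexp (0 +i* s))) =
  cint 0 (pi *+ 2) (fun s => g ((- d^-1) +i* s)).
  by apply: V; rewrite invr_gt0.
have cv := ccontinuous_vertical dg (- d^-1).
have cc : ccontinuous (fun=> F 0 : R[i]) by split=> s; exact: cvg_cst.
rewrite -cintB//.
rewrite -[leRHS](@divfK _ (pi *+ 2)); last by rewrite gt_eqF.
apply: le_normc_cint; first exact: ltW.
  split => s.
    under eq_fun do rewrite (raddfB (@complex.Re R : Rcomplex R -> R)).
    by apply: cvgB; [exact: (proj1 cv)|exact: cvg_cst].
  under eq_fun do rewrite (raddfB (@complex.Im R : Rcomplex R -> R)).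
  by apply: cvgB; [exact: (proj2 cv)|exact: cvg_cst].
move=> s _; apply: ltW.
have := Hd (cexp ((- d^-1) +i* s)); rewrite add0r; apply.
rewrite normc_cexp/= expRN -[ltRHS]invrK ltf_pV2 ?posrE ?expR_gt0 ?invr_gt0//.
by rewrite (lt_le_trans _ (expR_ge1Dx _))// ltrDr.
Qed.

End circle_mean.

Section indicator.
Context {R : realType} d (T : measurableType d).
Variable mu : {measure set T -> \bar R}.

Lemma cintegral_indic (D : set T) (f : T -> R[i]) :
  cintegral mu setT (fun x => (\1_D x)%:C * f x) = cintegral mu D f.
Proof.
rewrite /cintegral [in RHS]Rintegral_mkcond [X in _ = _ +i* X]Rintegral_mkcond.
congr (_ +i* _); apply: eq_Rintegral => x _.
  by rewrite Re_mulc/= mul0r subr0 indicE patchE; case: ifPn => _;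
    rewrite ?mul1r ?mul0r.
by rewrite Im_mulc/= mul0r addr0 indicE patchE; case: ifPn => _;
  rewrite ?mul1r ?mul0r.
Qed.

Lemma cintegrable_indic (D : set T) (f : T -> R[i]) : measurable D ->
  cintegrable mu D f -> cintegrable mu setT (fun x => (\1_D x)%:C * f x).
Proof.
move=> mD [mf foo]; split.
  by apply: cmeasurableM => //; apply: cmeasurableR; exact: measurable_indic.
rewrite integral_mkcond in foo; apply: le_lt_trans foo.
rewrite le_eqVlt; apply/orP; left; apply/eqP; apply: eq_integral => x _.
rewrite normcM normcR indicE patchE; case: ifPn => _.
  by rewrite normr1 mul1r.
by rewrite normr0 mul0r.
Qed.

End indicator.

Section mean_value.
Context {R : realType} {n : nat}.
Local Notation Cn := 'rV[R[i]]_n.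
Local Notation leb := (@lebesgue_measure R).

Lemma gauss_preserves (t : R) (Psi : Cn -> Cn) :
  preserves (@lebesgue_Cn R n) Psi ->
  (forall z, gauss_density t (Psi z) = gauss_density t z) ->
  preserves (@gauss_Cn R n t) Psi.
Proof.
move=> pPsi E; split; first by case: pPsi.
move=> A mA; rewrite /gauss_Cn integral_mkcond [RHS]integral_mkcond.
rewrite -[RHS](ge0_integral_preserves pPsi); last 2 first.
- apply/(measurable_restrictT _ mA)/measurable_EFinP; apply: measurable_funTS.
  exact: measurable_gauss_density.
- by move=> z; rewrite patchE; case: ifP => // _; rewrite lee_fin gauss_density_ge0.
apply: eq_integral => z _; rewrite !patchE.
by rewrite -[X in _ = if _ then X else _]/((gauss_density t (Psi z))%:E) E.
Qed.

Lemma sqnormCn_scale (u : R[i]) (z : Cn) :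
  sqnormCn (u *: z) = normc u ^+ 2 * sqnormCn z.
Proof.
by rewrite /sqnormCn mulr_sumr; apply: eq_bigr => i _; rewrite mxE normcM exprMn.
Qed.

Lemma gauss_Cn_rot (t : R) (u : R[i]) : normc u = 1 ->
  preserves (@gauss_Cn R n t) (fun z => u *: z).
Proof.
move=> u1; apply: gauss_preserves; first exact: lebesgue_Cn_rot.
by move=> z; rewrite /gauss_density sqnormCn_scale u1 expr1n mul1r.
Qed.

Lemma entire_line (F : Cn -> R[i]) (z : Cn) : entire F ->
  forall l, differentiable (fun l : R[i] => F (l *: z)) l.
Proof.
move=> dF l.
by apply: (@differentiable_comp _ _ _ _ (fun l : R[i] => l *: z) F).
Qed.

Lemma mean_value (t : R) (F : Cn -> R[i]) : 0 < t -> entire F ->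
  cintegrable (gauss_Cn n t) setT F -> cintegral (gauss_Cn n t) setT F = F 0.
Proof.
move=> t0 dF iF.
have p0 : 0 < pi *+ 2 :> R by rewrite mulrn_wgt0// pi_gt0.
pose D : set (measurableTypeR R) := `[0, 0 + pi *+ 2]%classic.
have mD : measurable D by exact: measurable_itv.
have lD : leb D = (pi *+ 2)%:E.
  by rewrite lebesgue_measure_itv/= lte_fin add0r p0 oppr0 adde0.
pose f (x : measurableTypeR R * Cn) :=
  (\1_D x.1)%:C * F (cexp (0 +i* x.1) *: x.2).
have u1 (s : R) : normc (cexp (0 +i* s)) = 1 by rewrite normc_cexp expR0.
have mu : cmeasurable (fun s : measurableTypeR R => cexp (0 +i* s)).
  apply: cmeasurable_cexp; split => /=; [exact: measurable_cst|exact: measurable_id].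
have mF := proj1 iF.
have mf : cmeasurable f.
  apply: cmeasurableM.
    apply: cmeasurableR; apply: (measurableT_comp (measurable_indic mD)).
    exact: measurable_fst.
  apply: (cmeasurable_comp (p := fun x : measurableTypeR R * Cn =>
    cexp (0 +i* x.1) *: x.2) _ mF).
  apply: measurable_CnP => i; under eq_fun do rewrite mxE.
  apply: cmeasurableM.
    exact: (cmeasurable_comp measurable_fst mu).
  exact: (cmeasurable_comp measurable_snd (cmeasurable_coord i)).
have iz s : cintegrable (gauss_Cn n t) setT (fun z => f (s, z)).
  exact: (cintegrableZ (\1_D s)%:C measurableT
    (cintegrable_preserves (gauss_Cn_rot t (u1 s)) iF)).
have is_ z : cintegrable leb setT (fun s => f (s, z)).
  have cv := ccontinuous_vertical (differentiable_cderivable (fun l =>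
    @differentiable_comp _ _ _ _ (@cexp R) _ l (differentiable_cexp l)
    (entire_line z dF (cexp l)))) 0.
  exact: (cintegrable_indic mD (ccontinuous_cintegrable 0 (0 + pi *+ 2) cv)).
have := cintegral_Fubini (m1 := leb) (m2 := gauss_Cn n t) mf _ iz is_.
have -> : cintegral leb setT (fun s =>
    cintegral (gauss_Cn n t) setT (fun z => f (s, z))) =
    cintegral (gauss_Cn n t) setT F * (pi *+ 2)%:C.
  transitivity (cintegral leb D (fun=> cintegral (gauss_Cn n t) setT F)).
    rewrite -[RHS]cintegral_indic; apply: eq_cintegral => s _.
    rewrite [LHS](cintegralZ (\1_D s)%:C measurableT
      (cintegrable_preserves (gauss_Cn_rot t (u1 s)) iF)).
    by rewrite (cintegral_preserves (gauss_Cn_rot t (u1 s)) mF).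
  by rewrite [LHS]cintegral_cst//; congr (_ * (_)%:C); rewrite -[RHS]/(fine (pi *+ 2)%:E) -lD.
have -> : cintegral (gauss_Cn n t) setT (fun z =>
    cintegral leb setT (fun s => f (s, z))) = F 0 * (pi *+ 2)%:C.
  transitivity (cintegral (gauss_Cn n t) setT (fun=> F 0 * (pi *+ 2)%:C)).
    apply: eq_cintegral => z _; rewrite cintegral_indic.
    by rewrite [LHS](circle_mean (entire_line z dF)) scale0r.
  rewrite [LHS]cintegral_cst// -[RHS]mulr1; congr (_ * _%:C).
  by have := @gauss_CnT R n t t0 => /(congr1 fine).
have fin : (\int[leb]_s \int[gauss_Cn n t]_z (normc (f (s, z)))%:E < +oo)%E.
  pose N := (\int[gauss_Cn n t]_z (normc (F z))%:E)%E.
  have N0 : (0 <= N)%E by apply: integral_ge0 => z _; rewrite lee_fin normc_ge0.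
  have -> : (\int[leb]_s \int[gauss_Cn n t]_z (normc (f (s, z)))%:E =
      \int[leb]_s ((\1_D s)%:E * N))%E.
    apply: eq_integral => s _.
    under eq_integral do rewrite /f/= normcM normcR EFinM.
    rewrite ge0_integralZl_EFin//; last 2 first.
    - by move=> z _; rewrite lee_fin normc_ge0.
    - apply: measurable_EFin_normc.
      exact: (proj1 (cintegrable_preserves (gauss_Cn_rot t (u1 s)) iF)).
    rewrite ger0_norm//; congr (_ * _)%E.
    apply: (ge0_integral_preserves (gauss_Cn_rot t (u1 s))
      (f := fun z => (normc (F z))%:E)).
      exact: measurable_EFin_normc.
    by move=> z; rewrite lee_fin normc_ge0.
  rewrite ge0_integralZr//; last first.
    by apply/measurable_EFinP; exact: measurable_indic.
  rewrite integral_indic// setIT; apply: lte_mul_pinfty => //.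
  - by rewrite -[X in X \is a fin_num]/(leb D) lD.
  - by case: iF.
move=> /(_ fin)/mulIf; apply.
by rewrite eq_complex/= negb_and gt_eqF.
Qed.

End mean_value.

(** * The Bergman projection as an integral operator *)

Section square_integrable.
Context {R : realType} {n : nat}.
Local Notation Cn := 'rV[R[i]]_n.
Implicit Types (f g : Cn -> R[i]) (t : R).

Definition sqint t f : \bar R := (\int[gauss_Cn n t]_z (normc (f z) ^+ 2)%:E)%E.

Lemma sqint_ge0 t f : (0 <= sqint t f)%E.
Proof. by apply: integral_ge0 => z _; rewrite lee_fin sqr_ge0. Qed.

Lemma L2normE t f : L2norm t f = sqrte (sqint t f).
Proof.
rewrite /L2norm /cLnorm unlock poweR12_sqrt.
  congr sqrte; apply: eq_integral => z _.
  by rewrite /= ger0_norm ?normc_ge0// powR_mulrn// normc_ge0.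
by apply: integral_ge0 => z _; exact: poweR_ge0.
Qed.

Lemma L2P t f : L2 t f <-> cmeasurable f /\ (sqint t f < +oo)%E.
Proof.
rewrite /L2 /cLp/= -/(L2norm t f) L2normE; split=> -[mf foo]; split => //.
  by move: foo; case: (sqint t f) (sqint_ge0 t f) => [r _ _|//|//]; exact: ltry.
by move: foo; case: (sqint t f) (sqint_ge0 t f) => [r _ _|//|//]; exact: ltry.
Qed.

Lemma measurable_normc_sqr D f : cmeasurable f ->
  measurable_fun D (fun z => (normc (f z) ^+ 2)%:E).
Proof.
move=> mf; apply/measurable_EFinP; apply: measurable_funTS.
by apply: measurable_funX; exact: measurable_normc.
Qed.

Lemma L2_cmeasurable t f : L2 t f -> cmeasurable f.
Proof. by case. Qed.

Lemma le_L2 t f (h : Cn -> R) : cmeasurable f -> measurable_fun setT h ->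
  (\int[gauss_Cn n t]_z (h z)%:E < +oo)%E ->
  (forall z, normc (f z) ^+ 2 <= h z) -> L2 t f.
Proof.
move=> mf mh hoo fh; apply/L2P; split => //; apply: le_lt_trans hoo.
apply: ge0_le_integral => //.
- by move=> z _; rewrite lee_fin sqr_ge0.
- exact: measurable_normc_sqr.
- exact/measurable_EFinP.
- by move=> z _; rewrite lee_fin.
Qed.

Lemma L2Z t (c : R[i]) f : L2 t f -> L2 t (fun z => c * f z).
Proof.
move=> /L2P[mf foo]; apply/L2P; split.
  by apply: cmeasurableM => //; exact: cmeasurable_cst.
rewrite /sqint; under eq_integral do rewrite normcM exprMn EFinM.
rewrite ge0_integralZl_EFin ?sqr_ge0//.
- by apply: lte_mul_pinfty => //; rewrite lee_fin sqr_ge0.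
- by move=> z _; rewrite lee_fin sqr_ge0.
- exact: measurable_normc_sqr.
Qed.

Lemma sqint_D2 t f g : cmeasurable f -> cmeasurable g ->
  (sqint t (fun z => f z + g z)%R <= 2%:E * sqint t f + 2%:E * sqint t g)%E.
Proof.
move=> mf mg.
rewrite /sqint -!ge0_integralZl_EFin//; last 4 first.
- by move=> z _; rewrite lee_fin sqr_ge0.
- exact: measurable_normc_sqr.
- by move=> z _; rewrite lee_fin sqr_ge0.
- exact: measurable_normc_sqr.
rewrite -ge0_integralD//; last 4 first.
- by move=> z _; rewrite -EFinM lee_fin mulr_ge0// sqr_ge0.
- by apply: measurable_funeM; exact: measurable_normc_sqr.
- by move=> z _; rewrite -EFinM lee_fin mulr_ge0// sqr_ge0.
- by apply: measurable_funeM; exact: measurable_normc_sqr.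
apply: ge0_le_integral => //.
- by move=> z _; rewrite lee_fin sqr_ge0.
- by apply: measurable_normc_sqr; exact: cmeasurableD.
- by apply: emeasurable_funD; apply: measurable_funeM; exact: measurable_normc_sqr.
- by move=> z _; rewrite -!EFinM -EFinD lee_fin normc_sqrD.
Qed.

Lemma L2D t f g : L2 t f -> L2 t g -> L2 t (fun z => f z + g z).
Proof.
move=> /L2P[mf foo] /L2P[mg goo]; apply/L2P; split; first exact: cmeasurableD.
apply: (le_lt_trans (sqint_D2 t mf mg)).
by apply: lte_add_pinfty; apply: lte_mul_pinfty.
Qed.

Lemma sqint_conj t f : sqint t (fun z => (f z)^*) = sqint t f.
Proof. by apply: eq_integral => z _; rewrite normc_conj. Qed.

Lemma sqintN t f : sqint t (fun z => - f z) = sqint t f.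
Proof. by apply: eq_integral => z _; rewrite normcN. Qed.

Lemma L2_conj t f : L2 t f -> L2 t (fun z => (f z)^*).
Proof.
by move=> /L2P[mf foo]; apply/L2P; rewrite sqint_conj; split => //;
  exact: cmeasurable_conj.
Qed.

Lemma L2N t f : L2 t f -> L2 t (fun z => - f z).
Proof.
by move=> /L2P[mf foo]; apply/L2P; rewrite sqintN; split => //;
  exact: cmeasurableN.
Qed.

Lemma L2B t f g : L2 t f -> L2 t g -> L2 t (fun z => f z - g z).
Proof. by move=> Lf Lg; apply: L2D => //; exact: L2N. Qed.

Lemma L2_mul_cintegrable t f g : L2 t f -> L2 t g ->
  cintegrable (gauss_Cn n t) setT (fun z => f z * g z).
Proof.
move=> /L2P[mf foo] /L2P[mg goo].
apply: (@le_cintegrable _ _ _ _ _ _ (fun z => normc (f z) ^+ 2 + normc (g z) ^+ 2)) => //.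
- exact: cmeasurableM.
- by apply: measurable_funD; apply: measurable_funX; exact: measurable_normc.
- under eq_integral do rewrite EFinD.
  rewrite ge0_integralD//; last 4 first.
  + by move=> z _; rewrite lee_fin sqr_ge0.
  + exact: measurable_normc_sqr.
  + by move=> z _; rewrite lee_fin sqr_ge0.
  + exact: measurable_normc_sqr.
  exact: lte_add_pinfty.
- move=> z _; rewrite normcM.
  have := normc_ge0 (f z); have := normc_ge0 (g z).
  by have := sqr_ge0 (normc (f z) - normc (g z)); nra.
Qed.

Lemma L2dot_cauchy_schwarz t f g : L2 t f -> L2 t g ->
  ((normc (L2dot t f g) ^+ 2)%:E <= sqint t f * sqint t g)%E.
Proof.
move=> Lf Lg; have [mf mg] := (L2_cmeasurable Lf, L2_cmeasurable Lg).
have ci := L2_mul_cintegrable Lf (L2_conj Lg).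
apply: le_trans (cauchy_schwarz_integral (gauss_Cn n t)
  (measurable_normc mf) (measurable_normc mg)
  (fun z => normc_ge0 (f z)) (fun z => normc_ge0 (g z))).
rewrite EFin_expe lee_sqr ?lee_fin ?normc_ge0//; last first.
  by apply: integral_ge0 => z _; rewrite lee_fin mulr_ge0// normc_ge0.
apply: (le_trans (le_normc_cintegral measurableT ci)).
rewrite le_eqVlt; apply/orP; left; apply/eqP; apply: eq_integral => z _.
by rewrite normcM normc_conj.
Qed.

Lemma L2dotBl t f g k : L2 t f -> L2 t g -> L2 t k ->
  L2dot t (fun z => f z - g z) k = L2dot t f k - L2dot t g k.
Proof.
move=> Lf Lg Lk; rewrite /L2dot -cintegralB//.
- by apply: eq_cintegral => z _; rewrite mulrBl.
- by apply: L2_mul_cintegrable => //; exact: L2_conj.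
- by apply: L2_mul_cintegrable => //; exact: L2_conj.
Qed.

Lemma L2dot_conj t f g : L2 t f -> L2 t g -> L2dot t g f = (L2dot t f g)^*.
Proof.
move=> Lf Lg; rewrite /L2dot -cintegral_conj//.
  by apply: eq_cintegral => z _; rewrite rmorphM/= conjcK mulrC.
by apply: L2_mul_cintegrable => //; exact: L2_conj.
Qed.

Lemma L2dotBr t f g k : L2 t f -> L2 t g -> L2 t k ->
  L2dot t k (fun z => f z - g z) = L2dot t k f - L2dot t k g.
Proof.
move=> Lf Lg Lk; rewrite (L2dot_conj (L2B Lf Lg) Lk) L2dotBl// rmorphB/=.
by rewrite (L2dot_conj Lf Lk) (L2dot_conj Lg Lk).
Qed.

Lemma L2dot_self t f : L2 t f -> L2dot t f f = (fine (sqint t f))%:C.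
Proof.
move=> Lf; rewrite /L2dot /cintegral; congr (_ +i* _).
  by congr fine; apply: eq_integral => z _; rewrite conj_mulc.
rewrite /Rintegral integral0_eq// => z _.
by rewrite conj_mulc.
Qed.

Lemma sqint_fin_num t f : L2 t f -> sqint t f \is a fin_num.
Proof. by move=> /L2P[_ foo]; rewrite ge0_fin_numE// sqint_ge0. Qed.

End square_integrable.

Section lebesgue_gauss.
Context {R : realType} {n : nat}.
Local Notation Cn := 'rV[R[i]]_n.
Local Notation leb := (@lebesgue_Cn R n).
Implicit Types (f : Cn -> R[i]) (t : R).

Lemma cintegrable_gauss t f : cmeasurable f ->
  cintegrable (gauss_Cn n t) setT f <->
  cintegrable leb setT (fun z => f z * (gauss_density t z)%:C).
Proof.
move=> mf.
have E : (\int[gauss_Cn n t]_z (normc (f z))%:E =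
    \int[leb]_z (normc (f z * (gauss_density t z)%:C)%R)%:E)%E.
  rewrite ge0_integral_gauss//; last 2 first.
  - exact: measurable_EFin_normc.
  - by move=> z; rewrite lee_fin normc_ge0.
  apply: eq_integral => z _; rewrite normcM normcR ger0_norm//.
  exact: gauss_density_ge0.
rewrite /cintegrable E; split=> -[_ foo]; split => //.
by apply: cmeasurableM => //; apply: cmeasurableR; exact: measurable_gauss_density.
Qed.

Lemma cintegral_gauss t f : cmeasurable f ->
  cintegral (gauss_Cn n t) setT f =
  cintegral leb setT (fun z => f z * (gauss_density t z)%:C).
Proof.
move=> mf; rewrite /cintegral /Rintegral.
have E (h : Cn -> R) : measurable_fun setT h ->
    (\int[gauss_Cn n t]_z (h z)%:E =
     \int[leb]_z (h z * gauss_density t z)%:E)%E.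
  move=> mh; rewrite integralE [RHS]integralE.
  have mhE : measurable_fun setT (EFin \o h) by exact/measurable_EFinP.
  have r0 z : (0 <= (gauss_density t z)%:E)%E by rewrite lee_fin gauss_density_ge0.
  congr (_ - _)%E.
    rewrite (@ge0_integral_gauss R n t (fun z => ((EFin \o h)^\+ z)%E)) //; last first.
      exact: measurable_funepos.
    by apply: eq_integral => z _; rewrite !funeposE EFinM maxe_pMl// mul0e.
  rewrite (@ge0_integral_gauss R n t (fun z => ((EFin \o h)^\- z)%E)) //; last first.
    exact: measurable_funeneg.
  by apply: eq_integral => z _; rewrite !funenegE EFinM maxe_pMl// mul0e mulNe.
have [mRe mIm] := mf.
rewrite !E//; congr (fine _ +i* fine _); apply: eq_integral => z _.
  by rewrite Re_mulc/= mulr0 subr0.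
by rewrite Im_mulc/= mulr0 add0r.
Qed.

End lebesgue_gauss.

Section fock_kernel.
Context {R : realType} {n : nat}.
Local Notation Cn := 'rV[R[i]]_n.
Local Notation leb := (@lebesgue_Cn R n).
Implicit Types (z w v : Cn) (t : R).

Lemma Re_sum (I : Type) (r : seq I) (F : I -> R[i]) :
  complex.Re (\sum_(i <- r) F i) = \sum_(i <- r) complex.Re (F i).
Proof. by apply: (big_morph (@complex.Re R)) => // -[a b] [c d]. Qed.

Definition hdot z w : R[i] := \sum_(i < n) z 0 i * (w 0 i)^*.

Lemma hdotDl z v w : hdot (z + v) w = hdot z w + hdot v w.
Proof.
by rewrite /hdot -big_split/=; apply: eq_bigr => i _; rewrite mxE mulrDl.
Qed.

Lemma hdotDr z v w : hdot z (v + w) = hdot z v + hdot z w.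
Proof.
by rewrite /hdot -big_split/=; apply: eq_bigr => i _; rewrite mxE rmorphD/= mulrDr.
Qed.

Lemma hdot0l w : hdot 0 w = 0.
Proof. by rewrite /hdot big1// => i _; rewrite mxE mul0r. Qed.

Lemma hdot_conj z w : (hdot z w)^* = hdot w z.
Proof.
by rewrite /hdot rmorph_sum/=; apply: eq_bigr => i _;
  rewrite rmorphM/= conjcK mulrC.
Qed.

Lemma sqnormCn_hdot z : (sqnormCn z)%:C = hdot z z.
Proof.
by rewrite /sqnormCn rmorph_sum; apply: eq_bigr => i _; rewrite conj_mulc.
Qed.

Lemma Re_hdot z w :
  2 * complex.Re (hdot z w) = sqnormCn z + sqnormCn w - sqnormCn (w - z).
Proof.
rewrite /hdot Re_sum /sqnormCn -big_split/= -sumrB mulr_sumr.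
apply: eq_bigr => i _; rewrite !mxE !normc_sqr.
by case: (z 0 i) (w 0 i) => [a b] [c d] /=; ring.
Qed.

Lemma sqnormCnN z : sqnormCn (- z) = sqnormCn z.
Proof. by apply: eq_bigr => i _; rewrite mxE normcN. Qed.

Lemma gauss_densityN t z : gauss_density t (- z) = gauss_density t z.
Proof. by rewrite /gauss_density sqnormCnN. Qed.

Definition fock_kernel t z w : R[i] := cexp ((4 * t)^-1%:C * hdot z w).

Lemma fock_kernel_conj t z w : (fock_kernel t z w)^* = fock_kernel t w z.
Proof. by rewrite /fock_kernel -cexp_conj rmorphM/= hdot_conj oppr0. Qed.

Lemma normc_fock_kernel t z w : normc (fock_kernel t z w) =
  expR ((sqnormCn z + sqnormCn w - sqnormCn (w - z)) / (8 * t)).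
Proof.
rewrite normc_cexp Re_mulc/= mul0r subr0 -Re_hdot; congr expR.
have [->|t0] := eqVneq t 0; first by rewrite !mulr0 invr0 mulr0 mul0r.
by field.
Qed.

Lemma cmeasurable_hdot d (T : measurableType d) (f g : T -> Cn) :
  measurable_fun setT f -> measurable_fun setT g ->
  cmeasurable (fun x => hdot (f x) (g x)).
Proof.
move=> mf mg; rewrite /hdot.
have key (r : seq 'I_n) :
    cmeasurable (fun x => \sum_(i <- r) f x 0 i * (g x 0 i)^*).
  elim: r => [|i r IH].
    by under eq_fun do rewrite big_nil; exact: cmeasurable_cst.
  under eq_fun do rewrite big_cons.
  apply: cmeasurableD => //; apply: cmeasurableM.
    exact: (cmeasurable_comp mf (cmeasurable_coord i)).
  apply: cmeasurable_conj.
  exact: (cmeasurable_comp mg (cmeasurable_coord i)).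
exact: key.
Qed.

Lemma cmeasurable_fock_kernel d (T : measurableType d) t (f g : T -> Cn) :
  measurable_fun setT f -> measurable_fun setT g ->
  cmeasurable (fun x => fock_kernel t (f x) (g x)).
Proof.
move=> mf mg; apply: cmeasurable_cexp; apply: cmeasurableM.
  exact: cmeasurable_cst.
exact: cmeasurable_hdot.
Qed.

Lemma measurable_CnB d (T : measurableType d) (f g : T -> Cn) :
  measurable_fun setT f -> measurable_fun setT g ->
  measurable_fun setT (fun x => f x - g x).
Proof.
move=> mf mg; apply: measurable_CnP => i; under eq_fun do rewrite !mxE.
apply: cmeasurableB.
  exact: (cmeasurable_comp mf (cmeasurable_coord i)).
exact: (cmeasurable_comp mg (cmeasurable_coord i)).
Qed.

Lemma integral_gauss_density_reflect t w : 0 < t ->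
  (\int[leb]_z (gauss_density t (w - z))%:E = 1)%E.
Proof.
move=> t0; rewrite -[RHS](@integral_gauss_density _ n t t0).
apply: (ge0_integral_preserves (lebesgue_Cn_reflect w)
  (f := fun z => (gauss_density t z)%:E)).
  by apply/measurable_EFinP; exact: measurable_gauss_density.
by move=> z; rewrite lee_fin gauss_density_ge0.
Qed.

Lemma integral_gauss_density_shift t z : 0 < t ->
  (\int[leb]_w (gauss_density t (w - z))%:E = 1)%E.
Proof.
move=> t0; rewrite -[RHS](integral_gauss_density_reflect z t0).
by apply: eq_integral => w _; rewrite -opprB gauss_densityN.
Qed.

Section schur.
Variables (t : R) (a : Cn * Cn -> R) (S : \bar R) (u : Cn -> R[i]).
Hypotheses (t0 : 0 < t) (a0 : forall x, 0 <= a x) (ma : measurable_fun setT a).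
Hypotheses (S0 : (0 <= S)%E) (mu : cmeasurable u).
Hypothesis aS : forall w,
  (\int[leb]_z (a (z, w) ^+ 2 * gauss_density (2 * t) (w - z))%:E <= S)%E.

Definition schur_fun z : \bar R :=
  (\int[gauss_Cn n t]_w (a (z, w) * normc (fock_kernel t z w * u w))%:E)%E.

Let t_neq0 : t != 0. Proof. by rewrite gt_eqF. Qed.
Let pi_neq0 : pi != 0 :> R. Proof. by rewrite gt_eqF// pi_gt0. Qed.

Let ma1 z : measurable_fun setT (fun w => a (z, w)).
Proof. exact: (measurableT_comp ma (pair1_measurable z)). Qed.

Let mk z : cmeasurable (fun w => fock_kernel t z w * u w).
Proof.
by apply: cmeasurableM => //; apply: cmeasurable_fock_kernel => //;
  exact: measurable_cst.
Qed.

Let schur_fun_sqr z : ((schur_fun z) ^+ 2 * (gauss_density t z)%:E <=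
  \int[leb]_w (4 ^+ n * (a (z, w) ^+ 2 * normc (u w) ^+ 2 * gauss_density t w *
    gauss_density (2 * t) (w - z)))%:E)%E.
Proof.
pose A := ((4 * pi * t) ^+ n)^-1; pose B := (8 * pi * t) ^+ n.
have A0 : 0 < A by rewrite invr_gt0 exprn_gt0// !mulr_gt0// pi_gt0.
have B0 : 0 < B by rewrite exprn_gt0// !mulr_gt0// pi_gt0.
have AB : A * B = 2 ^+ n.
  have key (p : R) : p != 0 -> (4 * p * t)^-1 * (8 * p * t) = 2.
    by move=> p0; field; rewrite t_neq0 p0.
  by rewrite /A /B -exprVn -exprMn key.
have rt (x : Cn) : gauss_density t x = A * expR (- (sqnormCn x / (4 * t))).
  by rewrite gauss_densityE// [LHS]mulrC.
have r2t (x : Cn) : B * gauss_density (2 * t) x = expR (- (sqnormCn x / (8 * t))).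
  have E : 4 * (2 * t) = 8 * t :> R by ring.
  have E' : 4 * pi * (2 * t) = 8 * pi * t :> R by ring.
  rewrite gauss_densityE ?mulr_gt0// E E' [LHS]mulrC divfK//.
  by rewrite gt_eqF.
clearbody A B.
pose s := Num.sqrt A * expR (- (sqnormCn z / (8 * t))).
have s0 : 0 <= s by rewrite mulr_ge0 ?expR_ge0.
have sE : gauss_density t z = s ^+ 2.
  rewrite rt /s exprMn sqr_sqrtr ?ltW// -expRM_natl; congr (_ * expR _).
  by field; rewrite gt_eqF.
pose F w := expR (- (sqnormCn (w - z) / (16 * t))).
pose G w := Num.sqrt A * A * (a (z, w) * normc (u w) *
  expR (- (sqnormCn w / (8 * t)))) * F w.
have F2 w : F w ^+ 2 = B * gauss_density (2 * t) (w - z).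
  rewrite r2t /F -expRM_natl; congr expR; field; rewrite gt_eqF//.
have mF : measurable_fun setT F.
  apply: (measurableT_comp (@measurable_expR R)); apply: measurable_funN.
  apply: measurable_funM => //; apply: (measurableT_comp (@measurable_sqnormCn R n)).
  by apply: measurable_CnB => //; exact: measurable_cst.
have mG : measurable_fun setT G.
  apply: measurable_funM => //; apply: measurable_funM => //.
  apply: measurable_funM; first by apply: measurable_funM => //; exact: measurable_normc.
  apply: (measurableT_comp (@measurable_expR R)); apply: measurable_funN.
  by apply: measurable_funM => //; exact: measurable_sqnormCn.
have F0 w : 0 <= F w by exact: expR_ge0.
have G0 w : 0 <= G w.
  by rewrite /G !mulr_ge0 ?expR_ge0 ?normc_ge0// ?sqrtr_ge0// ltW.
have E : (schur_fun z * s%:E = \int[leb]_w (F w * G w)%:E)%E.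
  rewrite /schur_fun ge0_integral_gauss; last 2 first.
  - apply/measurable_EFinP; apply: measurable_funM => //.
    exact: measurable_normc.
  - by move=> w; rewrite lee_fin mulr_ge0// normc_ge0.
  rewrite -[LHS]ge0_integralZr//; last 2 first.
  - apply: emeasurable_funM; apply/measurable_EFinP.
      by apply: measurable_funM => //; exact: measurable_normc.
    exact: measurable_gauss_density.
  - move=> w _; rewrite mule_ge0// lee_fin ?gauss_density_ge0//.
    by rewrite mulr_ge0// normc_ge0.
  apply: eq_integral => w _; rewrite -!EFinM; congr EFin.
  rewrite normcM normc_fock_kernel rt /s /G.
  have -> : expR ((sqnormCn z + sqnormCn w - sqnormCn (w - z)) / (8 * t)) =
      expR (sqnormCn z / (8 * t)) * expR (sqnormCn w / (8 * t)) * F w * F w.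
    by rewrite /F -!expRD; congr expR; field; rewrite gt_eqF.
  have -> : expR (- (sqnormCn w / (4 * t))) =
      expR (- (sqnormCn w / (8 * t))) * expR (- (sqnormCn w / (8 * t))).
    by rewrite -!expRD; congr expR; field; rewrite gt_eqF.
  have e1 : expR (sqnormCn z / (8 * t)) * expR (- (sqnormCn z / (8 * t))) = 1.
    by rewrite -expRD subrr expR0.
  have e2 : expR (sqnormCn w / (8 * t)) * expR (- (sqnormCn w / (8 * t))) = 1.
    by rewrite -expRD subrr expR0.
  move: e1 e2.
  set x1 := expR (sqnormCn z / _); set y1 := expR (- (sqnormCn z / _)).
  set x2 := expR (sqnormCn w / _); set y2 := expR (- (sqnormCn w / _)).
  move=> e1 e2.
  transitivity (Num.sqrt A * A * (a (z, w) * normc (u w) * y2) * F w * F w *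
     (x1 * y1) * (x2 * y2)); first by ring.
  by rewrite e1 e2; ring.
have -> : (schur_fun z ^+ 2 * (gauss_density t z)%:E =
    (\int[leb]_w (F w * G w)%:E) ^+ 2)%E.
  by rewrite -E sE expr2 EFinM !expe2 muleACA.
apply: (le_trans (cauchy_schwarz_integral _ mF mG F0 G0)).
have -> : (\int[leb]_w (F w ^+ 2)%:E = B%:E)%E.
  under eq_integral do rewrite F2 EFinM.
  rewrite ge0_integralZl_EFin//; last 3 first.
  - by move=> w _; rewrite lee_fin gauss_density_ge0.
  - apply/measurable_EFinP.
    apply: (measurableT_comp (@measurable_gauss_density R n (2 * t))).
    by apply: measurable_CnB => //; exact: measurable_cst.
  - exact: ltW.
  by rewrite integral_gauss_density_shift ?mule1// mulr_gt0.
rewrite -ge0_integralZl_EFin//; last 3 first.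
- by move=> w _; rewrite lee_fin sqr_ge0.
- by apply/measurable_EFinP; exact: measurable_funX.
- exact: ltW.
rewrite le_eqVlt; apply/orP; left; apply/eqP; apply: eq_integral => w _.
rewrite -EFinM; congr EFin.
have -> : G w ^+ 2 = Num.sqrt A ^+ 2 * A ^+ 2 * (a (z, w) ^+ 2 *
    normc (u w) ^+ 2 * expR (- (sqnormCn w / (8 * t))) ^+ 2) * F w ^+ 2.
  by rewrite /G; ring.
rewrite F2 sqr_sqrtr; last exact: ltW.
have -> : expR (- (sqnormCn w / (8 * t))) ^+ 2 = A^-1 * gauss_density t w.
  rewrite rt mulrA mulVf ?mul1r; last by rewrite gt_eqF.
  by rewrite -expRM_natl; congr expR; field; rewrite gt_eqF.
have -> : (4 : R) ^+ n = (A * B) ^+ 2.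
  rewrite AB -exprM mulnC exprM; congr (_ ^+ n); ring.
by field; rewrite gt_eqF.
Qed.

Let mfull : measurable_fun setT (fun x : Cn * Cn =>
  a x * normc (fock_kernel t x.1 x.2 * u x.2)).
Proof.
apply: measurable_funM => //; apply: measurable_normc; apply: cmeasurableM.
  by apply: cmeasurable_fock_kernel; [exact: measurable_fst|exact: measurable_snd].
exact: (cmeasurable_comp measurable_snd mu).
Qed.

Lemma measurable_schur_fun : measurable_fun setT schur_fun.
Proof.
apply: (@measurable_fun_fubini_tonelli_F _ _ _ _ _ (gauss_Cn n t)
  (fun x : Cn * Cn => (a x * normc (fock_kernel t x.1 x.2 * u x.2))%:E)).
  exact/measurable_EFinP.
by move=> x; rewrite lee_fin mulr_ge0// normc_ge0.
Qed.

Lemma schur_fun_ge0 z : (0 <= schur_fun z)%E.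
Proof. by apply: integral_ge0 => w _; rewrite lee_fin mulr_ge0// normc_ge0. Qed.

(* Schur test: Cauchy-Schwarz in w against the Gaussian in z - w, then
   Tonelli *)
Lemma schur_test : (\int[gauss_Cn n t]_z (schur_fun z) ^+ 2 <=
  (4 ^+ n)%:E * S * sqint t u)%E.
Proof.
rewrite ge0_integral_gauss; last 2 first.
- by under eq_fun do rewrite expe2; apply: emeasurable_funM; exact: measurable_schur_fun.
- by move=> z; rewrite expe_ge0// schur_fun_ge0.
pose H (x : Cn * Cn) := 4 ^+ n * (a x ^+ 2 * normc (u x.2) ^+ 2 *
  gauss_density t x.2 * gauss_density (2 * t) (x.2 - x.1)).
have mH : measurable_fun setT H.
  apply: measurable_funM => //; apply: measurable_funM.
    apply: measurable_funM.
      apply: measurable_funM; first exact: measurable_funX.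
      apply: measurable_funX; apply: measurable_normc.
      exact: (cmeasurable_comp measurable_snd mu).
    exact: (measurableT_comp (@measurable_gauss_density R n t) measurable_snd).
  apply: (measurableT_comp (@measurable_gauss_density R n (2 * t))).
  by apply: measurable_CnB; [exact: measurable_snd|exact: measurable_fst].
have H0 x : (0 <= (H x)%:E)%E.
  by rewrite lee_fin !mulr_ge0 ?exprn_ge0 ?normc_ge0 ?gauss_density_ge0.
apply: (@le_trans _ _ (\int[leb]_z \int[leb]_w (H (z, w))%:E)%E).
  apply: ge0_le_integral => //.
  - by move=> z _; rewrite mule_ge0 ?lee_fin ?gauss_density_ge0// expe_ge0// schur_fun_ge0.
  - apply: emeasurable_funM.
      by under eq_fun do rewrite expe2; apply: emeasurable_funM; exact: measurable_schur_fun.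
    by apply/measurable_EFinP; exact: measurable_gauss_density.
  - apply: (@measurable_fun_fubini_tonelli_F _ _ _ _ _ leb (EFin \o H)) => //.
    exact/measurable_EFinP.

have mHE : measurable_fun setT (EFin \o H) by exact/measurable_EFinP.
rewrite (@fubini_tonelli _ _ _ _ _ leb leb (EFin \o H) mHE H0).
apply: (@le_trans _ _ (\int[leb]_w ((4 ^+ n)%:E * S *
    ((normc (u w) ^+ 2)%:E * (gauss_density t w)%:E)))%E).
  apply: ge0_le_integral => //.
  - by move=> w _; apply: integral_ge0 => z _; exact: H0.
  - exact: (@measurable_fun_fubini_tonelli_G _ _ _ _ _ leb (EFin \o H) mHE H0).
  - apply: measurable_funeM; apply: emeasurable_funM.
      exact: measurable_normc_sqr.
    by apply/measurable_EFinP; exact: measurable_gauss_density.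
  move=> w _; rewrite /fubini_G/=.
  pose c := 4 ^+ n * (normc (u w) ^+ 2 * gauss_density t w).
  have c0 : 0 <= c by rewrite !mulr_ge0 ?exprn_ge0 ?normc_ge0 ?gauss_density_ge0.
  have -> : ((4 ^+ n)%:E * S * ((normc (u w) ^+ 2)%:E * (gauss_density t w)%:E) =
      c%:E * S)%E by rewrite /c !EFinM muleAC.
  apply: le_trans (lee_wpmul2l _ (aS w)); last by rewrite lee_fin.
  rewrite -ge0_integralZl_EFin//; last 2 first.
  - by move=> z _; rewrite lee_fin mulr_ge0 ?sqr_ge0 ?gauss_density_ge0.
  - apply/measurable_EFinP; apply: measurable_funM.
      by apply: measurable_funX; exact: (measurableT_comp ma (pair2_measurable w)).
    apply: (measurableT_comp (@measurable_gauss_density R n (2 * t))).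
    by apply: measurable_CnB => //; exact: measurable_cst.
  rewrite le_eqVlt; apply/orP; left; apply/eqP; apply: eq_integral => z _.
  by rewrite -EFinM /H /c/=; congr EFin; ring.
rewrite ge0_integralZl//; last 3 first.
- apply: emeasurable_funM; first exact: measurable_normc_sqr.
  by apply/measurable_EFinP; exact: measurable_gauss_density.
- by move=> w _; rewrite mule_ge0// lee_fin ?sqr_ge0 ?gauss_density_ge0.
- by rewrite mule_ge0// lee_fin exprn_ge0.
rewrite /sqint ge0_integral_gauss//; first exact: measurable_normc_sqr.
by move=> w; rewrite lee_fin sqr_ge0.
Qed.

End schur.
End fock_kernel.

Section entire_functions.
Context {R : realType} {n : nat}.
Local Notation Cn := 'rV[R[i]]_n.
Implicit Types (f g : Cn -> R[i]) (z w v : Cn) (t : R).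

Lemma entireD f g : entire f -> entire g -> entire (fun z => f z + g z).
Proof. by move=> ef eg z; exact: differentiableD. Qed.

Lemma entireN f : entire f -> entire (fun z => - f z).
Proof. by move=> ef z; exact: differentiableN. Qed.

Lemma entireB f g : entire f -> entire g -> entire (fun z => f z - g z).
Proof. by move=> ef eg; apply: entireD => //; exact: entireN. Qed.

Lemma entireM f g : entire f -> entire g -> entire (fun z => f z * g z).
Proof. by move=> ef eg z; exact: differentiableM. Qed.

Lemma entire_cst (c : R[i]) : entire (fun _ : Cn => c).
Proof. by move=> z; exact: differentiable_cst. Qed.

Lemma entire_coord (i : 'I_n) : entire (fun z : Cn => z 0 i).
Proof. by move=> z; exact: differentiable_coord. Qed.

Lemma entire_cexp f : entire f -> entire (fun z => cexp (f z)).
Proof.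
move=> ef z; apply: (@differentiable_comp _ _ _ _ f (@cexp R)) => //.
exact: differentiable_cexp.
Qed.

Lemma entire_sum (I : Type) (r : seq I) (F : I -> Cn -> R[i]) :
  (forall i, entire (F i)) -> entire (fun z => \sum_(i <- r) F i z).
Proof.
move=> eF; elim: r => [|i r IH].
  by under eq_fun do rewrite big_nil; exact: entire_cst.
by under eq_fun do rewrite big_cons; exact: entireD.
Qed.

Lemma entire_shift f v : entire f -> entire (fun z => f (z + v)).
Proof.
move=> ef z; apply: (@differentiable_comp _ _ _ _ (fun z => z + v) f) => //.
Qed.

Lemma entire_reflect f v : entire f -> entire (fun z => f (v - z)).
Proof.
move=> ef z; apply: (@differentiable_comp _ _ _ _ (fun z => v - z) f) => //.
Qed.

Lemma entire_hdot w : entire (fun z => hdot z w).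
Proof.
apply: entire_sum => i; apply: entireM; first exact: entire_coord.
exact: entire_cst.
Qed.

Lemma entire_fock_kernel t w : entire (fun z => fock_kernel t z w).
Proof.
apply: entire_cexp; apply: entireM; first exact: entire_cst.
exact: entire_hdot.
Qed.

End entire_functions.

Section fock_space.
Context {R : realType} {n : nat}.
Local Notation Cn := 'rV[R[i]]_n.
Local Notation leb := (@lebesgue_Cn R n).
Variable t : R.
Hypothesis t0 : 0 < t.
Local Notation mu := (@gauss_Cn R n t).
Local Notation K := (fock_kernel t).
Implicit Types (f g h u k : Cn -> R[i]) (z w v : Cn).

Let t_neq0 : t != 0. Proof. by rewrite gt_eqF. Qed.

Lemma cmeasurable_fock_kernel1 z : cmeasurable (K z).
Proof.
exact: (cmeasurable_fock_kernel t (measurable_cst z) (@measurable_id _ _ setT)).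
Qed.

Lemma cmeasurable_fock_kernel2 z : cmeasurable (fun w => K w z).
Proof.
exact: (cmeasurable_fock_kernel t (@measurable_id _ _ setT) (measurable_cst z)).
Qed.

Lemma fock_kernel_sqr_density z w :
  normc (K z w) ^+ 2 * gauss_density t w =
  expR (sqnormCn z / (4 * t)) * gauss_density t (w - z).
Proof.
rewrite !gauss_densityE// normc_fock_kernel -expRM_natl !mulrA -!expRD.
by congr (expR _ / _); field.
Qed.

Lemma sqint_fock_kernel z :
  sqint t (fun w => K w z) = (expR (sqnormCn z / (4 * t)))%:E.
Proof.
rewrite /sqint ge0_integral_gauss; last 2 first.
- by apply: measurable_normc_sqr; exact: cmeasurable_fock_kernel2.
- by move=> w; rewrite lee_fin sqr_ge0.
transitivity (\int[leb]_w ((expR (sqnormCn z / (4 * t)))%:E *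
    (gauss_density t (w - z))%:E))%E.
  apply: eq_integral => w _; rewrite -!EFinM -fock_kernel_sqr_density.
  by rewrite -fock_kernel_conj normc_conj.
rewrite ge0_integralZl_EFin ?expR_ge0//; last 2 first.
- by move=> w _; rewrite lee_fin gauss_density_ge0.
- apply/measurable_EFinP.
  apply: (measurableT_comp (@measurable_gauss_density R n t)).
  by apply: measurable_CnB => //; exact: measurable_cst.
by rewrite integral_gauss_density_shift// mule1.
Qed.

Lemma H2_fock_kernel z : H2 t (fun w => K w z).
Proof.
split; last exact: entire_fock_kernel.
apply/L2P; split; first exact: cmeasurable_fock_kernel2.
by rewrite sqint_fock_kernel ltry.
Qed.

Lemma L2_fock_kernel1 z : L2 t (K z).
Proof.
have := L2_conj (proj1 (H2_fock_kernel z)).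
by under eq_fun do rewrite fock_kernel_conj.
Qed.

Definition fock_proj u z : R[i] := cintegral mu setT (fun w => K z w * u w).

Lemma fock_proj_dot u z : fock_proj u z = L2dot t u (fun w => K w z).
Proof.
by apply: eq_cintegral => w _; rewrite -(fock_kernel_conj t w z) mulrC.
Qed.

Lemma fock_kernel_cintegrable u z : L2 t u ->
  cintegrable mu setT (fun w => K z w * u w).
Proof. by move=> Lu; apply: L2_mul_cintegrable => //; exact: L2_fock_kernel1. Qed.

Lemma fock_kernel_shift z v :
  K z (v + z) * (gauss_density t (v + z))%:C =
  cexp (- (4 * t)^-1%:C * hdot v z) * (gauss_density t v)%:C.
Proof.
have E (x : Cn) : (gauss_density t x)%:C = cexp (- (4 * t)^-1%:C * hdot x x) *
    ((4 * pi * t) ^+ n)^-1%:C.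
  rewrite gauss_densityE// rmorphM/= -cexp_real -sqnormCn_hdot; congr (cexp _ * _).
  by rewrite -[in RHS]rmorphN -rmorphM/= mulNr mulrC.
rewrite !E !mulrA /fock_kernel -!cexpD; congr (cexp _ * _).
by rewrite !(hdotDl, hdotDr); ring.
Qed.

Lemma fock_proj_H2 h z : H2 t h -> fock_proj h z = h z.
Proof.
move=> [Lh eh].
have mh := L2_cmeasurable Lh.
have ci := fock_kernel_cintegrable z Lh.
have mKh : cmeasurable (fun w => K z w * h w) by case: ci.
pose F v := cexp (- (4 * t)^-1%:C * hdot v z) * h (v + z).
have E v : F v * (gauss_density t v)%:C =
    ((fun w => K z w * h w * (gauss_density t w)%:C) \o (fun v => v + z)) v.
  by rewrite /F /= mulrAC -fock_kernel_shift mulrAC.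
have eF : entire F.
  apply: entireM; last exact: entire_shift.
  by apply: entire_cexp; apply: entireM; [exact: entire_cst|exact: entire_hdot].
have mF : cmeasurable F.
  apply: cmeasurableM.
    apply: cmeasurable_cexp; apply: cmeasurableM; first exact: cmeasurable_cst.
    by apply: cmeasurable_hdot => //; exact: measurable_cst.
  by apply: (cmeasurable_comp _ mh); case: (@lebesgue_Cn_shift R n z).
have ciL := (cintegrable_gauss t mKh).1 ci.
have iF : cintegrable mu setT F.
  apply/cintegrable_gauss => //.
  apply: eq_cintegrable (cintegrable_preserves (lebesgue_Cn_shift z) ciL).
  by move=> v; rewrite E.
rewrite /fock_proj cintegral_gauss//.
rewrite -(cintegral_preserves (lebesgue_Cn_shift z)); last by case: ciL.
have -> : h z = F 0 by rewrite /F add0r hdot0l mulr0 cexp0 mul1r.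
transitivity (cintegral mu setT F); last exact: mean_value.
rewrite [RHS](cintegral_gauss t mF).
by apply: eq_cintegral => v _; rewrite E.
Qed.

End fock_space.

Section fock_projection.
Context {R : realType} {n : nat}.
Local Notation Cn := 'rV[R[i]]_n.
Local Notation leb := (@lebesgue_Cn R n).
Variable t : R.
Hypothesis t0 : 0 < t.
Local Notation mu := (@gauss_Cn R n t).
Local Notation K := (fock_kernel t).
Implicit Types (f g h u k : Cn -> R[i]) (z w v : Cn).

Lemma normc_coord_le (h : Cn) (i : 'I_n) : (normc (h 0 i))%:C <= `|h|.
Proof.
rewrite -normE_normc -[leRHS]/(mx_norm h) mx_normE -[leLHS]nngE num_le.
exact: (le_bigmax _ (fun ij : 'I_1 * 'I_n => `|h ij.1 ij.2|%:nng) (0, i)).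
Qed.

Definition norm1Cn (w : Cn) : R := \sum_(i < n) normc (w 0 i).

Lemma norm1Cn_ge0 w : 0 <= norm1Cn w.
Proof. by apply: sumr_ge0 => i _; exact: normc_ge0. Qed.

Lemma normc_coord_le_norm1 w i : normc (w 0 i) <= norm1Cn w.
Proof.
rewrite /norm1Cn (bigD1 i)//= lerDl sumr_ge0// => j _.
exact: normc_ge0.
Qed.

Lemma measurable_norm1Cn : measurable_fun setT norm1Cn.
Proof.
apply: measurable_sum => i; apply: measurable_normc; exact: cmeasurable_coord.
Qed.

Lemma normc_sum (I : Type) (r : seq I) (F : I -> R[i]) :
  normc (\sum_(i <- r) F i) <= \sum_(i <- r) normc (F i).
Proof.
elim: r => [|i r IH]; first by rewrite !big_nil normc0.
by rewrite !big_cons (le_trans (le_normcD _ _))// lerD2l.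
Qed.

Lemma normc_hdot_le z w (H : R) : 0 <= H -> (forall i, normc (z 0 i) <= H) ->
  normc (hdot z w) <= H * norm1Cn w.
Proof.
move=> H0 zH; rewrite (le_trans (normc_sum _ _))// /norm1Cn mulr_sumr.
apply: ler_sum => i _; rewrite normcM -[normc (_^*)]/(normc (conjc _)).
by rewrite normc_conj ler_wpM2r// normc_ge0.
Qed.

Lemma expR_norm1_L2 (M : R) : L2 t (fun w : Cn => (expR (M * norm1Cn w))%:C).
Proof.
pose C := expR (8 * t * M ^+ 2 * n%:R).
have mE (a : R) : measurable_fun setT (fun w : Cn => expR (a * norm1Cn w)).
  apply: (measurableT_comp (@measurable_expR R)).
  by apply: measurable_funM => //; exact: measurable_norm1Cn.
have mq : measurable_fun setT (fun w : Cn => C * expR (sqnormCn w / (8 * t))).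
  apply: measurable_funM => //; apply: (measurableT_comp (@measurable_expR R)).
  by apply: measurable_funM => //; exact: measurable_sqnormCn.
apply: (@le_L2 _ _ _ _ (fun w => C * expR (sqnormCn w / (8 * t)))) => //.
- by apply: cmeasurableR; exact: mE.
- rewrite ge0_integral_gauss; last 2 first.
  + exact/measurable_EFinP.
  + by move=> w; rewrite lee_fin mulr_ge0// expR_ge0.
  have t20 : 0 < 2 * t by rewrite mulr_gt0.
  apply: (@le_lt_trans _ _ (\int[leb]_w ((C * 2 ^+ n)%:E *
      (gauss_density (2 * t) w)%:E))%E); last first.
    rewrite ge0_integralZl_EFin ?mulr_ge0 ?expR_ge0 ?exprn_ge0//; last 2 first.
    + by move=> w _; rewrite lee_fin gauss_density_ge0.
    + by apply/measurable_EFinP; exact: measurable_gauss_density.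
    by rewrite integral_gauss_density// mule1 ltry.
  rewrite le_eqVlt; apply/orP; left; apply/eqP; apply: eq_integral => w _.
  have E : 4 * pi * (2 * t) = 2 * (4 * pi * t) :> R by ring.
  rewrite -!EFinM !gauss_densityE// E; congr EFin.
  have -> : expR (- (sqnormCn w / (4 * (2 * t)))) =
      expR (sqnormCn w / (8 * t)) * expR (- (sqnormCn w / (4 * t))).
    by rewrite -expRD; congr expR; field; rewrite gt_eqF.
  have e2 : (2 : R) ^+ n * (2 ^+ n)^-1 = 1 by rewrite divff// expf_neq0.
  have -> : ((2 * (4 * pi * t)) ^+ n)^-1 = (2 ^+ n)^-1 * ((4 * pi * t) ^+ n)^-1.
    by rewrite exprMn invfM.
  move: e2; set X := ((4 * pi * t) ^+ n)^-1; set Y := (2 ^+ n)^-1 => e2.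
  set a := expR (sqnormCn w / _); set b := expR (- _); clearbody X C a b.
  transitivity (C * a * b * X * (2 ^+ n * Y)); first by rewrite e2; ring.
  by ring.
- move=> w; rewrite normcR ger0_norm ?expR_ge0// expr2 -expRD /C -expRD ler_expR.
  have -> : M * norm1Cn w + M * norm1Cn w = \sum_(i < n) M * normc (w 0 i) * 2.
    by rewrite -mulr_suml -mulr_sumr /norm1Cn; ring.
  have -> : 8 * t * M ^+ 2 * n%:R + sqnormCn w / (8 * t) =
      \sum_(i < n) (8 * t * M ^+ 2 + normc (w 0 i) ^+ 2 / (8 * t)).
    by rewrite big_split/= sumr_const card_ord mulr_natr mulr_suml.
  apply: ler_sum => i _.
  have : 0 <= (normc (w 0 i) / (8 * t) - M) ^+ 2 * (8 * t).
    by rewrite mulr_ge0 ?sqr_ge0// mulr_ge0// ltW.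
  set x := normc _.
  have -> : (x / (8 * t) - M) ^+ 2 * (8 * t) =
      8 * t * M ^+ 2 + x ^+ 2 / (8 * t) - M * x * 2.
    by field; rewrite gt_eqF.
  by rewrite subr_ge0.
Qed.

Lemma expR_norm1_cintegrable (M : R) u : L2 t u ->
  cintegrable mu setT (fun w => (expR (M * norm1Cn w))%:C * u w).
Proof. by move=> Lu; apply: L2_mul_cintegrable => //; exact: expR_norm1_L2. Qed.

Lemma normc_fock_kernel_le z w :
  normc (K z w) <= expR ((4 * t)^-1 * norm1Cn z * norm1Cn w).
Proof.
have c0 : 0 <= (4 * t)^-1 by rewrite invr_ge0 mulr_ge0// ltW.
rewrite normc_cexp ler_expR (le_trans (ler_norm _))//.
rewrite (le_trans (le_Re_normc _))// normcM normcR (ger0_norm c0) -mulrA.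
rewrite ler_wpM2l//.
by apply: normc_hdot_le; [exact: norm1Cn_ge0|exact: normc_coord_le_norm1].
Qed.

Lemma cintegrable_sum (I : Type) (r : seq I) (F : I -> Cn -> R[i]) :
  (forall i, cintegrable mu setT (F i)) ->
  cintegrable mu setT (fun w => \sum_(i <- r) F i w).
Proof.
move=> iF; elim: r => [|i r IH].
  under eq_fun do rewrite big_nil.
  split; first exact: cmeasurable_cst.
  by rewrite integral0_eq ?ltry// => w _; rewrite normc0.
by under eq_fun do rewrite big_cons; exact: cintegrableD.
Qed.

Lemma cintegral_sum (I : Type) (r : seq I) (F : I -> Cn -> R[i]) :
  (forall i, cintegrable mu setT (F i)) ->
  cintegral mu setT (fun w => \sum_(i <- r) F i w) =
  \sum_(i <- r) cintegral mu setT (F i).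
Proof.
move=> iF.
have is_ s := cintegrable_sum s iF.
elim: r => [|i r IH].
  rewrite big_nil (_ : (fun=> _) = (fun=> 0)).
    by rewrite cintegral_cst// mul0r.
  by apply/funext => w; rewrite big_nil.
rewrite big_cons -IH -cintegralD//.
by apply: eq_cintegral => w _; rewrite big_cons.
Qed.

Lemma entire_fock_proj u : L2 t u -> entire (fock_proj t u).
Proof.
move=> Lu z.
have mu_ := L2_cmeasurable Lu.
pose c : R := (4 * t)^-1; have c0 : 0 < c by rewrite invr_gt0 mulr_gt0.
pose a := c * norm1Cn z; have a0 : 0 <= a by rewrite mulr_ge0 ?norm1Cn_ge0// ltW.
have KE w : normc (K z w) <= expR (a * norm1Cn w) by exact: normc_fock_kernel_le.
have cW w : c * norm1Cn w <= expR (c * norm1Cn w).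
  by rewrite (le_trans _ (expR_ge1Dx _))// lerDr.
have cW2 w : (c * norm1Cn w) ^+ 2 <= expR (2 * c * norm1Cn w).
  rewrite -mulrA mulr2n mulrDl !mul1r expRD expr2.
  by rewrite ler_pM ?mulr_ge0 ?norm1Cn_ge0// ltW.
pose J i w := c%:C * ((w 0 i)^* * (K z w * u w)).
have mKu : cmeasurable (fun w => K z w * u w).
  by apply: cmeasurableM => //; exact: cmeasurable_fock_kernel1.
have iJ i : cintegrable mu setT (J i).
  have [mE Eoo] := expR_norm1_cintegrable (a + c) Lu.
  have mJ : cmeasurable (J i).
    apply: cmeasurableM; first exact: cmeasurable_cst.
    apply: cmeasurableM => //; apply: cmeasurable_conj; exact: cmeasurable_coord.
  apply: (le_cintegrable _ mJ (measurable_normc mE)) => // w _.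
  rewrite /J !normcM normcR -[normc (_^*)]/(normc (conjc _)) normc_conj.
  rewrite normcR !ger0_norm ?expR_ge0 ?(ltW c0)// !mulrA ler_wpM2r ?normc_ge0//.
  rewrite [a + c]addrC mulrDl expRD ler_pM ?mulr_ge0 ?normc_ge0 ?(ltW c0)//.
  rewrite (le_trans _ (cW w))// ler_wpM2l ?(ltW c0)//.
  exact: normc_coord_le_norm1.
pose l i := cintegral mu setT (J i).
pose r y := fock_proj t u y - \sum_(i < n) y 0 i * l i.
have dr : differentiable r z.
  have ci := expR_norm1_cintegrable (a + 3 * c) Lu.
  have [mE Eoo] := ci.
  pose I := fine (\int[mu]_w (normc ((expR ((a + 3 * c) * norm1Cn w))%:C * u w))%:E)%E.
  have I0 : 0 <= I.
    by apply: fine_ge0; apply: integral_ge0 => w _; rewrite lee_fin normc_ge0.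
  apply: (@differentiable_sq _ _ _ _ (3 * I)%:C); first by rewrite lecR mulr_ge0.
  move=> h h1.
  have hE : `|h| = (complex.Re `|h|)%:C by rewrite RRe_real// normr_real.
  set H := complex.Re `|h| in hE.
  have hi i : normc (h 0 i) <= H by rewrite -lecR -hE; exact: normc_coord_le.
  have H0 : 0 <= H by rewrite -ler0c -hE normr_ge0.
  have H1 : H <= 1 by rewrite -lecR -hE; exact: h1.
  pose E w := K z w * u w * (cexp (c%:C * hdot h w) - 1 - c%:C * hdot h w).
  have EJ w : E w = K (h + z) w * u w - K z w * u w - \sum_(i < n) h 0 i * J i w.
    have -> : K (h + z) w = K z w * cexp (c%:C * hdot h w).
      by rewrite /fock_kernel hdotDl mulrDr cexpD mulrC.
    have -> : \sum_(i < n) h 0 i * J i w = c%:C * hdot h w * (K z w * u w).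
      rewrite /hdot mulr_sumr mulr_suml; apply: eq_bigr => i _; rewrite /J; ring.
    rewrite /E; ring.
  have i1 y := fock_kernel_cintegrable t0 y Lu.
  have ihJ i : cintegrable mu setT (fun w => h 0 i * J i w) by exact: cintegrableZ.
  have rE : r (h + z) - r z = cintegral mu setT E.
    transitivity (cintegral mu setT (fun w => K (h + z) w * u w - K z w * u w -
        \sum_(i < n) h 0 i * J i w)); last first.
      by apply: eq_cintegral => w _; rewrite EJ.
    rewrite cintegralB//; last 2 first.
    - exact: cintegrableB.
    - exact: cintegrable_sum.
    rewrite cintegralB// cintegral_sum// /r /fock_proj.
    under [X in _ = _ - X]eq_bigr do rewrite cintegralZ//.
    have -> : \sum_(i < n) (h + z) 0 i * l i =
        \sum_(i < n) h 0 i * l i + \sum_(i < n) z 0 i * l i.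
      by rewrite -big_split/=; apply: eq_bigr => i _; rewrite mxE mulrDl.
    by rewrite /l; ring.
  have mEE : cmeasurable E.
    have mch : cmeasurable (fun w => c%:C * hdot h w).
      apply: cmeasurableM; first exact: cmeasurable_cst.
      exact: (cmeasurable_hdot (measurable_cst h) (@measurable_id _ _ setT)).
    apply: cmeasurableM => //; apply: cmeasurableB => //.
    apply: cmeasurableB; last exact: cmeasurable_cst.
    exact: cmeasurable_cexp.
  have EB w : normc (E w) <= 3 * H ^+ 2 *
      normc ((expR ((a + 3 * c) * norm1Cn w))%:C * u w).
    have W0 := norm1Cn_ge0 w.
    have b : normc (c%:C * hdot h w) <= H * (c * norm1Cn w).
      rewrite normcM normcR (gtr0_norm c0) mulrCA ler_wpM2l ?(ltW c0)//.
      exact: normc_hdot_le.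
    have b1 : normc (c%:C * hdot h w) <= c * norm1Cn w.
      by rewrite (le_trans b)// ler_piMl// mulr_ge0// ltW.
    rewrite /E normcM normcM normcM normcR (ger0_norm (expR_ge0 _)).
    rewrite [leLHS](_ : _ = normc (u w) * (normc (K z w) *
      normc (cexp (c%:C * hdot h w) - 1 - c%:C * hdot h w))); last by ring.
    rewrite [leRHS](_ : _ = normc (u w) * (expR ((a + 3 * c) * norm1Cn w) *
      (3 * H ^+ 2))); last by ring.
    rewrite ler_wpM2l ?normc_ge0// mulrDl expRD -mulrA.
    apply: ler_pM; rewrite ?normc_ge0 ?KE//.
    apply: (le_trans (cexp_taylor1_le _)).
    have e1 : expR (3 * c * norm1Cn w) =
        expR (2 * c * norm1Cn w) * expR (c * norm1Cn w).
      by rewrite -expRD; congr expR; ring.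
    rewrite e1 [leRHS](_ : _ = 3 * (H ^+ 2 * expR (2 * c * norm1Cn w)) *
      expR (c * norm1Cn w)); last by ring.
    apply: ler_pM.
    - by rewrite mulr_ge0// sqr_ge0.
    - exact: expR_ge0.
    - rewrite ler_pM2l//.
    apply: (@le_trans _ _ ((H * (c * norm1Cn w)) ^+ 2)).
        by rewrite ler_pXn2r// nnegrE ?normc_ge0// !mulr_ge0// ltW.
      by rewrite exprMn ler_wpM2l ?sqr_ge0.
    - by rewrite ler_expR.
  rewrite rE normE_normc hE -rmorphXn -rmorphM/= lecR -lee_fin.
  have iE : cintegrable mu setT E.
    apply: (@le_cintegrable _ _ _ _ _ _ (fun w => 3 * H ^+ 2 *
      normc ((expR ((a + 3 * c) * norm1Cn w))%:C * u w))) => //.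
      by apply: measurable_funM => //; exact: measurable_normc.
    under eq_integral do rewrite EFinM.
    rewrite ge0_integralZl_EFin ?mulr_ge0 ?sqr_ge0//.
    - by apply: lte_mul_pinfty => //; rewrite lee_fin mulr_ge0// sqr_ge0.
    - by move=> w _; rewrite lee_fin normc_ge0.
    - exact: measurable_EFin_normc.
  apply: (le_trans (le_normc_cintegral _ iE)) => //.
  apply: (@le_trans _ _ (\int[mu]_w ((3 * H ^+ 2)%:E *
      (normc ((expR ((a + 3 * c) * norm1Cn w))%:C * u w))%:E))%E).
    apply: ge0_le_integral => //.
    - by move=> w _; rewrite lee_fin normc_ge0.
    - exact: measurable_EFin_normc.
    - by apply: measurable_funeM; exact: measurable_EFin_normc.
    - by move=> w _; rewrite -EFinM lee_fin EB.
  rewrite ge0_integralZl_EFin ?mulr_ge0 ?sqr_ge0//.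
  - rewrite mulrAC [(3 * H ^+ 2 * I)%:E]EFinM lee_wpmul2l//.
      by rewrite lee_fin mulr_ge0// sqr_ge0.
    rewrite /I fineK// ge0_fin_numE//.
    by apply: integral_ge0 => w _; rewrite lee_fin normc_ge0.
  - by move=> w _; rewrite lee_fin normc_ge0.
  - exact: measurable_EFin_normc.
have -> : fock_proj t u = r + (fun y => \sum_(i < n) y 0 i * l i).
  by apply/funext => y; rewrite fctE /r subrK.
apply: differentiableD => //.
apply: (@entire_sum R n _ _ (fun i (y : Cn) => y 0 i * l i)) => i.
by apply: entireM; [exact: entire_coord|exact: entire_cst].
Qed.

Lemma sqint_schur (a : Cn * Cn -> R) (S : \bar R) u (v : Cn -> R[i]) :
  (forall x, 0 <= a x) -> measurable_fun setT a -> (0 <= S)%E ->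
  cmeasurable u -> cmeasurable v ->
  (forall w, (\int[leb]_z (a (z, w) ^+ 2 *
    gauss_density (2 * t) (w - z))%:E <= S)%E) ->
  (forall z, (normc (v z))%:E <= schur_fun t a u z)%E ->
  (sqint t v <= (4 ^+ n)%:E * S * sqint t u)%E.
Proof.
move=> a0 ma S0 mu_ mv aS vle.
apply: le_trans (schur_test t0 a0 ma S0 mu_ aS).
apply: ge0_le_integral => //.
- by move=> z _; rewrite lee_fin sqr_ge0.
- exact: measurable_normc_sqr.
- under eq_fun do rewrite expe2.
  by apply: emeasurable_funM; exact: measurable_schur_fun.
move=> z _; rewrite EFin_expe lee_sqr ?vle//; first by rewrite lee_fin normc_ge0.
exact: schur_fun_ge0.
Qed.

Lemma cmeasurable_fock_integrand u : cmeasurable u ->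
  cmeasurable (fun x : Cn * Cn => K x.1 x.2 * u x.2).
Proof.
move=> mu_; apply: cmeasurableM.
  exact: (cmeasurable_fock_kernel t measurable_fst measurable_snd).
exact: (cmeasurable_comp measurable_snd mu_).
Qed.

Lemma cmeasurable_fock_proj u : cmeasurable u -> cmeasurable (fock_proj t u).
Proof.
by move=> mu_; exact: (cmeasurable_cintegral mu (cmeasurable_fock_integrand mu_)).
Qed.

Let schur1 w : (\int[leb]_z ((1 : R) ^+ 2 * gauss_density (2 * t) (w - z))%:E
  <= 1)%E.
Proof.
under eq_integral do rewrite expr1n mul1r.
by rewrite integral_gauss_density_reflect// mulr_gt0.
Qed.

Lemma sqint_fock_proj u : L2 t u ->
  (sqint t (fock_proj t u) <= (4 ^+ n)%:E * sqint t u)%E.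
Proof.
move=> Lu; have mu_ := L2_cmeasurable Lu.
rewrite -[X in (X * _)%E]mule1; apply: (@sqint_schur (fun=> 1)) => //.
- exact: cmeasurable_fock_proj.
- move=> z; rewrite /schur_fun; under eq_integral do rewrite mul1r.
  exact: (le_normc_cintegral measurableT (fock_kernel_cintegrable t0 z Lu)).
Qed.

Lemma H2_fock_proj u : L2 t u -> H2 t (fock_proj t u).
Proof.
move=> Lu; split; last exact: entire_fock_proj.
have /L2P[mu_ uoo] := Lu; apply/L2P; split; first exact: cmeasurable_fock_proj.
apply: (le_lt_trans (sqint_fock_proj Lu)); apply: lte_mul_pinfty => //.
Qed.

Lemma fock_proj_adjoint u k : L2 t u -> L2 t k ->
  L2dot t (fock_proj t u) k = L2dot t u (fock_proj t k).
Proof.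
move=> Lu Lk; have [mu_ mk] := (L2_cmeasurable Lu, L2_cmeasurable Lk).
pose one (x : Cn * Cn) : R := 1.
pose f (x : Cn * Cn) := K x.1 x.2 * u x.2 * (k x.1)^*.
have mf : cmeasurable f.
  apply: cmeasurableM; first exact: cmeasurable_fock_integrand.
  exact: (cmeasurable_conj (cmeasurable_comp measurable_fst mk)).
have i2 z : cintegrable mu setT (fun w => f (z, w)).
  have := cintegrableZ ((k z)^*) measurableT (fock_kernel_cintegrable t0 z Lu).
  by apply: eq_cintegrable => w; rewrite mulrC.
have fE z w : f (z, w) = u w * (K w z * k z)^*.
  by rewrite /f/= rmorphM/= -(fock_kernel_conj t w z); ring.
have i1 w : cintegrable mu setT (fun z => f (z, w)).
  have := cintegrableZ (u w) measurableT
    (cintegrable_conj (fock_kernel_cintegrable t0 w Lk)).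
  by apply: eq_cintegrable => z; rewrite fE.
have fin : (\int[mu]_z \int[mu]_w (normc (f (z, w)))%:E < +oo)%E.
  have mS := @measurable_schur_fun R n t one u (fun=> ler01)
    (measurable_cst _) mu_.
  have S0 := @schur_fun_ge0 R n t one u (fun=> ler01).
  have Sfin z : schur_fun t one u z \is a fin_num.
    rewrite ge0_fin_numE// /schur_fun; under eq_integral do rewrite /one mul1r.
    by have [] := fock_kernel_cintegrable t0 z Lu.
  have uoo := (L2P t u).1 Lu; have koo := (L2P t k).1 Lk.
  have E z : (\int[mu]_w (normc (f (z, w)))%:E =
      schur_fun t one u z * (normc (k z))%:E)%E.
    rewrite /schur_fun -ge0_integralZr//.
    - apply: eq_integral => w _.
      rewrite /f/one/= mul1r normcM -[normc (_^*)]/(normc (conjc _)) normc_conj.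
      by rewrite EFinM.
    - apply/measurable_EFinP; apply: measurable_funM => //.
      apply: measurable_normc; apply: cmeasurableM => //.
      exact: cmeasurable_fock_kernel1.
    - by move=> w _; rewrite /one mul1r lee_fin normc_ge0.
    - by rewrite lee_fin normc_ge0.
  under eq_integral do rewrite E.
  apply: (@le_lt_trans _ _ (\int[mu]_z (schur_fun t one u z ^+ 2 +
      (normc (k z) ^+ 2)%:E))%E).
    apply: ge0_le_integral => //.
    - by move=> z _; rewrite mule_ge0// lee_fin normc_ge0.
    - by apply: emeasurable_funM => //; exact: measurable_EFin_normc.
    - apply: emeasurable_funD; last exact: measurable_normc_sqr.
      by under eq_fun do rewrite expe2; exact: emeasurable_funM.
    - move=> z _; rewrite -(fineK (Sfin z)) -EFin_expe -EFinM -EFinD lee_fin.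
      have : 0 <= fine (schur_fun t one u z) by exact: fine_ge0.
      set x := fine _; set y := normc _ => x0.
      have y0 : 0 <= y by exact: normc_ge0.
      by have := sqr_ge0 (x - y); nra.
  rewrite ge0_integralD//; last 4 first.
  - by move=> z _; rewrite expe_ge0.
  - by under eq_fun do rewrite expe2; exact: emeasurable_funM.
  - by move=> z _; rewrite lee_fin sqr_ge0.
  - exact: measurable_normc_sqr.
  apply: lte_add_pinfty; last by case: koo.
  apply: (le_lt_trans (schur_test t0 (fun=> ler01) (measurable_cst _) lee01 mu_ schur1)).
  rewrite mule1; apply: lte_mul_pinfty; [by rewrite lee_fin exprn_ge0|by []|].
  by case: uoo.
have H := cintegral_Fubini (m1 := mu) (m2 := mu) mf fin i2 i1.
transitivity (cintegral mu setT (fun z => cintegral mu setT (fun w => f (z, w)))).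
  apply: eq_cintegral => z _; rewrite mulrC.
  have E := cintegralZ (Num.conj (k z)) measurableT
    (fock_kernel_cintegrable t0 z Lu).
  by apply: (etrans (esym E)); apply: eq_cintegral => w _; rewrite mulrC.
rewrite H; apply: eq_cintegral => w _.
transitivity (u w * cintegral mu setT (fun z => (K w z * k z)^*)).
  have E := cintegralZ (u w) measurableT
    (cintegrable_conj (fock_kernel_cintegrable t0 w Lk)).
  by apply: (etrans _ E); apply: eq_cintegral => z _; rewrite fE.
congr (_ * _); rewrite /fock_proj.
exact: (cintegral_conj measurableT (fock_kernel_cintegrable t0 w Lk)).
Qed.

Lemma fock_proj_orth u k : L2 t u -> H2 t k ->
  L2dot t (fun z => u z - fock_proj t u z) k = 0.
Proof.
move=> Lu Hk; have [Lk _] := Hk; have [Lp _] := H2_fock_proj Lu.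
rewrite L2dotBl// fock_proj_adjoint//.
have -> : fock_proj t k = k by apply/funext => z; exact: fock_proj_H2.
by rewrite subrr.
Qed.

Lemma bergman_projE u : L2 t u -> bergman_proj t u = fock_proj t u.
Proof.
move=> Lu; rewrite /bergman_proj; case: xgetP => [g _ [Hg gorth]|H]; last first.
  exfalso; apply: (H (fock_proj t u)); split; first exact: H2_fock_proj.
  by move=> k Hk; exact: fock_proj_orth.
apply/funext => z; have [Lg _] := Hg.
have [LK eK] := H2_fock_kernel t0 z.
have := gorth _ (H2_fock_kernel t0 z); rewrite L2dotBl//.
rewrite -!fock_proj_dot (fock_proj_H2 t0 z Hg) => /eqP.
by rewrite subr_eq0 => /eqP ->.
Qed.

End fock_projection.

(** * Bounded symbols and Toeplitz operators *)

Section essentially_bounded.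
Context {R : realType} {n : nat}.
Local Notation Cn := 'rV[R[i]]_n.
Local Notation leb := (@lebesgue_Cn R n).
Implicit Types (f g h : Cn -> R[i]) (t M : R) (w z : Cn).

Definition ess_bounded M f :=
  [/\ cmeasurable f, 0 <= M & {ae leb, forall z, normc (f z) <= M}].

Lemma Linfty_ess_bounded f : Linfty R n f -> exists M, ess_bounded M f.
Proof.
move=> [mf]; rewrite /cLnorm unlock.
have [T0|T0] := ltP 0%E (leb setT); last first.
  move=> _; exists 0; split => //; apply: (@negligibleS _ _ _ _ setT) => //.
  apply/negligibleP => //; apply/eqP.
  by rewrite eq_le T0 measure_ge0.
move=> foo; pose s := ess_sup leb (abse \o (EFin \o (fun z => normc (f z)))).
have sge := ess_sup_ge leb (abse \o (EFin \o (fun z => normc (f z)))).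
have {}foo : (s < +oo)%E by exact: foo.
exists (Num.max 0 (fine s)); split => //; first by rewrite le_max lexx.
apply: filterS sge => z; rewrite -/s /= => fs.
rewrite le_max; apply/orP; right; rewrite -lee_fin fineK.
  by apply: le_trans fs; rewrite lee_fin ler_norm.
by rewrite ge0_fin_numE// (le_trans _ fs)// lee_fin.
Qed.

Lemma Linfty_conj f : Linfty R n f -> Linfty R n (fun z => (f z)^*).
Proof.
move=> [mf foo]; split; first exact: cmeasurable_conj.
rewrite /cLnorm (_ : (fun z => normc (conjc (f z))) = (fun z => normc (f z)))//.
by apply/funext => z; rewrite normc_conj.
Qed.

Lemma ess_bounded_conj M f : ess_bounded M f -> ess_bounded M (fun z => (f z)^*).
Proof.
move=> [mf M0 fM]; split => //; first exact: cmeasurable_conj.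
by apply: filterS fM => z; rewrite normc_conj.
Qed.

Lemma le_integral_ess_bounded M f (p : nat) (h : Cn -> R) : ess_bounded M f ->
  measurable_fun setT h -> (forall z, 0 <= h z) ->
  (\int[leb]_z (normc (f z) ^+ p * h z)%:E <=
   (M ^+ p)%:E * \int[leb]_z (h z)%:E)%E.
Proof.
move=> [mf M0 fM] mh h0.
rewrite -ge0_integralZl_EFin ?exprn_ge0//;
  [|by move=> z _; rewrite lee_fin|exact/measurable_EFinP].
apply: ae_ge0_le_integral => //.
- by move=> z _; rewrite lee_fin mulr_ge0// exprn_ge0// normc_ge0.
- apply/measurable_EFinP; apply: measurable_funM => //.
  by apply: measurable_funX; exact: measurable_normc.
- by move=> z _; rewrite -EFinM lee_fin mulr_ge0// exprn_ge0.
- by apply: measurable_funeM; exact/measurable_EFinP.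
apply: filterS fM => z fzM _; rewrite -EFinM lee_fin ler_wpM2r//.
by rewrite lerXn2r// nnegrE normc_ge0.
Qed.

Lemma ess_bounded_sqintM M f h t : ess_bounded M f -> cmeasurable h ->
  (sqint t (fun z => f z * h z)%R <= (M ^+ 2)%:E * sqint t h)%E.
Proof.
move=> fM mh; have [mf M0 _] := fM.
rewrite /sqint !ge0_integral_gauss; last 4 first.
- exact: measurable_normc_sqr.
- by move=> z; rewrite lee_fin sqr_ge0.
- by apply: measurable_normc_sqr; exact: cmeasurableM.
- by move=> z; rewrite lee_fin sqr_ge0.
under eq_integral do rewrite normcM exprMn -EFinM -mulrA.
under [in leRHS]eq_integral do rewrite -EFinM.
apply: le_integral_ess_bounded => //.
  apply: measurable_funM; last exact: measurable_gauss_density.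
  by apply: measurable_funX; exact: measurable_normc.
by move=> z; rewrite mulr_ge0 ?sqr_ge0 ?gauss_density_ge0.
Qed.

Lemma ess_bounded_L2M M f h t : ess_bounded M f -> L2 t h ->
  L2 t (fun z => f z * h z).
Proof.
move=> fM /L2P[mh hoo]; have [mf M0 _] := fM; apply/L2P; split.
  exact: cmeasurableM.
apply: (le_lt_trans (ess_bounded_sqintM t fM mh)).
by apply: lte_mul_pinfty; rewrite ?lee_fin ?exprn_ge0.
Qed.

Section heat_transform.
Variables (t : R) (M : R) (f : Cn -> R[i]).
Hypotheses (t0 : 0 < t) (fM : ess_bounded M f).

Let mf : cmeasurable f. Proof. by case: fM. Qed.
Let M0 : 0 <= M. Proof. by case: fM. Qed.

Lemma measurable_gauss_reflect (s : R) w :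
  measurable_fun setT (fun z => gauss_density s (w - z)).
Proof.
apply: (measurableT_comp (@measurable_gauss_density R n s)).
exact: (measurable_CnB (measurable_cst w) (@measurable_id _ _ setT)).
Qed.

Lemma cmeasurable_reflect w : cmeasurable (fun z => f (w - z)).
Proof.
apply: (cmeasurable_comp (p := fun z => w - z) _ mf).
exact: (measurable_CnB (measurable_cst w) (@measurable_id _ _ setT)).
Qed.

Lemma integral_gauss_reflect (s : R) w (u : Cn -> R) : measurable_fun setT u ->
  (forall z, 0 <= u z) ->
  (\int[gauss_Cn n s]_z (u (w - z))%:E =
   \int[leb]_z (u z * gauss_density s (w - z))%:E)%E.
Proof.
move=> mu u0; have mr : measurable_fun setT (fun z : Cn => w - z).
  exact: (measurable_CnB (measurable_cst w) (@measurable_id _ _ setT)).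
rewrite ge0_integral_gauss; last 2 first.
- by apply/measurable_EFinP; exact: (measurableT_comp mu mr).
- by move=> z; rewrite lee_fin.
rewrite -[RHS](ge0_integral_preserves (lebesgue_Cn_reflect w)); last 2 first.
- apply/measurable_EFinP; apply: measurable_funM => //.
  exact: measurable_gauss_reflect.
- by move=> z; rewrite lee_fin mulr_ge0// gauss_density_ge0.
by apply: eq_integral => z _; rewrite subKr EFinM.
Qed.

Lemma ess_bounded_reflect_L2 w : L2 t (fun z => f (w - z)).
Proof.
apply/L2P; split; first exact: cmeasurable_reflect.
rewrite /sqint (@integral_gauss_reflect t w (fun z => normc (f z) ^+ 2)); last 2 first.
- by apply: measurable_funX; exact: measurable_normc.
- by move=> z; exact: sqr_ge0.
apply: (le_lt_trans (le_integral_ess_bounded 2 fM (measurable_gauss_reflect t w) _)).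
  by move=> z; exact: gauss_density_ge0.
by rewrite integral_gauss_density_reflect// mule1 ltry.
Qed.

Lemma integral_gauss_cst (x : R) :
  (\int[gauss_Cn n t]_z (fun _ : Cn => x%:E) z = x%:E)%E.
Proof.
rewrite integral_cst// -[RHS]mule1; congr (_ * _)%E; exact: gauss_CnT.
Qed.

Lemma gauss_cintegrable_cst (c : R[i]) : cintegrable (gauss_Cn n t) setT (fun=> c).
Proof.
split; first exact: cmeasurable_cst.
by rewrite integral_gauss_cst ltry.
Qed.

Lemma L2_cst (c : R[i]) : L2 t (fun _ : Cn => c).
Proof.
apply/L2P; split; first exact: cmeasurable_cst.
by rewrite /sqint integral_gauss_cst ltry.
Qed.

Lemma ess_bounded_reflect_cintegrable w :
  cintegrable (gauss_Cn n t) setT (fun z => f (w - z)).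
Proof.
have := L2_mul_cintegrable (ess_bounded_reflect_L2 w) (L2_cst 1).
by under eq_fun do rewrite mulr1.
Qed.

Lemma normc_heat_le w : normc (heat t f w) <= M.
Proof.
rewrite -lee_fin.
apply: (le_trans (le_normc_cintegral _ (ess_bounded_reflect_cintegrable w))) => //.
rewrite (@integral_gauss_reflect t w (fun z => normc (f z))); last 2 first.
- exact: measurable_normc.
- by move=> z; exact: normc_ge0.
have := le_integral_ess_bounded 1 fM (measurable_gauss_reflect t w)
  (fun z => gauss_density_ge0 t (w - z)).
by rewrite integral_gauss_density_reflect// mule1.
Qed.

Lemma cmeasurable_heat : cmeasurable (heat t f).
Proof.
apply: (cmeasurable_cintegral (gauss_Cn n t) (f := fun x : Cn * Cn => f (x.1 - x.2))).
apply: (cmeasurable_comp (p := fun x : Cn * Cn => x.1 - x.2) _ mf).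
exact: (measurable_CnB measurable_fst measurable_snd).
Qed.

Lemma MO_sqint w : MO t f w = sqint t (fun z => f (w - z) - heat t f w).
Proof. by []. Qed.

Lemma MO_lebesgue w : MO t f w = (\int[leb]_z
  (normc (f z - heat t f w) ^+ 2 * gauss_density t (w - z))%:E)%E.
Proof.
apply: (@integral_gauss_reflect t w (fun z => normc (f z - heat t f w) ^+ 2)).
  apply: measurable_funX; apply: measurable_normc.
  exact: (cmeasurableB mf (cmeasurable_cst _ (heat t f w))).
by move=> z; exact: sqr_ge0.
Qed.

Lemma heat_conj w : heat t (fun z => (f z)^*) w = (heat t f w)^*.
Proof. exact: (cintegral_conj measurableT (ess_bounded_reflect_cintegrable w)). Qed.

Lemma MO_conj w : MO t (fun z => (f z)^*) w = MO t f w.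
Proof.
apply: eq_integral => z _; rewrite heat_conj -(rmorphB (@conjc R)).
by rewrite normc_conj.
Qed.

Lemma le_MO_cst w (c : R[i]) :
  (MO t f w <= 4%:E * sqint t (fun z => f (w - z) - c)%R)%E.
Proof.
have Lf := ess_bounded_reflect_L2 w.
have Lfc := L2B Lf (L2_cst c).
have ms := sqint_ge0 t (fun z => f (w - z) - c).
have E : (sqint t (fun _ : Cn => c - heat t f w)%R <= sqint t (fun z => f (w - z) - c)%R)%E.
  rewrite [X in (X <= _)%E]integral_gauss_cst.
  have -> : c - heat t f w = - (L2dot t (fun z => f (w - z) - c) (fun=> 1)).
    rewrite /L2dot.
    have -> : cintegral (gauss_Cn n t) setT
        (fun z => (f (w - z) - c) * conjc 1) =
        cintegral (gauss_Cn n t) setT (fun z => f (w - z) - c).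
      by apply: eq_cintegral => z _; rewrite conjc1 mulr1.
    rewrite cintegralB//; last 2 first.
    - exact: ess_bounded_reflect_cintegrable.
    - exact: gauss_cintegrable_cst.
    rewrite opprB; congr (_ - _).
    rewrite [RHS]cintegral_cst// -[LHS]mulr1; congr (_ * _%:C).
    by have := @gauss_CnT R n t t0 => /(congr1 fine) ->.
  rewrite normcN; apply: (le_trans (L2dot_cauchy_schwarz Lfc (L2_cst 1))).
  rewrite [X in (_ * X)%E](_ : _ = 1%E) ?mule1//.
  by rewrite /sqint integral_gauss_cst normc1 expr1n.
have mfc := L2_cmeasurable Lfc.
have := sqint_D2 t mfc (cmeasurable_cst _ (c - heat t f w)).
have -> : (fun z => f (w - z) - c + (c - heat t f w)) =
  (fun z => f (w - z) - heat t f w) by apply/funext => z; rewrite addrA subrK.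
move=> /le_trans; apply.
rewrite -[X in (_ <= X)%E]/(4%:E * _)%E.
have -> : (4%:E = 2%:E + 2%:E :> \bar R)%E by rewrite -EFinD; congr EFin; ring.
by rewrite [leRHS]ge0_muleDl ?lee_fin//; apply: leeD => //; apply: lee_wpmul2l.
Qed.

End heat_transform.

End essentially_bounded.

Section toeplitz_bounds.
Context {R : realType} {n : nat}.
Local Notation Cn := 'rV[R[i]]_n.
Local Notation leb := (@lebesgue_Cn R n).
Variable t : R.
Hypothesis t0 : 0 < t.
Local Notation mu := (@gauss_Cn R n t).
Local Notation K := (fock_kernel t).
Local Notation P := (fock_proj t).
Implicit Types (f g h u k v : Cn -> R[i]) (M : R) (w z : Cn).

Lemma ess_boundedM M N f g : ess_bounded M f -> ess_bounded N g ->
  ess_bounded (M * N) (fun z => f z * g z).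
Proof.
move=> [mf M0 fM] [mg N0 gN]; split; [exact: cmeasurableM|exact: mulr_ge0|].
by apply: filterS2 fM gN => z fz gz; rewrite normcM ler_pM// normc_ge0.
Qed.

Lemma hankel_approx M f h (S : \bar R) : ess_bounded M f -> H2 t h ->
  (0 <= S)%E -> (forall w, (MO (2 * t) f w <= S)%E) ->
  exists2 q, H2 t q &
    (sqint t (fun z => f z * h z - q z)%R <= (4 ^+ n)%:E * S * sqint t h)%E.
Proof.
move=> fM Hh S0 MOS; have [Lh _] := Hh; have mh := L2_cmeasurable Lh.
have t20 : 0 < 2 * t by rewrite mulr_gt0.
have mf : cmeasurable f by case: fM.
pose b := heat (2 * t) f.
have mb : cmeasurable b by exact: (cmeasurable_heat (2 * t) fM).
have bM : ess_bounded M b.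
  split => //; first by case: fM.
  by apply: aeW => z; exact: normc_heat_le.
have Lbh : L2 t (fun z => b z * h z) by exact: (ess_bounded_L2M bM Lh).
exists (P (fun z => b z * h z)); first exact: H2_fock_proj.
pose a (x : Cn * Cn) := normc (f x.1 - b x.2).
have ma : measurable_fun setT a.
  apply: measurable_normc; apply: cmeasurableB.
    exact: (cmeasurable_comp measurable_fst mf).
  exact: (cmeasurable_comp measurable_snd mb).
have Lfh := ess_bounded_L2M fM Lh.
apply: (sqint_schur t0 (a := a)) => //.
- by move=> x; exact: normc_ge0.
- by apply: L2_cmeasurable (L2B Lfh _); have [] := H2_fock_proj t0 Lbh.
- by move=> w; rewrite -(MO_lebesgue (2 * t) fM); exact: (MOS w).
move=> z.
have i1 := cintegrableZ (f z) measurableT (fock_kernel_cintegrable t0 z Lh).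
have i2 := fock_kernel_cintegrable t0 z Lbh.
have E : f z * h z - P (fun z => b z * h z) z =
    cintegral mu setT (fun w => (f z - b w) * (K z w * h w)).
  rewrite -[in LHS](fock_proj_H2 t0 z Hh).
  rewrite -[X in X - _](cintegralZ (f z) measurableT (fock_kernel_cintegrable t0 z Lh)).
  rewrite -[LHS](cintegralB measurableT i1 i2).
  by apply: eq_cintegral => w _; rewrite mulrBl; congr (_ - _); ring.
rewrite E.
have i3 : cintegrable mu setT (fun w => (f z - b w) * (K z w * h w)).
  apply: eq_cintegrable (cintegrableB measurableT i1 i2) => w.
  by rewrite mulrBl; congr (_ - _); ring.
apply: (le_trans (le_normc_cintegral measurableT i3)).
rewrite le_eqVlt; apply/orP; left; apply/eqP; apply: eq_integral => w _.
by rewrite /a/= normcM.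
Qed.

Lemma fock_projB u v z : L2 t u -> L2 t v ->
  P (fun z => u z - v z) z = P u z - P v z.
Proof.
move=> Lu Lv; rewrite -[RHS](cintegralB measurableT
  (fock_kernel_cintegrable t0 z Lu) (fock_kernel_cintegrable t0 z Lv)).
by apply: eq_cintegral => w _; rewrite mulrBr.
Qed.

Lemma toeplitzE M f h : ess_bounded M f -> L2 t h ->
  toeplitz t f h = P (fun z => f z * h z).
Proof.
by move=> fM Lh; apply: bergman_projE => //; exact: (ess_bounded_L2M fM Lh).
Qed.

Definition hankel f h z : R[i] := f z * h z - P (fun y => f y * h y) z.

Lemma hankel_L2 M f h : ess_bounded M f -> L2 t h -> L2 t (hankel f h).
Proof.
move=> fM Lh; have Lfh := ess_bounded_L2M fM Lh.
by apply: L2B => //; have [] := H2_fock_proj t0 Lfh.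
Qed.

Lemma hankel_orth M f h k : ess_bounded M f -> L2 t h -> H2 t k ->
  L2dot t (hankel f h) k = 0.
Proof.
by move=> fM Lh Hk; apply: fock_proj_orth => //; exact: (ess_bounded_L2M fM Lh).
Qed.

Lemma toeplitz_semicommutator M N f g h z : ess_bounded M f -> ess_bounded N g ->
  L2 t h ->
  toeplitz t f (toeplitz t g h) z - toeplitz t (fun w => f w * g w) h z =
  - P (fun y => f y * hankel g h y) z.
Proof.
move=> fM gN Lh.
have Lgh := ess_bounded_L2M gN Lh.
have [LPgh _] := H2_fock_proj t0 Lgh.
rewrite (toeplitzE gN Lh) (toeplitzE fM LPgh) (toeplitzE (ess_boundedM fM gN) Lh).
have L1 := ess_bounded_L2M fM LPgh.
have L2' := ess_bounded_L2M (ess_boundedM fM gN) Lh.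
rewrite -(fock_projB z L1 L2').
have L3 := ess_bounded_L2M fM (hankel_L2 gN Lh).
rewrite -[RHS](cintegralN measurableT (fock_kernel_cintegrable t0 z L3)).
by apply: eq_cintegral => w _; rewrite /hankel; ring.
Qed.

Lemma sqint_le_of_sqr u (y : \bar R) : L2 t u ->
  (sqint t u * sqint t u <= y * sqint t u -> 0 <= y -> sqint t u <= y)%E.
Proof.
move=> Lu; have := sqint_ge0 t u; have /fineK <- := sqint_fin_num Lu.
set x := fine _; rewrite lee_fin => x0.
case: y => [y| |//]; last by move=> _ _; rewrite leey.
rewrite -!EFinM !lee_fin => xy y0.
have [->//|x1] := eqVneq x 0.
by rewrite -(ler_pM2r (x := x))// lt_def x1.
Qed.

Lemma hankel_le M f h (S : \bar R) : ess_bounded M f -> H2 t h -> (0 <= S)%E ->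
  (forall w, (MO (2 * t) f w <= S)%E) ->
  (sqint t (hankel f h) <= (4 ^+ n)%:E * S * sqint t h)%E.
Proof.
move=> fM Hh S0 MOS; have [Lh _] := Hh.
have [q Hq le] := hankel_approx fM Hh S0 MOS; have [Lq _] := Hq.
have Lv := hankel_L2 fM Lh; have Lfh := ess_bounded_L2M fM Lh.
apply: le_trans le; apply: sqint_le_of_sqr => //; last exact: sqint_ge0.
have HP := H2_fock_proj t0 Lfh.
have E : L2dot t (hankel f h) (hankel f h) =
    L2dot t (hankel f h) (fun z => f z * h z - q z).
  rewrite {2}/hankel !L2dotBr//; last by case: HP.
  by rewrite (hankel_orth fM Lh HP) (hankel_orth fM Lh Hq).
have := L2dot_cauchy_schwarz Lv (L2B Lfh Lq).
rewrite -E L2dot_self// normcR.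
rewrite ger0_norm; last by rewrite fine_ge0// sqint_ge0.
by rewrite expr2 EFinM fineK ?sqint_fin_num// [X in (_ <= X)%E]muleC.
Qed.

Lemma semicommutator_le M N f g h (S : \bar R) :
  ess_bounded M f -> ess_bounded N g -> H2 t h -> (0 <= S)%E ->
  (forall w, (MO (2 * t) f w <= S)%E) ->
  (sqint t (P (fun z => f z * hankel g h z)%R) <=
    (4 ^+ n)%:E * S * sqint t (hankel g h))%E.
Proof.
move=> fM gN Hh S0 MOS; have [Lh _] := Hh.
have Lv := hankel_L2 gN Lh.
have Lfv := ess_bounded_L2M fM Lv.
have fcM := ess_bounded_conj fM.
set p := P _; have Hp : H2 t p by exact: H2_fock_proj.
have [Lp _] := Hp.
have Lcp := ess_bounded_L2M fcM Lp.
have MOS' w : (MO (2 * t) (fun z => (f z)^*) w <= S)%E.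
  by rewrite (MO_conj _ fM)// mulr_gt0.
have [q Hq le] := hankel_approx fcM Hp S0 MOS'; have [Lq _] := Hq.
have E : L2dot t p p = L2dot t (hankel g h) (fun z => (f z)^* * p z - q z).
  rewrite L2dotBr// (hankel_orth gN Lh Hq) subr0 {1}/p fock_proj_adjoint//.
  have -> : P p = p by apply/funext => z; exact: fock_proj_H2.
  apply: eq_cintegral => z _; rewrite rmorphM.
  by rewrite [X in _ = _ * (X * _)](conjcK (f z)); ring.
apply: sqint_le_of_sqr => //; last first.
  by rewrite !mule_ge0 ?sqint_ge0// lee_fin exprn_ge0.
have := L2dot_cauchy_schwarz Lv (L2B Lcp Lq).
rewrite -E L2dot_self// normcR.
rewrite ger0_norm; last by rewrite fine_ge0// sqint_ge0.
rewrite expr2 EFinM fineK ?sqint_fin_num// => /le_trans; apply.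
rewrite [leRHS](_ : _ = sqint t (hankel g h) * ((4 ^+ n)%:E * S * sqint t p))%E.
  by rewrite lee_wpmul2l// sqint_ge0.
by rewrite muleAC [RHS]muleC.
Qed.

Lemma sqrte1 : (sqrte 1 = 1 :> \bar R)%E.
Proof. by rewrite /= sqrtr1. Qed.

Lemma opnorm_le (X : (Cn -> R[i]) -> Cn -> R[i]) (y : \bar R) : (0 <= y)%E ->
  (forall h, H2 t h -> sqint t (X h) <= y * sqint t h)%E ->
  (opnorm t X <= sqrte y)%E.
Proof.
move=> y0 Xy; apply: ge_ereal_sup => _ [h [Hh]] h1 <-.
rewrite L2normE lee_sqrt//; apply: (le_trans (Xy h Hh)).
rewrite -[leRHS]mule1; apply: lee_wpmul2l => //.
by move: h1; rewrite L2normE -[X in (_ <= X)%E]sqrte1 lee_sqrt.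
Qed.

Lemma opnorm_ge (X : (Cn -> R[i]) -> Cn -> R[i]) h : H2 t h ->
  (sqint t h <= 1)%E -> (sqrte (sqint t (X h)) <= opnorm t X)%E.
Proof.
move=> Hh h1; rewrite -L2normE; apply: ereal_sup_ubound; exists h => //; split => //.
by rewrite L2normE -[X in (_ <= X)%E]sqrte1 lee_sqrt.
Qed.

Lemma sqint_hankel_bound M f h : ess_bounded M f -> H2 t h ->
  (sqint t (hankel f h) <= (2 * M ^+ 2 + 2 * (4 ^+ n * M ^+ 2))%:E * sqint t h)%E.
Proof.
move=> fM [Lh _]; have Lfh := ess_bounded_L2M fM Lh.
have mh := L2_cmeasurable Lh.
have [LP _] := H2_fock_proj t0 Lfh.
have h0 := sqint_ge0 t h.
apply: le_trans (sqint_D2 t (L2_cmeasurable Lfh) (L2_cmeasurable (L2N LP))) _.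
have a0 : 0 <= 2 * M ^+ 2 by rewrite mulr_ge0// sqr_ge0.
have b0 : 0 <= 2 * (4 ^+ n * M ^+ 2).
  by rewrite mulr_ge0// mulr_ge0 ?sqr_ge0// exprn_ge0.
rewrite sqintN [leRHS](@ge0_muleDl _ (sqint t h) (2 * M ^+ 2)%:E
  (2 * (4 ^+ n * M ^+ 2))%:E)//.
have hM := ess_bounded_sqintM t fM mh.
apply: leeD; first by rewrite [in leRHS]EFinM -muleA lee_wpmul2l.
rewrite [in leRHS]EFinM -muleA lee_wpmul2l//.
apply: (le_trans (sqint_fock_proj t0 Lfh)).
by rewrite [in leRHS]EFinM -muleA lee_wpmul2l// lee_fin exprn_ge0.
Qed.

Lemma opnorm_semicommutator_le M N f g (S : \bar R) :
  ess_bounded M f -> ess_bounded N g -> (0 <= S)%E ->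
  (forall w, (MO (2 * t) f w <= S)%E) ->
  let C := 4 ^+ n * (2 * N ^+ 2 + 2 * (4 ^+ n * N ^+ 2)) in
  (opnorm t (fun h z => (toeplitz t f (toeplitz t g h) z -
     toeplitz t (fun w => f w * g w) h z)%R) <= sqrte (C%:E * S))%E /\
  (opnorm t (fun h z => (toeplitz t g (toeplitz t f h) z -
     toeplitz t (fun w => f w * g w) h z)%R) <= sqrte (C%:E * S))%E.
Proof.
move=> fM gN S0 MOS C.
have N2 : 0 <= N ^+ 2 by exact: sqr_ge0.
have F0 : 0 <= (4 : R) ^+ n by rewrite exprn_ge0.
have C0 : 0 <= C by rewrite /C mulr_ge0// addr_ge0// mulr_ge0// mulr_ge0.
have C40 : (0 <= (4 ^+ n)%:E :> \bar R)%E by rewrite lee_fin exprn_ge0.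
split; apply: opnorm_le; rewrite ?mule_ge0// => h Hh; have [Lh _] := Hh;
    have h0 := sqint_ge0 t h.
  have -> : (fun z => toeplitz t f (toeplitz t g h) z -
      toeplitz t (fun w => f w * g w) h z) =
      (fun z => - P (fun y => f y * hankel g h y) z).
    by apply/funext => z; exact: (toeplitz_semicommutator z fM gN Lh).
  rewrite sqintN; apply: (le_trans (semicommutator_le fM gN Hh S0 MOS)).
  apply: (le_trans (lee_wpmul2l _ (sqint_hankel_bound gN Hh))).
    by rewrite mule_ge0.
  by rewrite /C EFinM muleA -[X in (_ <= X)%E]muleA muleACA -!muleA.
have -> : (fun z => toeplitz t g (toeplitz t f h) z -
    toeplitz t (fun w => f w * g w) h z) =
    (fun z => - P (fun y => g y * hankel f h y) z).
  have E : (fun w => f w * g w) = (fun w => g w * f w).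
    by apply/funext => w; rewrite mulrC.
  by apply/funext => z; rewrite E; exact: (toeplitz_semicommutator z gN fM Lh).
have Lv := hankel_L2 fM Lh.
rewrite sqintN; apply: (le_trans (sqint_fock_proj t0 (ess_bounded_L2M gN Lv))).
apply: (le_trans (lee_wpmul2l C40 (ess_bounded_sqintM t gN (L2_cmeasurable Lv)))).
rewrite muleA -EFinM.
apply: (le_trans (lee_wpmul2l _ (hankel_le fM Hh S0 MOS))).
  by rewrite lee_fin mulr_ge0.
rewrite !muleA -EFinM; do 2 (apply: lee_wpmul2r => //).
rewrite lee_fin /C -mulrA ler_wpM2l ?exprn_ge0//.
have : 0 <= 4 ^+ n * N ^+ 2 by rewrite mulr_ge0.
move: N2.
rewrite [N ^+ 2 * _]mulrC; lra.
Qed.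

End toeplitz_bounds.

Section mean_oscillation.
Context {R : realType} {n : nat}.
Local Notation Cn := 'rV[R[i]]_n.
Local Notation leb := (@lebesgue_Cn R n).
Variable t : R.
Hypothesis t0 : 0 < t.
Local Notation mu := (@gauss_Cn R n t).
Local Notation K := (fock_kernel t).
Local Notation P := (fock_proj t).
Implicit Types (f g h u k v : Cn -> R[i]) (M : R) (w z : Cn).

(* Entire functions vanishing at 0 are orthogonal to their conjugates, so the
   holomorphic approximants of phi and of its conjugate can only be close to
   each other when both are nearly constant. *)
Lemma sqint_subr_mean_le (phi p q : Cn -> R[i]) : L2 t phi -> H2 t p -> H2 t q ->
  q 0 = (p 0)^* ->
  (sqint t (fun z => phi z - p 0)%R <= 6%:E * sqint t (fun z => phi z - p z)%R +
    4%:E * sqint t (fun z => (phi z)^* - q z)%R)%E.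
Proof.
move=> Lphi [Lp ep] [Lq eq_] q0.
pose a z := p z - p 0; pose b z := (q z - q 0)^*.
have La : L2 t a by apply: L2B => //; exact: L2_cst.
have Lb' : L2 t (fun z => q z - q 0) by apply: L2B => //; exact: L2_cst.
have Lb : L2 t b by exact: L2_conj.
have ab0 : L2dot t a b = 0.
  pose F z := a z * (q z - q 0).
  have FE : L2dot t a b = cintegral mu setT F.
    by apply: eq_cintegral => z _; rewrite /F; congr (_ * _); exact: conjcK.
  rewrite FE mean_value//.
  - by rewrite /F /a subrr mul0r.
  - by apply: entireM; apply: entireB => //; exact: entire_cst.
  - exact: L2_mul_cintegrable.
have Lab := L2B La Lb.
have ab : (sqint t a <= sqint t (fun z => a z - b z)%R)%E.
  have : L2dot t (fun z => a z - b z) (fun z => a z - b z) =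
      (fine (sqint t a) + fine (sqint t b))%:C.
    rewrite (L2dotBl La Lb Lab) (L2dotBr La Lb La) (L2dotBr La Lb Lb).
    rewrite (L2dot_self La) (L2dot_self Lb) (L2dot_conj La Lb) ab0.
    by rewrite conjc0 subr0 sub0r opprK rmorphD.
  rewrite (L2dot_self Lab) => /complexI E.
  rewrite -[leLHS]fineK ?sqint_fin_num// -[leRHS]fineK ?sqint_fin_num// lee_fin E.
  by rewrite lerDl fine_ge0// sqint_ge0.
pose x := sqint t (fun z => phi z - p z); pose y := sqint t (fun z => (phi z)^* - q z).
have mphi := L2_cmeasurable Lphi.
have [mp mq] := (L2_cmeasurable Lp, L2_cmeasurable Lq).
have Lc := L2_conj Lphi.
have h1 : (sqint t (fun z => phi z - p 0)%R <= 2%:E * x + 2%:E * sqint t a)%E.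
  rewrite (_ : (fun z => phi z - p 0) = (fun z => (phi z - p z) + a z)).
    exact: (sqint_D2 t (L2_cmeasurable (L2B Lphi Lp)) (L2_cmeasurable La)).
  by apply/funext => z; rewrite /a addrA subrK.
have h2 : (sqint t (fun z => a z - b z)%R <= 2%:E * x + 2%:E * y)%E.
  have -> : x = sqint t (fun z => - (phi z - p z)) by rewrite sqintN.
  have -> : y = sqint t (fun z => ((phi z)^* - q z)^*) by rewrite sqint_conj.
  rewrite (_ : (fun z => a z - b z) =
    (fun z => - (phi z - p z) + ((phi z)^* - q z)^*)).
    exact: (sqint_D2 t (L2_cmeasurable (L2N (L2B Lphi Lp)))
      (L2_cmeasurable (L2_conj (L2B Lc Lq)))).
  apply/funext => z; rewrite /a /b q0.
  by case: (phi z) (p z) (p 0) (q z) => [? ?] [? ?] [? ?] [? ?];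
    apply/eqP; rewrite eq_complex/=; apply/andP; split; apply/eqP; ring.
have xfin : x \is a fin_num by apply: sqint_fin_num; exact: L2B.
have yfin : y \is a fin_num by apply: sqint_fin_num; exact: L2B.
have afin := sqint_fin_num La.
have abfin := sqint_fin_num Lab.
move: h1 h2 ab; rewrite -/x -/y.
rewrite -(fineK xfin) -(fineK yfin) -(fineK afin) -(fineK abfin).
rewrite -!EFinM -!EFinD !lee_fin => h1 h2 ab.
apply: (le_trans h1); rewrite lee_fin; lra.
Qed.

Section normalized_kernel.
Variable w : Cn.

Let c : R := expR (- (sqnormCn w / (8 * t))).
Let c0 : 0 < c. Proof. exact: expR_gt0. Qed.
Let c_neq0 : c != 0. Proof. by rewrite gt_eqF. Qed.

Definition nkernel z : R[i] := c%:C * K z w.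

Let nkernel_inv z : R[i] := c^-1%:C * cexp (- ((4 * t)^-1%:C * hdot z w)).

Let nkernelK z : nkernel_inv z * nkernel z = 1.
Proof.
rewrite /nkernel_inv /nkernel mulrACA -rmorphM/= mulVf//.
by rewrite mul1r /fock_kernel cexpNK.
Qed.

Lemma nkernel_density z :
  normc (nkernel z) ^+ 2 * gauss_density t z = gauss_density t (w - z).
Proof.
rewrite /nkernel normcM normcR gtr0_norm// exprMn.
rewrite -(normc_conj (K z w)) fock_kernel_conj -mulrA fock_kernel_sqr_density//.
rewrite mulrA -expRM_natl -expRD -[in RHS]opprB gauss_densityN.
rewrite (_ : _ + _ = 0) ?expR0 ?mul1r//.
by field; rewrite gt_eqF.
Qed.

Lemma nkernel_H2 : H2 t nkernel.
Proof.
have [LK eK] := H2_fock_kernel t0 w; split; first exact: L2Z.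
by apply: entireM => //; exact: entire_cst.
Qed.

Lemma sqint_nkernel : sqint t nkernel = 1%E.
Proof.
rewrite /sqint ge0_integral_gauss; last 2 first.
- by apply: measurable_normc_sqr; exact: L2_cmeasurable (proj1 nkernel_H2).
- by move=> z; rewrite lee_fin sqr_ge0.
under eq_integral do rewrite -EFinM nkernel_density.
exact: integral_gauss_density_reflect.
Qed.

Section approx.
Variables (M : R) (f : Cn -> R[i]).
Hypothesis fM : ess_bounded M f.

Let mf : cmeasurable f. Proof. by case: fM. Qed.

Let Lk : L2 t nkernel. Proof. by case: nkernel_H2. Qed.
Let p := P (fun z => f z * nkernel z).
Let Hp : H2 t p.
Proof. by apply: H2_fock_proj => //; exact: (ess_bounded_L2M fM). Qed.

Definition hol_approx z := p (w - z) * nkernel_inv (w - z).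

Let u z := f z - p z * nkernel_inv z.

Let uE z : u z * nkernel z = hankel t f nkernel z.
Proof. by rewrite /u mulrBl -mulrA nkernelK mulr1. Qed.

Let minv : cmeasurable nkernel_inv.
Proof.
apply: cmeasurableM; first exact: cmeasurable_cst.
apply: cmeasurable_cexp; apply: cmeasurableN; apply: cmeasurableM.
  exact: cmeasurable_cst.
exact: (cmeasurable_hdot (@measurable_id _ _ setT) (measurable_cst w)).
Qed.

Let mu_ : cmeasurable u.
Proof.
apply: cmeasurableB => //; apply: cmeasurableM => //.
exact: L2_cmeasurable (proj1 Hp).
Qed.

Lemma sqint_hol_approx :
  sqint t (fun z => f (w - z) - hol_approx z) = sqint t (hankel t f nkernel).
Proof.
rewrite /sqint.
rewrite [LHS](@integral_gauss_reflect R n t w (fun z => normc (u z) ^+ 2)); last 2 first.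
- by apply: measurable_funX; exact: measurable_normc.
- by move=> z; exact: sqr_ge0.
rewrite ge0_integral_gauss; last 2 first.
- apply: measurable_normc_sqr; exact: L2_cmeasurable (hankel_L2 t0 fM Lk).
- by move=> z; rewrite lee_fin sqr_ge0.
apply: eq_integral => z _.
by rewrite -nkernel_density -EFinM mulrA -exprMn -normcM uE.
Qed.

Let mhol : cmeasurable hol_approx.
Proof.
have mr : measurable_fun setT (fun z : Cn => w - z).
  exact: (measurable_CnB (measurable_cst w) (@measurable_id _ _ setT)).
apply: cmeasurableM.
  by apply: (cmeasurable_comp mr); exact: L2_cmeasurable (proj1 Hp).
exact: (cmeasurable_comp mr).
Qed.

Lemma hol_approx_H2 : H2 t hol_approx.
Proof.
split; last first.
  apply: (@entire_reflect _ _ (fun z => p z * nkernel_inv z)).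
  apply: entireM; first by case: Hp.
  apply: entireM; first exact: entire_cst.
  apply: entire_cexp; apply: entireN; apply: entireM; first exact: entire_cst.
  exact: entire_hdot.
have Lf := ess_bounded_reflect_L2 t0 fM w.
have Ld : L2 t (fun z => f (w - z) - hol_approx z).
  apply/L2P; split; first by apply: cmeasurableB => //; exact: L2_cmeasurable Lf.
  by rewrite sqint_hol_approx; case/L2P : (hankel_L2 t0 fM Lk).
have := L2B Lf Ld.
by under eq_fun do rewrite subKr.
Qed.

Lemma hol_approx0 : hol_approx 0 = heat t f w.
Proof.
have [Lh eh] := hol_approx_H2.
have Lf := ess_bounded_reflect_L2 t0 fM w.
have L1 := L2_cst (n := n) t0 1.
have int1 v : L2 t v -> cintegrable mu setT v.
  by move=> Lv; have := L2_mul_cintegrable Lv L1; under eq_fun do rewrite mulr1.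
rewrite -(mean_value t0 eh (int1 _ Lh)); apply/eqP; rewrite eq_sym -subr_eq0; apply/eqP.
rewrite -[LHS](cintegralB measurableT (int1 _ Lf) (int1 _ Lh)).
have mr : measurable_fun setT (fun z : Cn => w - z).
  exact: (measurable_CnB (measurable_cst w) (@measurable_id _ _ setT)).
have Lv := hankel_L2 t0 fM Lk.
rewrite -[RHS](hankel_orth t0 fM Lk nkernel_H2) /L2dot.
rewrite [LHS]cintegral_gauss; last first.
  by apply: cmeasurableB => //; exact: L2_cmeasurable Lf.
rewrite [RHS]cintegral_gauss; last first.
  by case: (L2_mul_cintegrable Lv (L2_conj Lk)).
rewrite -[RHS](cintegral_preserves (lebesgue_Cn_reflect w)); last first.
  apply: cmeasurableM; last by apply: cmeasurableR; exact: measurable_gauss_density.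
  by case: (L2_mul_cintegrable Lv (L2_conj Lk)).
apply: eq_cintegral => z _; rewrite /=.
have -> : (gauss_density t z)%:C = nkernel (w - z) * (nkernel (w - z))^* *
    (gauss_density t (w - z))%:C :> R[i].
  by rewrite conj_mulc -rmorphM/= nkernel_density subKr.
rewrite -uE /u /hol_approx; ring.
Qed.

Lemma sqint_hankel_nkernel_le :
  (sqint t (hankel t f nkernel) <=
   sqrte (sqint t (P (fun z => (f z)^* * hankel t f nkernel z)%R)))%E.
Proof.
have Lv := hankel_L2 t0 fM Lk.
have fcM := ess_bounded_conj fM.
have Lcv := ess_bounded_L2M fcM Lv.
have [Lg _] := H2_fock_proj t0 Lcv.
have Lfk := ess_bounded_L2M fM Lk.
have E : L2dot t (P (fun z => (f z)^* * hankel t f nkernel z)) nkernel =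
    L2dot t (hankel t f nkernel) (hankel t f nkernel).
  rewrite fock_proj_adjoint//.
  have -> : P nkernel = nkernel.
    by apply/funext => z; apply: fock_proj_H2 => //; exact: nkernel_H2.
  rewrite [in RHS]/hankel [RHS]L2dotBr//; last by case: Hp.
  rewrite [X in _ = _ - X](hankel_orth t0 fM Lk Hp) subr0.
  apply: eq_cintegral => z _.
  rewrite (rmorphM (@Num.conj R[i]) (f z) (nkernel z)).
  by rewrite [RHS]mulrA [X in _ = X * _]mulrC.
have := L2dot_cauchy_schwarz Lg Lk.
rewrite sqint_nkernel mule1 E L2dot_self// normcR.
rewrite ger0_norm; last by rewrite fine_ge0// sqint_ge0.
rewrite EFin_expe fineK ?sqint_fin_num// => le.
by rewrite -[leLHS]gee0_abs ?sqint_ge0// -sqrte_sqr lee_sqrt// sqint_ge0.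
Qed.

End approx.

Lemma MO_hankel_le M f : ess_bounded M f ->
  (MO t f w <= 6%:E * sqint t (hankel t f nkernel) +
    4%:E * sqint t (hankel t (fun z => (f z)^*) nkernel))%E.
Proof.
move=> fM; have fcM := ess_bounded_conj fM.
rewrite -(sqint_hol_approx fM) -(sqint_hol_approx fcM).
rewrite MO_sqint -(hol_approx0 fM).
apply: sqint_subr_mean_le.
- exact: (ess_bounded_reflect_L2 t0 fM).
- exact: hol_approx_H2 fM.
- exact: hol_approx_H2 fcM.
- by rewrite (hol_approx0 fcM) (hol_approx0 fM) (heat_conj t0 fM).
Qed.

End normalized_kernel.

Lemma MO_opnorm_le M f g w : ess_bounded M f -> g = (fun z => (f z)^*) ->
  (MO t f w <=
   6%:E * opnorm t (fun h z => (toeplitz t g (toeplitz t f h) z -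
     toeplitz t (fun w => f w * g w) h z)%R) +
   4%:E * opnorm t (fun h z => (toeplitz t f (toeplitz t g h) z -
     toeplitz t (fun w => f w * g w) h z)%R))%E.
Proof.
move=> fM gE; have fcM : ess_bounded M g by rewrite gE; exact: ess_bounded_conj.
have [Lk ek] := nkernel_H2 w.
apply: (le_trans (MO_hankel_le w fM)); rewrite -gE.
apply: leeD; apply: lee_wpmul2l => //.
  apply: (le_trans (sqint_hankel_nkernel_le w fM)).
  apply: le_trans (opnorm_ge _ (nkernel_H2 w) _); last by rewrite sqint_nkernel.
  rewrite (_ : (fun z => _ - _) = (fun z => - P (fun y => g y * hankel t f (nkernel w) y) z)).
    by rewrite sqintN gE.
  have E : (fun w => f w * g w) = (fun w => g w * f w).
    by apply/funext => z; rewrite mulrC.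
  by apply/funext => z; rewrite E; exact: (toeplitz_semicommutator t0 z fcM fM Lk).
apply: (le_trans (sqint_hankel_nkernel_le w fcM)).
apply: le_trans (opnorm_ge _ (nkernel_H2 w) _); last by rewrite sqint_nkernel.
rewrite (_ : (fun z => _ - _) = (fun z => - P (fun y => f y * hankel t g (nkernel w) y) z)).
  rewrite sqintN (_ : (fun z => (g z)^* * _) = (fun y => f y * hankel t g (nkernel w) y))//.
  by apply/funext => z; rewrite gE -[X in X * _ = _]/(conjc (conjc (f z))) conjcK.
by apply/funext => z; exact: (toeplitz_semicommutator t0 z fM fcM Lk).
Qed.

End mean_oscillation.

(** * Oscillation over cubes *)

Section cubes.
Context {R : realType} {n : nat}.
Local Notation Cn := 'rV[R[i]]_n.
Local Notation leb := (@lebesgue_Cn R n).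
Implicit Types (f g h : Cn -> R[i]) (t M l : R) (w z c : Cn) (E : set Cn).

Lemma measurable_cube c l : measurable (cube c l).
Proof.
pose A i : set (measurableTypeR R * measurableTypeR R) :=
  `[complex.Re (c 0 i), complex.Re (c 0 i) + l] `*`
  `[complex.Im (c 0 i), complex.Im (c 0 i) + l].
have -> : cube c l = \bigcap_(i in [set: 'I_n]) (@Cn_coord R n i @^-1` A i).
  apply/seteqP; split => z /=.
    by move=> zc i _; have [zr zi] := zc i; split; rewrite /= in_itv.
  by move=> zc i; have [] := zc i Logic.I; rewrite /= !in_itv.
apply: fin_bigcap_measurable => // i _; rewrite -[X in measurable X]setTI.
by apply: measurable_Cn_coord => //; apply: measurableX; exact: measurable_itv.
Qed.

Lemma lebesgue_cube c l : 0 <= l -> leb (cube c l) = ((l ^+ 2) ^+ n)%:E.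
Proof.
move=> l0; pose I : set (measurableTypeR R) := `[0, l]%classic.
have -> : leb (cube c l) = leb (cube (0 : Cn) l).
  have [_ <-] := lebesgue_Cn_shift c; last exact: measurable_cube.
  congr (leb _); apply/seteqP; split => z /= zc i; have := zc i;
    rewrite !mxE/=; case: (z 0 i) (c 0 i) => [a b] [c1 c2] /=; lra.
have mI : measurable_fun setT (\1_I : measurableTypeR R -> R).
  by apply: measurable_indic; exact: measurable_itv.
rewrite -[X in leb X]setIT -(integral_indic _ measurableT (measurable_cube _ _)).
rewrite -(@integral_lebesgue_Cn_prod R n (fun x y => \1_I x * \1_I y) (l ^+ 2)).
- apply: eq_integral => z _; congr EFin; rewrite indicE.
  case: (asboolP (cube 0 l z)) => [zc|zc].
    rewrite mem_set//= big1// => i _; have [xi yi] := zc i.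
    by rewrite !mxE !add0r in xi yi; rewrite !indicE !mem_set ?mulr1//= in_itv.
  rewrite memNset//= ; apply/esym/eqP; apply/prodf_eq0.
  have [i ci] : exists i : 'I_n, ~ (I (complex.Re (z 0 i)) /\ I (complex.Im (z 0 i))).
    apply: contrapT => /forallNP zi; apply: zc => i.
    have /contrapT[] := zi i; rewrite /I/= !in_itv/= => xi yi.
    by rewrite !mxE !add0r.
  exists i => //; rewrite !indicE.
  have [xi|xi] := pselect (I (complex.Re (z 0 i))); last by rewrite (memNset xi) mul0r.
  have [yi|yi] := pselect (I (complex.Im (z 0 i))); last by rewrite (memNset yi) mulr0.
  by case: ci.
- by move=> x y; rewrite mulr_ge0// indicE.
- apply: measurable_funM; first exact: (measurableT_comp mI measurable_fst).
  exact: (measurableT_comp mI measurable_snd).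
- have II : (\int[lebesgue_measure]_x (\1_I x)%:E = l%:E)%E.
    rewrite integral_indic//; last exact: measurable_itv.
    rewrite setIT [LHS]lebesgue_measure_itv/= lte_fin sube0.
    by case: (ltrP 0 l) => //; rewrite le_eqVlt ltNge l0 orbF => /eqP ->.
  have IZ k : 0 <= k -> (\int[lebesgue_measure]_x (k * \1_I x)%:E = (k * l)%:E)%E.
    move=> k0; under eq_integral do rewrite EFinM.
    rewrite ge0_integralZl_EFin ?II//.
    by apply/measurable_EFinP.
  under eq_integral => x _ do rewrite IZ ?indicE// mulrC.
  by under eq_integral do rewrite -indicE; rewrite IZ.
Qed.

Lemma compact_subset_cube (K : set Cn) : compact K ->
  exists c l, 0 < l /\ K `<=` cube c l.
Proof.
move=> /compact_near_coveringP cK.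
pose P (N : R) (z : Cn) := forall i, normc (z 0 i) <= N.
have : \forall N \near +oo, K `<=` P N.
  apply: (cK R (nbhs +oo) P) => x _.
  exists (ball x 1, [set N | norm1Cn x + 1 <= N]) => /=.
    split; first exact: nbhsx_ballx.
    by apply: nbhs_pinfty_ge; exact: num_real.
  move=> [z N]/= [xz xN] i; apply: le_trans xN.
  have xz1 : normc (x 0 i - z 0 i) < 1.
    have := normc_coord_le (x - z) i; rewrite !mxE -ltcR => /le_lt_trans; apply.
    by move: xz; rewrite -ball_normE.
  rewrite -[z 0 i](subKr (x 0 i)); apply: (le_trans (le_normcD _ _)).
  by rewrite normcN; apply: lerD; [exact: normc_coord_le_norm1|exact: ltW].
move=> /(filterI (nbhs_pinfty_gt (num_real 0))) /filter_ex[N [/= N0 KN]].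
exists (const_mx (- N +i* - N)), (2 * N); split; first by rewrite mulr_gt0.
move=> z /KN zN i; rewrite !mxE/=.
have := le_trans (le_Re_normc (z 0 i)) (zN i).
have := le_trans (le_Im_normc (z 0 i)) (zN i).
by rewrite !ler_norml; lra.
Qed.

(* A and B need not be measurable: the integral is a supremum over simple
   functions. *)
Lemma ge0_subset_integral_le (mu : {measure set Cn -> \bar R}) (A B : set Cn)
    (f : Cn -> \bar R) : (forall z, 0 <= f z)%E -> A `<=` B ->
  (\int[mu]_(z in A) f z <= \int[mu]_(z in B) f z)%E.
Proof.
move=> f0 AB; rewrite !ge0_integralE//; apply: ereal_sup_le => _ [h hf <-].
exists h => //= z; apply: (le_trans (hf z)).
by apply: restrict_lee.
Qed.

Section oscillation.
Variables (E : set Cn) (V : R) (f : Cn -> R[i]).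
Hypotheses (mE : measurable E) (V0 : 0 < V) (EV : leb E = V%:E).
Hypothesis fi : cintegrable leb E f.

Let EVfine : fine (leb E) = V.
Proof. by rewrite [leb E]EV. Qed.

Lemma cintegrable_cst_on (b : R[i]) : cintegrable leb E (fun=> b).
Proof.
split; first exact: cmeasurable_cst.
rewrite (integral_cst leb mE (normc b)%:E).
by rewrite [X in (_ * X)%E]EV -EFinM ltry.
Qed.

Lemma cintegrable_subr_cst (b : R[i]) : cintegrable leb E (fun z => f z - b).
Proof. by apply: cintegrableB => //; exact: cintegrable_cst_on. Qed.

Lemma cintegral_subr_cst (b : R[i]) :
  cintegral leb E (fun z => f z - b) = V%:C * (mean E f - b).
Proof.
rewrite cintegralB//; last exact: cintegrable_cst_on.
rewrite [X in _ - X]cintegral_cst// /mean [fine (lebesgue_Cn _ _ _)]EVfine.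
by rewrite mulrBr mulrA -rmorphM/= mulfV ?gt_eqF// mul1r [in RHS]mulrC.
Qed.

Lemma Osc_le_integral (b : R[i]) :
  (Osc E f <= (2 / V)%:E * \int[leb]_(z in E) (normc (f z - b))%:E)%E.
Proof.
have [mfb Ioo] := cintegrable_subr_cst b.
set I := (\int[leb]_(z in E) (normc (f z - b))%:E)%E in Ioo *.
have I0 : (0 <= I)%E by apply: integral_ge0 => z _; rewrite lee_fin normc_ge0.
have mb : ((V * normc (mean E f - b))%:E <= I)%E.
  rewrite -{1}(ger0_norm (ltW V0)) -normcR -normcM -cintegral_subr_cst.
  exact: le_normc_cintegral.
rewrite /Osc [fine _]EVfine.
rewrite [2 / V]mulrC EFinM -muleA; apply: lee_wpmul2l.
  by rewrite lee_fin invr_ge0 ltW.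
apply: (@le_trans _ _ (I + (V * normc (mean E f - b))%:E)%E); last first.
  have -> : (2%:E * I = I + I)%E.
    by rewrite -[in RHS](mul1e I) -ge0_muleDl ?lee_fin// -EFinD.
  by rewrite leeD2l.
have -> : (V * normc (mean E f - b))%:E =
    (\int[leb]_(z in E) (fun=> (normc (b - mean E f))%:E) z)%E.
  rewrite integral_cst// [X in (_ * X)%E]EV -EFinM mulrC.
  by rewrite [in RHS](normcB b).
rewrite -ge0_integralD//; last 3 first.
- by move=> z _; rewrite lee_fin normc_ge0.
- exact: measurable_EFin_normc.
- by move=> z _; rewrite lee_fin normc_ge0.
apply: ge0_le_integral => //.
- by move=> z _; rewrite lee_fin normc_ge0.
- by apply: measurable_EFin_normc; case: (cintegrable_subr_cst (mean E f)).
- by apply: emeasurable_funD => //; exact: measurable_EFin_normc.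
move=> z _; rewrite -EFinD lee_fin (le_trans _ (le_normcD _ _))//.
by rewrite addrA subrK.
Qed.

End oscillation.
End cubes.

Section bounded_oscillation.
Context {R : realType} {n : nat}.
Local Notation Cn := 'rV[R[i]]_n.
Local Notation leb := (@lebesgue_Cn R n).
Implicit Types (t l : R) (w z c : Cn) (E : set Cn).
Variables (M : R) (f : Cn -> R[i]).
Hypothesis fM : ess_bounded M f.

Let mf : cmeasurable f. Proof. by case: fM. Qed.
Let M0 : 0 <= M. Proof. by case: fM. Qed.

Lemma ge0_integral_indicM E (g : Cn -> R) :
  (\int[leb]_(z in E) (g z)%:E = \int[leb]_z (g z * \1_E z)%:E)%E.
Proof. by rewrite integral_mkcond epatch_indic. Qed.

Lemma ess_bounded_integral_le E V : measurable E -> leb E = V%:E ->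
  (\int[leb]_(z in E) (normc (f z))%:E <= (M * V)%:E)%E.
Proof.
move=> mE EV; rewrite ge0_integral_indicM.
have i0 z : 0 <= (\1_E z : R) by rewrite indicE.
have H := le_integral_ess_bounded 1 fM (measurable_indic mE) i0.

apply: (le_trans H).
by rewrite (integral_indic leb measurableT mE) setIT [X in (_ * X)%E]EV.
Qed.

Lemma ess_bounded_cintegrable_on E V : measurable E -> leb E = V%:E ->
  cintegrable leb E f.
Proof.
by move=> mE EV; split => //; rewrite (le_lt_trans (ess_bounded_integral_le mE EV))// ltry.
Qed.

Lemma normc_mean_le E V : measurable E -> 0 < V -> leb E = V%:E ->
  normc (mean E f) <= M.
Proof.
move=> mE V0 EV; have fi := ess_bounded_cintegrable_on mE EV.
rewrite -(ler_pM2l V0) -{1}(ger0_norm (ltW V0)) -normcR -normcM.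
rewrite -[mean E f]subr0 -(cintegral_subr_cst mE V0 EV fi) -lee_fin.
have fi0 := cintegrable_subr_cst mE EV fi 0.
apply: (le_trans (le_normc_cintegral mE fi0)).
under eq_integral do rewrite subr0.
by rewrite mulrC; exact: ess_bounded_integral_le.
Qed.

Lemma ess_bounded_subr_cst (b : R[i]) : normc b <= M ->
  ess_bounded (2 * M) (fun z => f z - b).
Proof.
move=> bM; have [_ _ foo] := fM; split; last 2 first.
- by rewrite mulr_ge0.
- apply: filterS foo => z fz; apply: (le_trans (le_normcD _ _)).
  by rewrite normcN mulr2n mulrDl mul1r lerD.
exact: (cmeasurableB mf (cmeasurable_cst _ b)).
Qed.

Lemma lebesgue_cube_gt0 c l : 0 < l ->
  0 < (l ^+ 2) ^+ n /\ leb (cube c l) = ((l ^+ 2) ^+ n)%:E.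
Proof. by move=> l0; rewrite !exprn_gt0// lebesgue_cube// ltW. Qed.

Lemma ess_bounded_loc_integrable : loc_integrable f.
Proof.
split => // K /compact_subset_cube[c [l [l0 Kcl]]].
have [V0 EV] := lebesgue_cube_gt0 c l0.
have [_] := ess_bounded_cintegrable_on (measurable_cube c l) EV.
apply: le_lt_trans; apply: ge0_subset_integral_le => // z.
by rewrite lee_fin normc_ge0.
Qed.

Lemma ess_bounded_Osc_le E : is_cube E -> (Osc E f <= (2 * M)%:E)%E.
Proof.
move=> [c [l [l0 ->]]]; have [V0 EV] := lebesgue_cube_gt0 c l0.
have mE := measurable_cube c l.
have fi := ess_bounded_cintegrable_on mE EV.
apply: (le_trans (Osc_le_integral mE V0 EV fi 0)).
under eq_integral do rewrite subr0.
apply: (le_trans (lee_wpmul2l _ (ess_bounded_integral_le mE EV))).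
  by rewrite lee_fin divr_ge0// ltW.
by rewrite -EFinM lee_fin mulrA mulrAC divfK// gt_eqF.
Qed.

Lemma gauss_density_cube_ge c l z : 0 < l -> cube c l z ->
  1 <= (4 * pi) ^+ n * expR (n%:R / 2) * (l ^+ 2) ^+ n *
    gauss_density (l ^+ 2) (c - z).
Proof.
move=> l0 zE; have l20 : 0 < l ^+ 2 by rewrite exprn_gt0.
have s_le : sqnormCn (c - z) <= n%:R * (2 * l ^+ 2).
  rewrite -[X in X%:R]card_ord -sumr_const mulr_suml; apply: ler_sum => i _.
  rewrite normc_sqr !mxE; have := zE i; move: (c 0 i) (z 0 i) => [a b] [a' b'] /=.
  by move=> [/andP[? ?] /andP[? ?]]; nra.
rewrite gauss_densityE//.
have -> : (4 * pi * l ^+ 2) ^+ n = (4 * pi) ^+ n * (l ^+ 2) ^+ n :> R.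
  by rewrite -exprMn.
set P := (4 * pi) ^+ n; set L := (l ^+ 2) ^+ n.
have P0 : 0 < P by rewrite exprn_gt0// mulr_gt0// pi_gt0.
have L0 : 0 < L by rewrite exprn_gt0.
have -> : P * expR (n%:R / 2) * L *
    (expR (- (sqnormCn (c - z) / (4 * l ^+ 2))) / (P * L)) =
    expR (n%:R / 2 - sqnormCn (c - z) / (4 * l ^+ 2)).
  rewrite expRD; move: (expR _) (expR _) => u v.
  by rewrite -[RHS](mulfK (lt0r_neq0 (mulr_gt0 P0 L0))); ring.
rewrite -[leLHS]expR0 ler_expR subr_ge0 ler_pdivrMr ?mulr_gt0//.
apply: (le_trans s_le); rewrite le_eqVlt; apply/orP; left; apply/eqP.
by field.
Qed.

Lemma Osc_cube_le_MO c l e : 0 < l -> 0 < e ->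
  (MO (l ^+ 2) f c <= (e ^+ 2 / ((4 * pi) ^+ n * expR (n%:R / 2)))%:E)%E ->
  (Osc (cube c l) f <= (4 * e)%:E)%E.
Proof.
move=> l0 e0; have l20 : 0 < l ^+ 2 by rewrite exprn_gt0.
have [V0 EV] := lebesgue_cube_gt0 c l0; have mE := measurable_cube c l.
have fi := ess_bounded_cintegrable_on mE EV.
set b := heat (l ^+ 2) f c.
have gE := gauss_density_cube_ge l0.
move: gE V0 EV; set P := (4 * pi) ^+ n * _; set V := (l ^+ 2) ^+ n => gE V0 EV.
have P0 : 0 < P by rewrite mulr_gt0 ?expR_gt0// exprn_gt0// mulr_gt0// pi_gt0.
move=> MOe; apply: (le_trans (Osc_le_integral mE V0 EV fi b)).
have mfb : measurable_fun setT (fun z => normc (f z - b)).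
  by apply: measurable_normc; exact: (cmeasurableB mf (cmeasurable_cst _ b)).
have mI : measurable_fun setT (\1_(cube c l) : Cn -> R) by exact: measurable_indic.
suff H : (\int[leb]_(z in cube c l) (normc (f z - b))%:E <= (2 * e * V)%:E)%E.
  apply: (le_trans (lee_wpmul2l _ H)); first by rewrite lee_fin divr_ge0// ltW.
  rewrite -EFinM lee_fin le_eqVlt; apply/orP; left; apply/eqP.
  by clearbody V; field; rewrite gt_eqF.
have PVe : 0 <= P * V / e by exact: (divr_ge0 (mulr_ge0 (ltW P0) (ltW V0)) (ltW e0)).
rewrite ge0_integral_indicM.
pose F z := normc (f z - b) ^+ 2 * gauss_density (l ^+ 2) (c - z).
have mF : measurable_fun setT F.
  apply: measurable_funM; last exact: measurable_gauss_reflect.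
  exact: measurable_funX.
have F0 z : 0 <= F z by rewrite mulr_ge0 ?sqr_ge0 ?gauss_density_ge0.
apply: (@le_trans _ _ (\int[leb]_z ((e * \1_(cube c l) z)%:E + (P * V / e * F z)%:E))%E).
  apply: ge0_le_integral => //.
  - by move=> z _; rewrite lee_fin mulr_ge0 ?normc_ge0// indicE.
  - by apply/measurable_EFinP; exact: measurable_funM.
  - by apply: emeasurable_funD; apply/measurable_EFinP; exact: measurable_funM.
  move=> z _; rewrite -EFinD lee_fin indicE.
  case: (asboolP (cube c l z)) => zE; last first.
    by rewrite memNset// !mulr0 add0r mulr_ge0.
  rewrite mem_set// !mulr1 /F.
  have := gE c z zE; set x := normc _; set rho := gauss_density _ _ => g1.
  have x0 : 0 <= x by exact: normc_ge0.
  have : x <= e + x ^+ 2 / e.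
    rewrite -(ler_pM2r e0) mulrDl divfK ?gt_eqF//; nra.
  move=> /le_trans; apply; rewrite lerD2l.
  have -> : P * V / e * (x ^+ 2 * rho) = P * V * rho * (x ^+ 2 / e) by ring.
  by rewrite ler_peMl// divr_ge0 ?sqr_ge0// ltW.
rewrite ge0_integralD//; last 4 first.
- by move=> z _; rewrite lee_fin mulr_ge0 ?indicE// ltW.
- by apply/measurable_EFinP; exact: measurable_funM.
- by move=> z _; rewrite lee_fin mulr_ge0// divr_ge0 ?mulr_ge0// ltW.
- by apply/measurable_EFinP; exact: measurable_funM.
under eq_integral do rewrite EFinM.
have e0' := ltW e0.
rewrite ge0_integralZl_EFin//; last by apply/measurable_EFinP.
rewrite (integral_indic leb measurableT mE) setIT [X in (_ * X)%E]EV.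
under [X in (_ + X)%E]eq_integral do rewrite EFinM.
rewrite ge0_integralZl_EFin//;
  [|by move=> z _; rewrite lee_fin|exact/measurable_EFinP].
have -> : (2 * e * V)%:E = (e%:E * V%:E + (P * V / e)%:E * (e ^+ 2 / P)%:E)%E.
  rewrite -!EFinM -EFinD; congr EFin; clearbody P V.
  by field; rewrite !gt_eqF.
by rewrite leeD2l// lee_wpmul2l// -(MO_lebesgue _ fM).
Qed.

Lemma cube_center w l : 0 < l ->
  exists c, forall z, ~ cube c l z -> l ^+ 2 / 4 <= sqnormCn (w - z).
Proof.
move=> l0; exists (\row_i ((complex.Re (w 0 i) - l / 2) +i*
                           (complex.Im (w 0 i) - l / 2))) => z zc.
have [i zi] : exists i : 'I_n, l ^+ 2 / 4 < normc (w 0 i - z 0 i) ^+ 2.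
  apply: contrapT => /forallNP H; apply: zc => i; rewrite !mxE/=.
  have /negP := H i; rewrite -leNgt normc_sqr.
  have sq (d e : R) : d ^+ 2 + e ^+ 2 <= l ^+ 2 / 4 -> - (l / 2) <= d <= l / 2.
    move=> de; rewrite -ler_norml -(@ler_pXn2r _ 2) ?nnegrE ?divr_ge0 ?(ltW l0)//.
    rewrite real_normK ?num_real// expr_div_n; have := sqr_ge0 e; lra.
  move: (w 0 i) (z 0 i) => [a b] [a' b'] /= H2.
  have := sq _ _ H2; rewrite addrC in H2; have := sq _ _ H2; lra.
rewrite /sqnormCn (bigD1 i)//= !mxE (le_trans (ltW zi))// lerDl.
by apply: sumr_ge0 => j _; exact: sqr_ge0.
Qed.

Lemma gauss_density_double t z : 0 < t -> gauss_density t z =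
  2 ^+ n * expR (- (sqnormCn z / (8 * t))) * gauss_density (2 * t) z.
Proof.
move=> t0; rewrite !gauss_densityE ?mulr_gt0//.
have -> : sqnormCn z / (4 * t) = sqnormCn z / (8 * t) + sqnormCn z / (4 * (2 * t)).
  by field; rewrite gt_eqF.
have -> : (4 * pi * (2 * t)) ^+ n = 2 ^+ n * (4 * pi * t) ^+ n :> R.
  by rewrite -exprMn; congr (_ ^+ _); ring.
have P0 : 0 < (4 * pi * t) ^+ n by rewrite exprn_gt0// !mulr_gt0// pi_gt0.
have Q0 : 0 < 2 ^+ n :> R by rewrite exprn_gt0.
move: P0 Q0; rewrite opprD expRD; move: (_ ^+ n) (_ ^+ n) => P Q P0 Q0.
by field; rewrite !gt_eqF.
Qed.

Lemma gauss_density_le t z : 0 < t ->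
  gauss_density t z <= ((4 * pi * t) ^+ n)^-1.
Proof.
move=> t0; rewrite gauss_densityE// ler_piMl//.
  by rewrite invr_ge0 exprn_ge0// !mulr_ge0 ?pi_ge0 ?ltW.
by rewrite -expR0 ler_expR oppr_le0 divr_ge0 ?sqnormCn_ge0// mulr_ge0// ltW.
Qed.

(* Inside the cube of side sqrt(s t) centred at w the Gaussian density is at most
   (4 pi t)^-n; outside it gauss_density_double gains the factor
   2^n e^(-s/32). *)
Lemma MO_le_Osc t s w : 0 < t -> 0 < s ->
  exists E, [/\ is_cube E, leb E = ((s * t) ^+ n)%:E &
    (MO t f w <= 4%:E * ((2 * M * (s / (4 * pi)) ^+ n)%:E * Osc E f +
      (2 ^+ n * expR (- (s / 32)) * (2 * M) ^+ 2)%:E))%E].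
Proof.
move=> t0 s0; have st0 : 0 < s * t by rewrite mulr_gt0.
pose l := Num.sqrt (s * t); have l0 : 0 < l by rewrite sqrtr_gt0.
have l2 : l ^+ 2 = s * t by rewrite sqr_sqrtr// ltW.
have [c cE] := cube_center w l0; rewrite l2 in cE.
have [V0 EV] := lebesgue_cube_gt0 c l0; have mE := measurable_cube c l.
rewrite l2 in V0 EV.
exists (cube c l); split => //; first by exists c, l.
set E := cube c l in cE mE EV *; set m := mean E f.
have mM : normc m <= M := normc_mean_le mE V0 EV.
have fmM := ess_bounded_subr_cst mM.
have mfm : measurable_fun setT (fun z => normc (f z - m)).
  by apply: measurable_normc; case: fmM.
apply: (le_trans (le_MO_cst t0 fM w m)); apply: lee_wpmul2l => //.
rewrite /sqint (@integral_gauss_reflect R n t w (fun z => normc (f z - m) ^+ 2)); last 2 first.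
- exact: measurable_funX.
- by move=> z; exact: sqr_ge0.
set A := ((4 * pi * t) ^+ n)^-1; set B := 2 ^+ n * expR (- (s / 32)).
have A0 : 0 <= A by rewrite invr_ge0 exprn_ge0// !mulr_ge0 ?pi_ge0 ?(ltW t0).
have B0 : 0 <= B by rewrite mulr_ge0 ?exprn_ge0 ?expR_ge0.
pose F1 z := normc (f z - m) ^+ 1 * (normc (f z - m) * \1_E z).
pose F2 z := normc (f z - m) ^+ 2 * gauss_density (2 * t) (w - z).
have mI : measurable_fun setT (\1_E : Cn -> R) by exact: measurable_indic.
have mF1 : measurable_fun setT F1.
  by apply: measurable_funM; [exact: measurable_funX|exact: measurable_funM].
have mF2 : measurable_fun setT F2.
  apply: measurable_funM; last exact: measurable_gauss_reflect.
  exact: measurable_funX.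
have I0 z : 0 <= normc (f z - m) * \1_E z by rewrite mulr_ge0 ?normc_ge0// indicE.
have F10 z : 0 <= F1 z by rewrite mulr_ge0// exprn_ge0// normc_ge0.
have F20 z : 0 <= F2 z by rewrite mulr_ge0 ?sqr_ge0 ?gauss_density_ge0.
apply: (@le_trans _ _ (\int[leb]_z (A%:E * (F1 z)%:E + B%:E * (F2 z)%:E))%E).
  apply: ge0_le_integral => //.
  - by move=> z _; rewrite lee_fin mulr_ge0 ?sqr_ge0 ?gauss_density_ge0.
  - apply/measurable_EFinP; apply: measurable_funM; last exact: measurable_gauss_reflect.
    exact: measurable_funX.
  - by apply: emeasurable_funD; apply: measurable_funeM; exact/measurable_EFinP.
  move=> z _; rewrite -!EFinM -EFinD lee_fin.
  case: (asboolP (E z)) => zE.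
    rewrite -[leLHS]addr0; apply: lerD; last exact: mulr_ge0.
    rewrite /F1 indicE mem_set// mulr1 expr1 -expr2.
    by rewrite mulrC ler_wpM2r ?sqr_ge0// gauss_density_le.
  rewrite -[leLHS]add0r; apply: lerD; first exact: mulr_ge0.
  rewrite /F2 (gauss_density_double _ t0).
  rewrite mulrCA; apply: ler_wpM2r.
    by rewrite mulr_ge0 ?sqr_ge0 ?gauss_density_ge0.
  apply: ler_wpM2l; first exact: exprn_ge0.
  rewrite ler_expR lerN2.
  apply: (@le_trans _ _ (s * t / 4 / (8 * t))).
    by rewrite le_eqVlt; apply/orP; left; apply/eqP; field; rewrite gt_eqF.
  by rewrite ler_pM2r ?cE// invr_gt0 mulr_gt0.
rewrite ge0_integralD//; last 4 first.
- by move=> z _; rewrite -EFinM lee_fin mulr_ge0.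
- by apply: measurable_funeM; exact/measurable_EFinP.
- by move=> z _; rewrite -EFinM lee_fin mulr_ge0.
- by apply: measurable_funeM; exact/measurable_EFinP.
have F1e z : [set: Cn] z -> (0 <= (F1 z)%:E)%E by rewrite lee_fin.
have F2e z : [set: Cn] z -> (0 <= (F2 z)%:E)%E by rewrite lee_fin.
rewrite !ge0_integralZl_EFin//; [|exact/measurable_EFinP..].
apply: leeD; last first.
  rewrite [leRHS]EFinM; apply: lee_wpmul2l => //.
  apply: (le_trans (le_integral_ess_bounded 2 fmM (measurable_gauss_reflect (2 * t) w) _)).
    by move=> z; exact: gauss_density_ge0.
  by rewrite integral_gauss_density_reflect ?mule1// mulr_gt0.
have H := le_integral_ess_bounded 1 fmM (measurable_funM mfm mI) I0.
apply: (le_trans (lee_wpmul2l _ H)) => //.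
rewrite -ge0_integral_indicM /Osc -/m -/E [fine _](_ : _ = (s * t) ^+ n); last first.
  by rewrite [lebesgue_Cn _ _ _]EV.
rewrite !muleA -!EFinM; apply: lee_wpmul2r.
  by apply: integral_ge0 => z _; rewrite lee_fin normc_ge0.
rewrite lee_fin expr1 le_eqVlt; apply/orP; left; apply/eqP.
rewrite /A !exprMn exprVn !exprMn.
have := exprn_gt0 n s0; have := exprn_gt0 n t0; have := exprn_gt0 n (@pi_gt0 R).
have : 0 < 4 ^+ n :> R by exact: exprn_gt0.
move: (_ ^+ n) (_ ^+ n) (_ ^+ n) (_ ^+ n) => a b c' d *.
by field; rewrite !gt_eqF.
Qed.

End bounded_oscillation.

(** * The three classes *)

Section limits_at_zero.
Context {R : realType}.

Lemma near_at_right0 (P : R -> Prop) : (\forall t \near 0^'+, P t) <->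
  exists2 d, 0 < d & forall t, 0 < t -> t < d -> P t.
Proof.
split=> [/nbhs_ballP[d /= d0 dP]|[d d0 dP]].
  exists d => // t t0 td; apply: dP => //.
  by rewrite /ball/= sub0r normrN gtr0_norm.
apply/nbhs_ballP; exists d => //= t; rewrite /ball/= sub0r normrN => td t0.
by apply: dP => //; move: td; rewrite gtr0_norm.
Qed.

Lemma cvge_at_right0 (u : R -> \bar R) : (forall t, 0 < t -> (0 <= u t)%E) ->
  u t @[t --> 0^'+] --> 0%E <->
  forall e, 0 < e -> exists2 d, 0 < d & forall t, 0 < t -> t < d -> (u t <= e%:E)%E.
Proof.
move=> u0; split => [/fine_cvgP[ufin u0cvg] e e0|H].
  apply/near_at_right0; move/cvgrPdist_le : u0cvg => /(_ _ e0).
  apply: filterS2 ufin => t ufin; rewrite sub0r normrN => ue.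
  by rewrite -(fineK ufin) lee_fin (le_trans (ler_norm _)).
apply/fine_cvgP; split.
  have [d d0 du] := H _ ltr01; apply/near_at_right0; exists d => // t t0 td.
  by rewrite ge0_fin_numE ?u0// (le_lt_trans (du _ t0 td))// ltry.
apply/cvgrPdist_le => e e0; have [d d0 du] := H _ e0.
apply/near_at_right0; exists d => // t t0 td.
rewrite sub0r normrN ger0_norm ?fine_ge0 ?u0// -lee_fin fineK ?du//.
by rewrite ge0_fin_numE ?u0// (le_lt_trans (du _ t0 td))// ltry.
Qed.

End limits_at_zero.

Section classes.
Context {R : realType} {n : nat}.
Local Notation Cn := 'rV[R[i]]_n.
Local Notation leb := (@lebesgue_Cn R n).
Implicit Types (f g : Cn -> R[i]) (t d e : R) (w z : Cn).

Lemma BMOnorm_ge0 t f : (0 <= BMOnorm t f)%E.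
Proof.
apply: (le_trans (sqrte_ge0 (MO t f 0))).
by apply: ereal_sup_ubound; exists 0.
Qed.

Lemma BMOnorm_leP t f d : 0 <= d ->
  (BMOnorm t f <= d%:E)%E <-> forall w, (MO t f w <= (d ^+ 2)%:E)%E.
Proof.
move=> d0; have sd : d%:E = sqrte ((d ^+ 2)%:E) by rewrite /= sqrtr_sqr ger0_norm.
rewrite sd; split => [H w|H].
  rewrite -lee_sqrt ?lee_fin ?sqr_ge0//; apply: le_trans H.
  by apply: ereal_sup_ubound; exists w.
apply: ge_ereal_sup => _ [w _ <-]; rewrite lee_sqrt//.
by rewrite lee_fin sqr_ge0.
Qed.

Lemma opnorm_ge0 t X : 0 < t -> (0 <= @opnorm R n t X)%E.
Proof.
move=> t0; apply: le_trans (opnorm_ge X (nkernel_H2 t0 0) _).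
  exact: sqrte_ge0.
by rewrite sqint_nkernel.
Qed.

Lemma classB_sub_classA : classB R n `<=` classA R n.
Proof.
move=> f [Lf /(cvge_at_right0 (fun t _ => BMOnorm_ge0 t f)) fB]; split => // g Lg.
have [M fM] := Linfty_ess_bounded Lf; have [N gN] := Linfty_ess_bounded Lg.
pose C : R := 4 ^+ n * (2 * N ^+ 2 + 2 * (4 ^+ n * N ^+ 2)).
have C0 : 0 <= C.
  by have [_ N0 _] := gN; rewrite /C !(mulr_ge0, addr_ge0, exprn_ge0).
have H e : 0 < e -> exists2 d, 0 < d & forall t, 0 < t -> t < d ->
    exists2 S : \bar R, (0 <= S)%E /\ (forall w, (MO (2 * t) f w <= S)%E) &
      (sqrte (C%:E * S) <= e%:E)%E.
  move=> e0; pose b := e / (Num.sqrt C + 1).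
  have c0 : 0 < Num.sqrt C + 1 by rewrite ltr_pwDr ?sqrtr_ge0.
  have b0 : 0 < b by rewrite divr_gt0.
  have [d d0 db] := fB _ b0; exists (d / 2); first by rewrite divr_gt0.
  move=> t t0 td; exists (b ^+ 2)%:E.
    split; first by rewrite lee_fin sqr_ge0.
    apply/(BMOnorm_leP (2 * t) f (ltW b0)); apply: db; first by rewrite mulr_gt0.
    by rewrite mulrC -ltr_pdivlMr.
  rewrite -EFinM /= sqrtrM// sqrtr_sqr gtr0_norm// lee_fin /b mulrCA ger_pMr//.
  by rewrite ler_pdivrMr// mul1r lerDl.
split; (apply/cvge_at_right0 => [t t0|e e0]; first exact: opnorm_ge0);
  have [d d0 dS] := H _ e0; exists d => // t t0 td;
  have [S [S0 MOS] Se] := dS _ t0 td; apply: le_trans Se.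
- exact: (opnorm_semicommutator_le t0 fM gN S0 MOS).1.
- exact: (opnorm_semicommutator_le t0 fM gN S0 MOS).2.
Qed.

Lemma classA_sub_classB : classA R n `<=` classB R n.
Proof.
move=> f [Lf fA]; split => //; have [M fM] := Linfty_ess_bounded Lf.
have [op1 op2] := fA _ (Linfty_conj Lf).
apply/(cvge_at_right0 (fun t _ => BMOnorm_ge0 t f)) => e e0.
have e1 : 0 < e ^+ 2 / 10 by rewrite divr_gt0 ?exprn_gt0.
move/cvge_at_right0 : op1 => /(_ (fun t => @opnorm_ge0 t _) _ e1)[d1 d10 H1].
move/cvge_at_right0 : op2 => /(_ (fun t => @opnorm_ge0 t _) _ e1)[d2 d20 H2].
exists (Num.min d1 d2); first by rewrite lt_min d10.
move=> t t0; rewrite lt_min => /andP[td1 td2].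
apply/(BMOnorm_leP t f (ltW e0)) => w.
apply: (le_trans (MO_opnorm_le t0 w fM erefl)).
apply: (@le_trans _ _ (6%:E * (e ^+ 2 / 10)%:E + 4%:E * (e ^+ 2 / 10)%:E)%E).
  by apply: leeD; apply: lee_wpmul2l => //; [exact: H2|exact: H1].
by rewrite -!EFinM -EFinD lee_fin; lra.
Qed.

Definition sup_Osc f (a : R) : \bar R := ereal_sup [set Osc E f | E in
  [set E | is_cube E /\ (leb E <= a%:E)%E]].

Lemma Osc_ge0 f (E : set Cn) : (0 <= Osc E f)%E.
Proof.
rewrite mule_ge0//; first by rewrite lee_fin invr_ge0 fine_ge0.
by apply: integral_ge0 => z _; rewrite lee_fin normc_ge0.
Qed.

Lemma sup_Osc_ge0 f a : (0 < n)%N -> 0 < a -> (0 <= sup_Osc f a)%E.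
Proof.
move=> n0 a0; pose l := Num.min 1 a.
have l0 : 0 < l by rewrite lt_min ltr01.
apply: (le_trans (Osc_ge0 f (cube 0 l))); apply: ereal_sup_ubound.
exists (cube 0 l) => //; split; first by exists 0, l.
have [_ ->] := @lebesgue_cube_gt0 R n 0 l l0.
rewrite lee_fin -exprM; apply: (@le_trans _ _ l); last by rewrite ge_min lexx orbT.
by rewrite ler_iXnr ?muln_gt0 ?(ltW l0)// ge_min lexx.
Qed.

Lemma classB_sub_VMO : (0 < n)%N -> classB R n `<=` VMO R n.
Proof.
move=> n0 f [Lf /(cvge_at_right0 (fun t _ => BMOnorm_ge0 t f)) fB].
have [M fM] := Linfty_ess_bounded Lf; split.
- exact: ess_bounded_loc_integrable fM.
- by exists (2 * M) => E; exact: ess_bounded_Osc_le.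
apply/(cvge_at_right0 (u := sup_Osc f)) => [a a0|e e0]; first exact: sup_Osc_ge0.
pose K : R := (4 * pi) ^+ n * expR (n%:R / 2).
have K0 : 0 < K by rewrite mulr_gt0 ?expR_gt0// exprn_gt0// mulr_gt0// pi_gt0.
have e4 : 0 < e / 4 by rewrite divr_gt0.
have b0 : 0 < e / 4 / Num.sqrt K by rewrite divr_gt0 ?sqrtr_gt0.
have [d d0 dB] := fB _ b0; exists (d ^+ n); first exact: exprn_gt0.
move=> a a0 ad; apply: ge_ereal_sup => _ [E [[c [l [l0 ->]]]] + <-].
have [V0 ->] := lebesgue_cube_gt0 c l0; rewrite lee_fin => Va.
have ld : l ^+ 2 < d.
  by rewrite -(ltr_pXn2r n0) ?nnegrE ?sqr_ge0 ?(ltW d0)// (le_lt_trans Va).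
have l20 : 0 < l ^+ 2 by rewrite exprn_gt0.
have -> : e = 4 * (e / 4) by field.
apply: (Osc_cube_le_MO fM l0 e4); rewrite -/K.
have := (BMOnorm_leP (l ^+ 2) f (ltW b0)).1 (dB _ l20 ld) c.
by rewrite expr_div_n sqr_sqrtr// ltW.
Qed.

Lemma VMO_Linfty_sub_classB : (0 < n)%N -> VMO R n `&` Linfty R n `<=` classB R n.
Proof.
move=> n0 f [[_ _ fV] Lf]; split => //; have [M fM] := Linfty_ess_bounded Lf.
have {}fV := (cvge_at_right0 (u := sup_Osc f) (fun a => @sup_Osc_ge0 f a n0)).1 fV.
apply/(cvge_at_right0 (fun t _ => BMOnorm_ge0 t f)) => e e0.
have [_ M0 _] := fM; have e20 : 0 < e ^+ 2 by rewrite exprn_gt0.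
pose Q : R := 2 ^+ n * (2 * M) ^+ 2.
have Q0 : 0 <= Q by rewrite /Q mulr_ge0 ?exprn_ge0// mulr_ge0.
pose x := 8 * Q / e ^+ 2 + 1.
have x0 : 0 < x by rewrite ltr_pwDr// divr_ge0 ?mulr_ge0// ltW.
pose s := 32 * x; have s0 : 0 < s by rewrite mulr_gt0.
have Qs : 8 * Q * expR (- (s / 32)) <= e ^+ 2.
  have -> : s / 32 = x by rewrite /s mulrC mulKf.
  have := expR_ge1Dx x; rewrite expRN => xe.
  rewrite ler_pdivrMr ?expR_gt0//.
  apply: (@le_trans _ _ (e ^+ 2 * (8 * Q / e ^+ 2))).
    by rewrite [leRHS]mulrC divfK// gt_eqF.
  rewrite ler_wpM2l ?(ltW e20)//; apply: le_trans xe; rewrite /x; lra.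
pose A := 2 * M * (s / (4 * pi)) ^+ n.
have A0 : 0 <= A.
  by rewrite /A mulr_ge0 ?mulr_ge0// exprn_ge0// divr_ge0 ?(ltW s0)// mulr_ge0// pi_ge0.
pose del := e ^+ 2 / (8 * (A + 1)).
have A10 : 0 < A + 1 by rewrite ltr_wpDl.
have del0 : 0 < del by rewrite divr_gt0// mulr_gt0.
have [d d0 dV] := fV _ del0.
exists (Num.min 1 d / s); first by rewrite divr_gt0// lt_min ltr01.
move=> t t0; rewrite ltr_pdivlMr// mulrC lt_min => /andP[st1 std].
have st0 : 0 < s * t by rewrite mulr_gt0.
apply/(BMOnorm_leP t f (ltW e0)) => w.
have [E [cE EV MOE]] := MO_le_Osc fM w t0 s0.
have OscE : (Osc E f <= del%:E)%E.
  apply: (le_trans _ (dV ((s * t) ^+ n) (exprn_gt0 _ st0) _)).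
    by apply: ereal_sup_ubound; exists E => //; split => //; rewrite EV.
  by rewrite (le_lt_trans _ std)// ler_iXnr// ltW.
apply: (le_trans MOE).
apply: (@le_trans _ _ (4%:E * (A%:E * del%:E +
    (2 ^+ n * expR (- (s / 32)) * (2 * M) ^+ 2)%:E))%E).
  apply: lee_wpmul2l => //; rewrite leeD2r// lee_wpmul2l//.
rewrite -!(EFinM, EFinD) lee_fin [X in 4 * (_ + X)]mulrAC -/Q.
have : A * del <= e ^+ 2 / 8.
  rewrite /del mulrA ler_pdivrMr ?mulr_gt0//.
  have -> : e ^+ 2 / 8 * (8 * (A + 1)) = e ^+ 2 * (A + 1) by field.
  by rewrite mulrC ler_wpM2l ?(ltW e20)// lerDl.
by have : Q * expR (- (s / 32)) <= e ^+ 2 / 8; lra.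
Qed.

End classes.

Theorem theorem5p7 (R : realType) (n : nat) (n_gt0 : (0 < n)%N) :
  classA R n = classB R n /\ classB R n = VMO R n `&` Linfty R n.
Proof.
split; apply/seteqP; split.
- exact: classA_sub_classB.
- exact: classB_sub_classA.
- by move=> f fB; split; [exact: classB_sub_VMO|case: fB].
- exact: VMO_Linfty_sub_classB.
Qed.
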